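(* Let $p$ be a prime, $K_0/\mathbb{Q}_p$ a finite extension with uniformizer $\pi$ and residue field $k_0$, $K/K_0$ finite unramified, $L/K$ finite, $n=[L:K_0]$, and $M/L$ a finite unramified extension with Galois group of order $p^m$. Let $F$ be a Honda formal group over $\mathcal{O}_K$ relative to $K/K_0$ and $\pi$, of height $h$, and suppose $W_F\cap F(\mathfrak{p}_L)=W_F\cap F(\mathfrak{p}_M)=W^s_F$ for some $s\ge1$. Then $\dim_{k_0}\big(F(\mathfrak{p}_L)/[\pi]_F(F(\mathfrak{p}_L))\big)=n+h$.
   Context: Honda formal groups: let $q=|k_0|$ and $\varphi$ the Frobenius of $K/K_0$. $\mathcal{O}_{K,\varphi}[[T]]$ is the noncommutative power series ring with $Ta=\varphi(a)T$, acting on $K[[X]]$ by $T*g(X)=g^{\varphi}(X^q)$. A type is $u=\pi+\sum_{i\ge1}a_iT^i$, $a_i\in\mathcal{O}_K$, of height $h$ = least $i$ with $a_i$ a unit. A one-dimensional formal group $F$ over $\mathcal{O}_K$ with logarithm $f$ is Honda of type $u$ if $u*f\equiv0\pmod\pi$; its height is that of $u$. There is an embedding $\mathcal{O}_{K_0}\hookrightarrow\mathrm{End}_{\mathcal{O}_K}(F)$, $a\mapsto[a]_F$, $f\circ[a]_F=af$. $F(\mathfrak{p}_E)$ is the maximal ideal of $\mathcal{O}_E$ with group law $F(x,y)$, an $\mathcal{O}_{K_0}$-module via $[a]_F$. $W^k_F=\{x\in\mathfrak{p}_{K^{\mathrm{alg}}}:[\pi^k]_F(x)=0\}$, $W_F=\bigcup_k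 W^k_F$. *)

(* Defs.v *)
From HB Require Import structures.
From mathcomp Require Import all_boot all_order all_algebra all_fingroup all_field.
From mathcomp Require Import boolp classical_sets reals.
From mathcomp Require Import mpoly.

Set Implicit Arguments.
Unset Strict Implicit.
Unset Printing Implicit Defensive.

Import Order.TTheory GRing.Theory Num.Theory.
Local Open Scope classical_set_scope.
Local Open Scope ring_scope.

Section AbsoluteValues.
Variables (R : realType) (F : fieldType) (nu : F -> R).

Definition nonarch_abs : Prop :=
  [/\ forall x, 0 <= nu x,
      forall x, nu x = 0 <-> x = 0,
      forall x y, nu (x * y) = nu x * nu y
    & forall x y, nu (x + y) <= Num.max (nu x) (nu y)].

Definition seq_to (u : nat -> F) (l : F) : Prop :=
  forall e : R, 0 < e ->
    exists n0 : nat, forall n : nat, (n0 <= n)%N -> nu (u n - l) < e.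

Definition cauchy_seq (u : nat -> F) : Prop :=
  forall e : R, 0 < e ->
    exists n0 : nat, forall m n : nat,
      (n0 <= m)%N -> (n0 <= n)%N -> nu (u m - u n) < e.

(* (F, nu) is the completion of Q for the p-adic absolute value normalised by
   |p| = 1/p. The third clause also forces characteristic 0, so that [ratr] is
   the embedding of Q into F. *)
Definition is_Qp (p : nat) : Prop :=
  [/\ prime p,
      nonarch_abs,
      forall n : nat, (0 < n)%N -> nu n%:R = p%:R ^- logn p n,
      forall (x : F) (e : R), 0 < e -> exists r : rat, nu (x - ratr r) < e
    & forall u : nat -> F, cauchy_seq u -> exists l, seq_to u l].

End AbsoluteValues.

Section LocalFields.
Variables (R : realType) (Q : fieldType) (N : fieldExtType Q) (nu : N -> R).

Definition int_ring (E : {vspace N}) : set N := [set x | x \in E /\ nu x <= 1].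

Definition max_ideal (E : {vspace N}) : set N := [set x | x \in E /\ nu x < 1].

Definition uniformizer (E : {vspace N}) (pi : N) : Prop :=
  pi \in E /\ max_ideal E = [set pi * y | y in int_ring E].

(* The maximal ideal of E' is generated by that of E, i.e. the ramification
   index is 1. Separability of the residue extension is automatic here, residue
   fields of finite extensions of Q_p being finite. *)
Definition unramified (E E' : {vspace N}) : Prop :=
  max_ideal E' =
  [set z | exists x y, [/\ max_ideal E x, int_ring E' y & z = x * y]].

(* k is the residue field of E, with reduction map red; the values of red
   outside the ring of integers are irrelevant. *)
Definition residue_map (E : {vspace N}) (k : fieldType) (red : N -> k) : Prop :=
  [/\ red 1 = 1,
      forall x y, int_ring E x -> int_ring E y -> red (x + y) = red x + red y,
      forall x y, int_ring E x -> int_ring E y -> red (x * y) = red x * red y,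
      forall c : k, exists2 x, int_ring E x & red x = c
    & forall x, int_ring E x -> red x = 0 <-> max_ideal E x].

End LocalFields.

(* A power series in one variable is its coefficient sequence, [f i] being the
   coefficient of X^i; a power series in two variables is [F : nat -> nat -> A],
   with [F i j] the coefficient of X^i Y^j. [ps_trunc1] and [ps_trunc2] evaluate
   the truncations, transporting coefficients along [c]. *)
Section PowerSeries.
Variables (A B : nzRingType) (c : A -> B).

Definition ps_trunc1 (f : nat -> A) (n : nat) (x : B) : B :=
  \sum_(i < n) c (f i) * x ^+ i.

Definition ps_trunc2 (F : nat -> nat -> A) (n : nat) (x y : B) : B :=
  \sum_(i < n) \sum_(j < n) c (F i j) * (x ^+ i * y ^+ j).

End PowerSeries.

Section Evaluation.
Variables (R : realType) (A B : fieldType) (c : A -> B) (nu : B -> R).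

Definition ps_sum1 (f : nat -> A) (x s : B) : Prop :=
  seq_to nu (fun n => ps_trunc1 c f n x) s.

Definition ps_sum2 (F : nat -> nat -> A) (x y s : B) : Prop :=
  seq_to nu (fun n => ps_trunc2 c F n x y) s.

(* The sum of the series, and 0 if it does not converge. *)
Definition ps_eval1 (f : nat -> A) (x : B) : B := xget 0 (ps_sum1 f x).

Definition ps_eval2 (F : nat -> nat -> A) (x y : B) : B :=
  xget 0 (ps_sum2 F x y).

End Evaluation.

Definition eq_mod_deg (A : nzRingType) (d n : nat) (P S : {mpoly A[d]}) : Prop :=
  forall m : 'X_{1..d}, (mdeg m < n)%N -> P@_m = S@_m.

Section FormalGroups.
Variables (R : realType) (Q : fieldType) (N : fieldExtType Q) (nu : N -> R).

(* As F has no constant term, an identity between composites of power series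
   holds iff for every n it holds modulo total degree n for truncations. *)
Definition formal_group (K : {vspace N}) (F : nat -> nat -> N) : Prop :=
  [/\ forall i j, int_ring nu K (F i j),
      forall i, F i 0%N = (i == 1%N)%:R,
      forall i j, F i j = F j i
    & forall n : nat,
        let X := 'X_(@Ordinal 3 0 isT) : {mpoly N[3]} in
        let Y := 'X_(@Ordinal 3 1 isT) : {mpoly N[3]} in
        let Z := 'X_(@Ordinal 3 2 isT) : {mpoly N[3]} in
        let Fn := ps_trunc2 (@mpolyC 3 N) F n in
        eq_mod_deg n (Fn (Fn X Y) Z) (Fn X (Fn Y Z))].

Definition logarithm (K : {vspace N}) (F : nat -> nat -> N) (f : nat -> N) : Prop :=
  [/\ forall i, f i \in K,
      f 0%N = 0,
      f 1%N = 1
    & forall n : nat,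
        let X := 'X_(@Ordinal 2 0 isT) : {mpoly N[2]} in
        let Y := 'X_(@Ordinal 2 1 isT) : {mpoly N[2]} in
        let Fn := ps_trunc2 (@mpolyC 2 N) F n in
        let fn := ps_trunc1 (@mpolyC 2 N) f n in
        eq_mod_deg n (fn (Fn X Y)) (fn X + fn Y)].

(* g = [a]_F, the unique series without constant term with f o g = a f. *)
Definition fg_mult (f : nat -> N) (a : N) (g : nat -> N) : Prop :=
  g 0%N = 0 /\
  forall n i : nat, (i < n)%N ->
    (ps_trunc1 (@polyC N) f n (ps_trunc1 (@polyC N) g n 'X))`_i = a * f i.

(* A twisted series u = \sum_i a_i T^i is its coefficient sequence. *)
Definition honda_type (K : {vspace N}) (pi : N) (a : nat -> N) : Prop :=
  a 0%N = pi /\ forall i, (0 < i)%N -> int_ring nu K (a i).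

Definition type_height (a : nat -> N) (h : nat) : Prop :=
  [/\ (0 < h)%N, nu (a h) = 1
    & forall i, (0 < i < h)%N -> nu (a i) != 1].

(* The coefficient of X^n in u * f = \sum_i a_i f^(phi^i)(X^(q^i)), for f
   without constant term and q > 1. *)
Definition type_act (phi : N -> N) (q : nat) (a f : nat -> N) (n : nat) : N :=
  \sum_(i < n.+1 | (q ^ i %| n)%N) a i * iter i phi (f (n %/ q ^ i)%N).

Definition honda_of_type (K : {vspace N}) (pi : N) (phi : N -> N) (q : nat)
    (a f : nat -> N) : Prop :=
  forall n, exists2 y, int_ring nu K y & type_act phi q a f n = pi * y.

(* theta : F(p_L) -> V exhibits V as the k0-vector space
   F(p_L) / [pi]_F(F(p_L)), where k0 is the residue field of K0 via red. *)
Definition is_quotient_mod_pi (K0 L : {vspace N}) (pi : N)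
    (F : nat -> nat -> N) (br : N -> nat -> N)
    (k0 : fieldType) (red : N -> k0) (V : vectType k0) (theta : N -> V) : Prop :=
  let pL := max_ideal nu L in
  [/\ forall x y, pL x -> pL y ->
        theta (ps_eval2 idfun nu F x y) = theta x + theta y,
      forall a x, int_ring nu K0 a -> pL x ->
        theta (ps_eval1 idfun nu (br a) x) = red a *: theta x,
      forall v : V, exists2 x, pL x & theta x = v
    & forall x, pL x ->
        theta x = 0 <->
        exists2 y, pL y & x = ps_eval1 idfun nu (br pi) y].

End FormalGroups.

(* W^k_F, inside an algebraic closure C of the field of coefficients. *)
Definition fg_torsion (R : realType) (N C : fieldType) (iota : N -> C)
    (abs : C -> R) (pi : N) (br : N -> nat -> N) (k : nat) : set C :=
  [set x | abs x < 1 /\ ps_sum1 iota abs (br (pi ^+ k)) x 0].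

(* Main.v *)
From HB Require Import structures.
From mathcomp Require Import all_boot all_order all_algebra all_fingroup all_field.
From mathcomp Require Import boolp classical_sets reals.
From mathcomp Require Import mpoly ring lra zify.
Require Import Defs.

(** Let [g] be multiplication by [pi] on [F(p_L)]. On the ball [B_2] of radius
    [|pi|^2] it is injective, with image the ball [B_3] of radius [|pi|^3] (the
    contraction [x - (g(x) - t) / pi]). As [F]-cosets of a ball are additive
    cosets, [B_2] has finite index in [F(p_L)] and [B_2 / B_3 = O_L / pi O_L] has
    [q^n] elements. The Herbrand quotient of [g] is the same on [F(p_L)] and on
    [B_2], so the cokernel of [g] has [q^n |ker g|] elements, and [ker g] is
    [W^1], which lies in [L] since it is contained in [W^s].

    To count [W^1], Honda's functional equation shows that [g] is integral, that
    its reduction starts with a unit times [X^(q^h)], and that its derivative is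
    [pi] times an integral series with constant term 1. Hence a long truncation of
    [g] has exactly [q^h] roots in the open unit disc of [Kalg], at mutual
    distances at least [|pi|]; each lies within [|pi|^2] of a unique zero of [g],
    obtained by subtracting, in the group law, the small preimage of its image. *)

Set Implicit Arguments.
Unset Strict Implicit.
Unset Printing Implicit Defensive.

Import Order.TTheory GRing.Theory Num.Theory.
Local Open Scope classical_set_scope.
Local Open Scope ring_scope.

(** Two obstacles shape the argument. An algebraic closure of [Q_p] is not complete, so a series
    need not have a sum in [Kalg]: the zero close to a root [r] of a truncation is constructed in
    [N(r)], which is finite over [Q_p] and hence complete, and evaluation is therefore developed
    over an arbitrary complete subring. And series are coefficient sequences, whose composites
    appear only through truncations: an identity between composites is proved modulo degree [n] by
    applying the logarithm and cancelling it, then carried to points of absolute value at most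
    [r < 1] with an error [r ^+ n].

    The radius [|pi|^2] is small enough for the linear term [pi X] to govern [g], and lies below the
    separation [|pi|] of the roots, so that distinct roots yield distinct zeros. The index
    computation gives only the number of elements of the cokernel; the dimension follows because
    scalars congruent modulo [pi] act alike on the cokernel, which makes it a space over [k0]. *)

(** * Nonarchimedean absolute values, limits, completeness of finite-dimensional spans *)

Section NonArchimedean.
Variables (R : realType) (C : fieldType) (abs : C -> R).
Hypothesis habs : nonarch_abs abs.

Lemma abs_ge0 x : 0 <= abs x. Proof. by case: habs. Qed.
Lemma absM x y : abs (x * y) = abs x * abs y. Proof. by case: habs. Qed.
Lemma absD_le x y : abs (x + y) <= Num.max (abs x) (abs y).
Proof. by case: habs. Qed.

Lemma abs0 : abs 0 = 0. Proof. by case: habs => _ h _ _; apply/h. Qed.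

Lemma abs_eq0 x : (abs x == 0) = (x == 0).
Proof. by case: habs => _ h _ _; apply/eqP/eqP => /h. Qed.

Lemma abs_gt0 x : (0 < abs x) = (x != 0).
Proof. by rewrite lt_neqAle abs_ge0 andbT eq_sym abs_eq0. Qed.

Lemma abs1 : abs 1 = 1.
Proof.
have n0 : abs 1 != 0 by rewrite abs_eq0 oner_eq0.
by apply: (mulfI n0); rewrite -absM !mulr1.
Qed.

Lemma absX x n : abs (x ^+ n) = abs x ^+ n.
Proof. by elim: n => [|n IH]; rewrite ?expr0 ?abs1 // !exprS absM IH. Qed.

Lemma absN x : abs (- x) = abs x.
Proof.
have h : abs (-1) = 1.
  have : abs (-1) ^+ 2 = 1 by rewrite -absX sqrrN expr1n abs1.
  by move/eqP; rewrite sqrp_eq1 ?abs_ge0 // => /eqP.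
by rewrite -mulN1r absM h mul1r.
Qed.

Lemma absC x y : abs (x - y) = abs (y - x).
Proof. by rewrite -absN opprB. Qed.

Lemma absV x : abs x^-1 = (abs x)^-1.
Proof.
have [->|x0] := eqVneq x 0; first by rewrite invr0 abs0 invr0.
by apply: (mulfI (x := abs x)); rewrite ?abs_eq0 // -absM !mulfV ?abs1 ?abs_eq0.
Qed.

Lemma absD_bound x y c : abs x <= c -> abs y <= c -> abs (x + y) <= c.
Proof. by move=> hx hy; rewrite (le_trans (absD_le x y)) // ge_max hx. Qed.

Lemma absB_bound x y c : abs x <= c -> abs y <= c -> abs (x - y) <= c.
Proof. by move=> hx hy; apply: absD_bound; rewrite ?absN. Qed.

Lemma absD_lt x y c : abs x < c -> abs y < c -> abs (x + y) < c.
Proof. by move=> hx hy; rewrite (le_lt_trans (absD_le x y)) // gt_max hx. Qed.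

Lemma absB_lt x y c : abs x < c -> abs y < c -> abs (x - y) < c.
Proof. by move=> hx hy; apply: absD_lt; rewrite ?absN. Qed.

Lemma abs_trans x y z c : abs (x - y) <= c -> abs (y - z) <= c -> abs (x - z) <= c.
Proof. by move=> hx hy; have := absD_bound hx hy; rewrite addrA subrK. Qed.

Lemma abs_sum I (r : seq I) (P : pred I) (G : I -> C) c : 0 <= c ->
  (forall i, P i -> abs (G i) <= c) -> abs (\sum_(i <- r | P i) G i) <= c.
Proof.
by move=> c0 h; apply: (big_ind (fun x => abs x <= c)) => //;
  [rewrite abs0|move=> x y; apply: absD_bound].
Qed.

Lemma abs_sum_lt I (r : seq I) (P : pred I) (G : I -> C) c : 0 < c ->
  (forall i, P i -> abs (G i) < c) -> abs (\sum_(i <- r | P i) G i) < c.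
Proof.
by move=> c0 h; apply: (big_ind (fun x => abs x < c)) => //;
  [rewrite abs0|move=> x y; apply: absD_lt].
Qed.

Lemma abs_dominant x y : abs x < abs y -> abs (x + y) = abs y.
Proof.
move=> h; apply/eqP; rewrite eq_le; apply/andP; split.
  by apply: absD_bound => //; apply: ltW.
rewrite leNgt; apply/negP => h2.
have := absB_lt h2 h; rewrite addrC addKr ltxx //.
Qed.

Lemma abs_close x y : abs (x - y) < abs y -> abs x = abs y.
Proof. by move/abs_dominant; rewrite subrK. Qed.

Lemma absM_le1 x y c : abs x <= 1 -> abs y <= c -> abs (x * y) <= c.
Proof. by move=> hx hy; rewrite absM -[c]mul1r ler_pM // abs_ge0. Qed.

Lemma absX_le1 x n : abs x <= 1 -> abs (x ^+ n) <= 1.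
Proof. by move=> hx; rewrite absX exprn_ile1 // abs_ge0. Qed.

Lemma abs_nat n : abs n%:R <= 1.
Proof.
by elim: n => [|n IH]; rewrite ?abs0 // -natr1; apply: absD_bound; rewrite ?abs1.
Qed.

(** Bernoulli's inequality for [r^-1], then the Archimedean property. *)
Lemma expr_small (r e : R) : 0 <= r < 1 -> 0 < e -> exists n, r ^+ n < e.
Proof.
case/andP=> r0 r1 e0; have [->|rn0] := eqVneq r 0; first by exists 1; rewrite expr1.
have rp : 0 < r by rewrite lt_neqAle eq_sym rn0.
have d0 : 0 < r^-1 - 1 by rewrite subr_gt0 invf_gt1.
have bern n : 1 + (r^-1 - 1) *+ n <= r^-1 ^+ n.
  elim: n => [|n IH]; first by rewrite mulr0n addr0 expr0.
  have h0 : 0 <= (r^-1 - 1) *+ n by rewrite mulrn_wge0 // ltW.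
  rewrite exprS mulrSr; apply: le_trans (_ : r^-1 * (1 + (r^-1 - 1) *+ n) <= _); last first.
    by rewrite ler_pM2l // invr_gt0.
  have -> : r^-1 * (1 + (r^-1 - 1) *+ n) =
     1 + ((r^-1 - 1) *+ n + (r^-1 - 1)) + (r^-1 - 1) * ((r^-1 - 1) *+ n) by ring.
  by rewrite lerDl mulr_ge0 // ltW.
have := archi_boundP (_ : 0 <= e^-1 / (r^-1 - 1)).
rewrite divr_ge0 ?invr_ge0 ?(ltW d0) ?(ltW e0) // => /(_ isT); set n := Num.bound _.
rewrite ltr_pdivrMr // mulr_natl => hn; exists n.
have h : e^-1 < r^-1 ^+ n by apply: (lt_le_trans hn); apply: le_trans (bern n); rewrite lerDr.
by rewrite -[r]invrK exprVn -[e]invrK ltf_pV2 ?posrE ?invr_gt0 ?exprn_gt0 ?invr_gt0.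
Qed.

Lemma expr_small_all (r e : R) : 0 <= r < 1 -> 0 < e ->
  exists n0, forall n, (n0 <= n)%N -> r ^+ n < e.
Proof.
move=> hr e0; have [n0 h] := expr_small hr e0; exists n0 => n hn.
by apply: le_lt_trans h; rewrite ler_wiXn2l //; lra.
Qed.

(** This is how congruences modulo degree [n], for all [n], become equalities between sums of
    series. *)
Lemma abs_le_all0 (x : C) (r : R) : 0 <= r < 1 ->
  (exists n0, forall n, (n0 <= n)%N -> abs x <= r ^+ n) -> x = 0.
Proof.
move=> hr [n0 h]; apply/eqP; rewrite -abs_eq0; apply/eqP/le_anti; rewrite abs_ge0 andbT.
rewrite leNgt; apply/negP => /(expr_small_all hr)[n1 h1].
have := lt_le_trans (h1 _ (leq_maxr n0 n1)) (h _ (leq_maxl n0 n1)).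
by rewrite ltxx.
Qed.

Lemma seq_to_uniq u l l' : seq_to abs u l -> seq_to abs u l' -> l = l'.
Proof.
move=> h h'; apply/eqP; rewrite -subr_eq0 -abs_eq0; apply/negPn/negP => n0.
have p : 0 < abs (l - l') by rewrite lt_neqAle abs_ge0 eq_sym n0.
have [n1 h1] := h _ p; have [n2 h2] := h' _ p.
have := absB_lt (h2 _ (leq_maxr n1 n2)) (h1 _ (leq_maxl n1 n2)).
by rewrite opprB addrC addrA subrK ltxx.
Qed.

Lemma seq_to_bound u l x c : seq_to abs u l ->
  (exists n0, forall n, (n0 <= n)%N -> abs (u n - x) <= c) -> abs (l - x) <= c.
Proof.
move=> h [n0 hb]; rewrite leNgt; apply/negP => cl.
have p : 0 < abs (l - x) by apply: le_lt_trans cl; apply: le_trans (hb n0 _); rewrite ?abs_ge0.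
have [n1 h1] := h _ p.
have h2 := h1 _ (leq_maxr n0 n1); have h3 := hb _ (leq_maxl n0 n1).
rewrite absC in h2; have := absD_lt h2 (le_lt_trans h3 cl).
by rewrite addrA subrK ltxx.
Qed.

Lemma seq_to_approx u l (r : R) : 0 <= r < 1 ->
  (forall n, abs (u n - l) <= r ^+ n) -> seq_to abs u l.
Proof.
move=> hr h e e0; have [n0 h0] := expr_small_all hr e0.
by exists n0 => n hn; apply: le_lt_trans (h0 n hn).
Qed.

Lemma seq_to_cauchy u l : seq_to abs u l -> cauchy_seq abs u.
Proof.
move=> h e e0; have [n0 h0] := h e e0; exists n0 => m n hm hn.
have := absB_lt (h0 m hm) (h0 n hn); rewrite opprB addrA subrK //.
Qed.

(** By the ultrametric inequality consecutive differences control all differences; the explicit rate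
    in the second clause survives in the limit and bounds truncation errors. *)
Lemma cauchy_steps u (r : R) : 0 <= r < 1 ->
  (forall n, abs (u n.+1 - u n) <= r ^+ n) -> cauchy_seq abs u /\
  forall n m, (n <= m)%N -> abs (u m - u n) <= r ^+ n.
Proof.
move=> hr h.
have H n m : (n <= m)%N -> abs (u m - u n) <= r ^+ n.
  elim: m => [|m IH]; first by rewrite leqn0 => /eqP->; rewrite subrr abs0 expr0.
  rewrite leq_eqVlt => /orP[/eqP->|].
    by rewrite subrr abs0 exprn_ge0 //; case/andP: hr.
  rewrite ltnS => hn; apply: (abs_trans (y := u m)); last exact: IH.
  by apply: le_trans (h m) _; rewrite ler_wiXn2l //; lra.
split=> // e e0; have [n0 h0] := expr_small_all hr e0; exists n0 => m n hm hn.
have h1 := le_lt_trans (H _ _ hm) (h0 _ (leqnn _)).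
have h2 := le_lt_trans (H _ _ hn) (h0 _ (leqnn _)).
have := absB_lt h1 h2; rewrite opprB addrA subrK //.
Qed.

(** Completeness is relative to a predicate because the ambient field, an algebraic closure in one
    application, is not complete while its finite subextensions are. *)
Definition complete_in (E : C -> Prop) := forall u, (forall n, E (u n)) ->
  cauchy_seq abs u -> exists2 l, E l & seq_to abs u l.

Section Span.
Variables (Q : fieldType) (sigma : {rmorphism Q -> C}).
Hypothesis hQ : forall u : nat -> Q, cauchy_seq (abs \o sigma) u ->
  exists l, seq_to (abs \o sigma) u l.

(** The generators may be dependent; the recursion on the list is the one along which completeness
    is proved. *)
Fixpoint in_span (s : seq C) (x : C) : Prop :=
  if s is b :: s' then exists c y, in_span s' y /\ x = sigma c * b + y
  else x = 0.

Lemma in_spanD s x y : in_span s x -> in_span s y -> in_span s (x + y).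
Proof.
elim: s x y => [|b s IH] x y /=; first by move=> -> ->; rewrite addr0.
move=> [c [x' [hx ->]]] [d [y' [hy ->]]]; exists (c + d), (x' + y').
by split; [exact: IH|rewrite rmorphD; ring].
Qed.

Lemma in_spanZ s c x : in_span s x -> in_span s (sigma c * x).
Proof.
elim: s x => [|b s IH] x /=; first by move=> ->; rewrite mulr0.
move=> [d [x' [hx ->]]]; exists (c * d), (sigma c * x').
by split; [exact: IH|rewrite rmorphM; ring].
Qed.

Lemma in_span0 s : in_span s 0.
Proof.
elim: s => //= b s IH; exists 0, 0; split=> //; by rewrite rmorph0; ring.
Qed.

Lemma in_spanN s x : in_span s x -> in_span s (- x).
Proof. by move/(in_spanZ (-1)); rewrite rmorphN1 mulN1r. Qed.

Lemma in_span_mem s x : x \in s -> in_span s x.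
Proof.
elim: s => // b s IH; rewrite inE => /orP[/eqP->|/IH h] /=.
  by exists 1, 0; split; [exact: in_span0|rewrite rmorph1; ring].
by exists 0, x; split=> //; rewrite rmorph0; ring.
Qed.

(* A finite-dimensional space over a complete field is complete: induction on
   a generating family, a vector outside a closed subspace lying at positive
   distance from it. *)
Lemma span_complete s : complete_in (in_span s).
Proof.
elim: s => [|b s IH] u /= hu cu.
  by exists 0 => // e e0; exists 0%N => n _; rewrite hu subrr abs0.
have [hb|nb] := pselect (in_span s b).
  have hs n : in_span s (u n).
    by have [c [y [hy ->]]] := hu n; apply: in_spanD => //; apply: in_spanZ.
  have [l hl ul] := IH u hs cu; exists l => //; exists 0, l; split=> //.
  by rewrite rmorph0; ring.
have [d d0 hd] : exists2 d : R, 0 < d & forall v, in_span s v -> d <= abs (b + v).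
  apply: contrapT => hn.
  have hv n : exists v, in_span s v /\ abs (b + v) < 2^-1 ^+ n.
    apply: contrapT => hv; apply: hn; exists (2^-1 ^+ n).
      by rewrite exprn_gt0 // invr_gt0.
    by move=> v sv; rewrite leNgt; apply/negP => h; apply: hv; exists v.
  have [v hv'] := choice hv.
  have vb : seq_to abs (fun n => - v n) b.
    apply: (seq_to_approx (r := 2^-1)); first by lra.
    by move=> n; rewrite -absN opprD !opprK [v n + b]addrC ltW //; case: (hv' n).
  have [l hl vl] := IH _ (fun n => in_spanN (proj1 (hv' n))) (seq_to_cauchy vb).
  by apply: nb; rewrite (seq_to_uniq vb vl).
(* By homogeneity the distance [d] from [b] to the span bounds the coefficient of [b], so these
   coefficients form a Cauchy sequence in [Q] when the vectors do. *)
have key c v : in_span s v -> abs (sigma c) * d <= abs (sigma c * b + v).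
  move=> sv; have [->|c0] := eqVneq c 0; first by rewrite rmorph0 abs0 mul0r abs_ge0.
  have s0 : sigma c != 0 by rewrite fmorph_eq0.
  have -> : sigma c * b + v = sigma c * (b + sigma c^-1 * v).
    by rewrite mulrDr fmorphV mulrA mulfV // mul1r.
  by rewrite absM ler_wpM2l ?abs_ge0 // hd //; apply: in_spanZ.
have [c hc] := choice hu; have [y hy] := choice hc.
have cc : cauchy_seq (abs \o sigma) c.
  move=> e e0; have [n0 h0] := cu (e * d) (mulr_gt0 e0 d0); exists n0 => m n hm hn.
  rewrite -(ltr_pM2r d0) /=; apply: le_lt_trans (h0 m n hm hn).
  have -> : u m - u n = sigma (c m - c n) * b + (y m - y n).
    by rewrite (proj2 (hy m)) (proj2 (hy n)) rmorphB mulrBl opprD addrACA.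
  by apply: key; apply: in_spanD; [exact: (proj1 (hy m))|apply: in_spanN; exact: (proj1 (hy n))].
have [cl hcl] := hQ cc.
have cb : seq_to abs (fun n => sigma (c n) * b) (sigma cl * b).
  move=> e e0; have [->|b0] := eqVneq b 0.
    by exists 0%N => n _; rewrite !mulr0 subrr abs0.
  have eb : 0 < e / abs b by rewrite divr_gt0 // abs_gt0.
  have [n0 h0] := hcl _ eb; exists n0 => n hn.
  by rewrite -mulrBl absM -rmorphB -ltr_pdivlMr ?abs_gt0 //; exact: h0.
have cy : cauchy_seq abs y.
  move=> e e0; have [n0 h0] := cu e e0; have [n1 h1] := seq_to_cauchy cb e0.
  exists (maxn n0 n1) => m n; rewrite !geq_max => /andP[m0 m1] /andP[k0 k1].
  have -> : y m - y n = (u m - u n) - (sigma (c m) * b - sigma (c n) * b).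
    by rewrite (proj2 (hy m)) (proj2 (hy n)); ring.
  by apply: absB_lt; [exact: h0|exact: h1].
have [yl hyl yyl] := IH y (fun n => proj1 (hy n)) cy.
exists (sigma cl * b + yl); first by exists cl, yl.
move=> e e0; have [n0 h0] := cb e e0; have [n1 h1] := yyl e e0.
exists (maxn n0 n1) => n; rewrite geq_max => /andP[k0 k1].
have -> : u n - (sigma cl * b + yl) = (sigma (c n) * b - sigma cl * b) + (y n - yl).
  by rewrite (proj2 (hy n)); ring.
by apply: absD_lt; [exact: h0|exact: h1].
Qed.

End Span.
End NonArchimedean.

(** * Truncated power series under ring morphisms *)

Section Truncation.
Variables (A B B' : nzRingType) (c : A -> B) (c' : A -> B') (phi : {rmorphism B -> B'}).
Hypothesis hc : forall a, phi (c a) = c' a.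

Lemma ps_trunc1_morph f n x : phi (ps_trunc1 c f n x) = ps_trunc1 c' f n (phi x).
Proof.
by rewrite /ps_trunc1 rmorph_sum; apply: eq_bigr => i _; rewrite rmorphM rmorphXn hc.
Qed.

Lemma ps_trunc2_morph F n x y :
  phi (ps_trunc2 c F n x y) = ps_trunc2 c' F n (phi x) (phi y).
Proof.
rewrite /ps_trunc2 rmorph_sum; apply: eq_bigr => i _.
rewrite rmorph_sum; apply: eq_bigr => j _.
by rewrite !rmorphM !rmorphXn hc.
Qed.

End Truncation.

Lemma coef_pstrunc (N : fieldType) (g : nat -> N) M i :
  (\sum_(j < M) (g j)%:P * 'X^j)`_i = if (i < M)%N then g i else 0.
Proof.
rewrite coef_sum; case: ifP => hi.
  rewrite (bigD1 (Ordinal hi)) //= coefCM coefXn eqxx mulr1 big1 ?addr0 // => j.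
  by rewrite coefCM coefXn -val_eqE eq_sym /= => /negbTE->; rewrite mulr0.
rewrite big1 // => j _; rewrite coefCM coefXn; case: eqP => [e|]; last by rewrite mulr0.
by move: (ltn_ord j); rewrite -e hi.
Qed.

(** * The filtration of polynomials by order at the origin *)

Section DegreeFiltration.
Variables (N : fieldType) (d : nat).
Implicit Types P S T : {mpoly N[d]}.

(** Membership in the [n]-th power of the ideal of the variables: [eq_mod_deg] thus becomes a
    congruence modulo an ideal, stable under products and substitutions. *)
Definition ordge n P := forall m : 'X_{1..d}, (mdeg m < n)%N -> P@_m = 0.

Lemma eq_mod_degP n P S : eq_mod_deg n P S <-> ordge n (P - S).
Proof.
split=> h m hm; first by rewrite mcoeffB h // subrr.
by apply/eqP; rewrite -subr_eq0 -mcoeffB h.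
Qed.

Lemma ordge0 P : ordge 0 P. Proof. by []. Qed.

Lemma ordge_zero n : ordge n 0. Proof. by move=> m _; rewrite mcoeff0. Qed.

Lemma ordgeD n P S : ordge n P -> ordge n S -> ordge n (P + S).
Proof. by move=> hP hS m hm; rewrite mcoeffD hP // hS // addr0. Qed.

Lemma ordgeN n P : ordge n P -> ordge n (- P).
Proof. by move=> hP m hm; rewrite mcoeffN hP // oppr0. Qed.

Lemma ordgeB n P S : ordge n P -> ordge n S -> ordge n (P - S).
Proof. by move=> hP hS; apply: ordgeD => //; apply: ordgeN. Qed.

Lemma ordge_sym n P S : ordge n (P - S) -> ordge n (S - P).
Proof. by move/ordgeN; rewrite opprB. Qed.

Lemma ordge_trans n P S T : ordge n (P - S) -> ordge n (S - T) -> ordge n (P - T).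
Proof. by move=> h1 h2; have := ordgeD h1 h2; rewrite addrA subrK. Qed.

Lemma ordge_le n k P : (k <= n)%N -> ordge n P -> ordge k P.
Proof. by move=> kn h m hm; apply: h; apply: leq_trans kn. Qed.

Lemma ordge_sum n I (r : seq I) (p : pred I) (G : I -> {mpoly N[d]}) :
  (forall i, p i -> ordge n (G i)) -> ordge n (\sum_(i <- r | p i) G i).
Proof.
move=> h; apply: (big_ind (ordge n)) => //; first exact: ordge_zero.
by move=> x y; apply: ordgeD.
Qed.

Lemma ordgeM n k P S : ordge n P -> ordge k S -> ordge (n + k) (P * S).
Proof.
move=> hP hS m hm; rewrite mcoeffM big1 // => -[a b] /= /eqP e.
have [ha|ha] := ltnP (mdeg a) n; first by rewrite hP // mul0r.
have := congr1 (@mdeg _) e; rewrite mdegD => e'.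
rewrite [S@__]hS ?mulr0 // -(ltn_add2l (mdeg a)) -e'.
by apply: leq_trans hm _; rewrite leq_add2r.
Qed.

Lemma ordgeMl n P S : ordge n S -> ordge n (P * S).
Proof. by move=> h; have := ordgeM (@ordge0 P) h; rewrite add0n. Qed.

Lemma ordgeMr n P S : ordge n P -> ordge n (P * S).
Proof. by rewrite mulrC; apply: ordgeMl. Qed.

Lemma ordgeX i P : ordge 1 P -> ordge i (P ^+ i).
Proof.
by move=> h; elim: i => [|i IH] //; rewrite exprS -add1n; apply: ordgeM.
Qed.

(** The cofactor of [P - S] in [P ^+ i - S ^+ i] has order at least [i - 1], which is positive, so
    one degree is gained. *)
Lemma ordge_subXS k i P S : ordge 1 P -> ordge 1 S -> (1 < i)%N ->
  ordge k (P - S) -> ordge k.+1 (P ^+ i - S ^+ i).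
Proof.
move=> hP hS hi h; rewrite subrXX -addn1; apply: ordgeM => //.
apply: ordge_sum => j _.
apply: (@ordge_le (i.-1 - j + j)); first by have := ltn_ord j; lia.
by apply: ordgeM; apply: ordgeX.
Qed.

Lemma ordge_var (i : 'I_d) : ordge 1 'X_i.
Proof.
move=> m; rewrite ltnS leqn0 mdeg_eq0 => /eqP->.
by rewrite mcoeffX -mdeg_eq0 mdeg1.
Qed.

Local Notation c := (@mpolyC d N).

Lemma ordge_trunc1 g n P : g 0%N = 0 -> ordge 1 P -> ordge 1 (ps_trunc1 c g n P).
Proof.
move=> g0 hP; apply: ordge_sum => -[[|i] hi] _ /=.
  by rewrite g0 mpolyC0 mul0r; apply: ordge_zero.
by apply: ordgeMl; apply: ordge_le _ (ordgeX (i := i.+1) hP).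
Qed.

Lemma ordge_trunc2 F n P S : F 0%N 0%N = 0 -> ordge 1 P -> ordge 1 S ->
  ordge 1 (ps_trunc2 c F n P S).
Proof.
move=> F0 hP hS; apply: ordge_sum => -[i hi] _; apply: ordge_sum => -[j hj] _ /=.
case: i j hi hj => [|i] [|j] _ _; first by rewrite F0 mpolyC0 mul0r; apply: ordge_zero.
all: apply: ordgeMl; apply: ordge_le _ (ordgeM (ordgeX hP) (ordgeX hS)); lia.
Qed.

(** A series with linear term [X] can be cancelled on the left. If [P] and [S] agree modulo degree
    [k], their powers of exponent at least 2 agree modulo degree [k.+1]; comparing the linear terms
    then raises [k] by one. *)
Lemma ordge_trunc1_cancel f n P S : f 1%N = 1 -> ordge 1 P -> ordge 1 S ->
  ordge n (ps_trunc1 c f n P - ps_trunc1 c f n S) -> ordge n (P - S).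
Proof.
move=> f1 hP hS h.
case: (leqP n 1) => n1; first by apply: ordge_le n1 _; apply: ordgeB.
suff H k : (k <= n)%N -> ordge k (P - S) by apply: H.
elim: k => [|k IH] kn; first exact: ordge0.
have {}IH : ordge k (P - S) by apply: IH; apply: ltnW.
have hn : ordge k.+1 (ps_trunc1 c f n P - ps_trunc1 c f n S) by apply: ordge_le _ h.
move: hn; rewrite -sumrB (bigD1 (Ordinal n1)) //= f1 !expr1 !mul1r.
set D := \sum_(i < n | _) _ => hn.
have hD : ordge k.+1 D.
  apply: ordge_sum => -[[|[|i]] hi] //= _.
    by rewrite !expr0 subrr; apply: ordge_zero.
  by rewrite -mulrBr; apply: ordgeMl; apply: ordge_subXS.
by have := ordgeB hn hD; rewrite addrK.
Qed.

Lemma ordge_mmap k n (h : 'I_k -> {mpoly N[d]}) (P : {mpoly N[k]}) :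
  (forall i, ordge 1 (h i)) ->
  (forall m : 'X_{1..k}, (mdeg m < n)%N -> P@_m = 0) -> ordge n (mmap c h P).
Proof.
move=> hh hP; rewrite /mmap; apply: ordge_sum => m _.
have [hm|hm] := ltnP (mdeg m) n; first by rewrite hP // mpolyC0 mul0r; apply: ordge_zero.
apply: ordgeMl; apply: ordge_le hm _; rewrite mdegE /mmap1.
elim/big_rec2: _ => [|i a b _ IH] //.
by apply: ordgeM => //; apply: ordgeX.
Qed.

Lemma ordge_horner n (T : {poly N}) P : ordge 1 P ->
  (forall i, (i < n)%N -> T`_i = 0) -> ordge n (map_poly c T).[P].
Proof.
move=> hP hT; rewrite horner_coef; apply: ordge_sum => i _.
have [hi|hi] := ltnP i n.
  by rewrite coef_map /= hT // mpolyC0 mul0r; apply: ordge_zero.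
by apply: ordgeMl; apply: ordge_le hi _; apply: ordgeX.
Qed.

End DegreeFiltration.

(** * Formal identities between [F] and the series [[a]_F], deduced from the logarithm *)

Section FormalIdentities.
Variables (N : fieldType) (F : nat -> nat -> N) (f : nat -> N).
Hypotheses (F00 : F 0%N 0%N = 0) (f1 : f 1%N = 1).
Hypothesis flog : forall n : nat,
  let X := 'X_(@Ordinal 2 0 isT) : {mpoly N[2]} in
  let Y := 'X_(@Ordinal 2 1 isT) : {mpoly N[2]} in
  let Fn := ps_trunc2 (@mpolyC 2 N) F n in
  let fn := ps_trunc1 (@mpolyC 2 N) f n in
  eq_mod_deg n (fn (Fn X Y)) (fn X + fn Y).

(* [fg_mult] for coefficients in an arbitrary field. *)
Definition bracket (a : N) (g : nat -> N) := g 0%N = 0 /\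
  forall n i : nat, (i < n)%N ->
    (ps_trunc1 (@polyC N) f n (ps_trunc1 (@polyC N) g n 'X))`_i = a * f i.

Variables (d n : nat).
Local Notation c := (@mpolyC d N).
Local Notation ev1 g x := (ps_trunc1 c g n x).
Local Notation ev2 x y := (ps_trunc2 c F n x y).
Implicit Types x y : {mpoly N[d]}.

(** The hypothesis [flog] is about two generic variables; substituting elements of order 1 for them
    through [mmap] preserves the congruence. *)
Lemma log_add x y : ordge 1 x -> ordge 1 y ->
  ordge n (ev1 f (ev2 x y) - (ev1 f x + ev1 f y)).
Proof.
move=> hx hy; have /= /eq_mod_degP h := @flog n.
pose v := fun i : 'I_2 => if i == ord0 then x else y.
have hv i : ordge 1 (v i) by rewrite /v; case: eqP.
have := ordge_mmap hv h.
rewrite rmorphB rmorphD /=.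
have hc b : mmap c v (mpolyC 2 b) = c b by exact: mmapC.
rewrite !(ps_trunc1_morph hc) (ps_trunc2_morph hc).
by rewrite /= !mmapX !mmap1U.
Qed.

Lemma log_mul a g x : bracket a g -> ordge 1 x ->
  ordge n (ev1 f (ev1 g x) - c a * ev1 f x).
Proof.
move=> [g0 hg] hx.
have cx : commr_rmorph c x by move=> z; apply: mulrC.
pose T := ps_trunc1 (@polyC N) f n (ps_trunc1 (@polyC N) g n 'X) -
          a%:P * ps_trunc1 (@polyC N) f n 'X.
have hT i : (i < n)%N -> T`_i = 0.
  move=> hi; rewrite coefB hg // coefCM.
  have -> : (ps_trunc1 (@polyC N) f n 'X)`_i = f i.
    by rewrite /ps_trunc1 coef_pstrunc hi.
  exact: subrr.
have := ordge_horner hx hT; rewrite -/(horner_morph cx T).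
rewrite rmorphB rmorphM /= horner_morphC.
have hc b : horner_morph cx b%:P = c b by exact: horner_morphC.
by rewrite !(ps_trunc1_morph hc) /= horner_morphX.
Qed.

(** As in the lemmas that follow, [f] is applied to both sides, where it turns [F] into addition and
    [[a]_F] into multiplication by [a], and is then cancelled. *)
Lemma bracket_add a b g1 g2 g3 x : bracket a g1 -> bracket b g2 ->
  bracket (a + b) g3 -> ordge 1 x -> ordge n (ev2 (ev1 g1 x) (ev1 g2 x) - ev1 g3 x).
Proof.
move=> h1 h2 h3 hx.
have o1 : ordge 1 (ev1 g1 x) by apply: ordge_trunc1 => //; case: h1.
have o2 : ordge 1 (ev1 g2 x) by apply: ordge_trunc1 => //; case: h2.
have o3 : ordge 1 (ev1 g3 x) by apply: ordge_trunc1 => //; case: h3.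
apply: (ordge_trunc1_cancel f1) => //; first exact: ordge_trunc2.
apply: ordge_trans (log_add o1 o2) _; apply: ordge_sym.
apply: ordge_trans (log_mul h3 hx) _; apply: ordge_sym.
rewrite mpolyCD mulrDl opprD addrACA.
by apply: ordgeD; apply: log_mul.
Qed.

Lemma bracket_hom a g x y : bracket a g -> ordge 1 x -> ordge 1 y ->
  ordge n (ev1 g (ev2 x y) - ev2 (ev1 g x) (ev1 g y)).
Proof.
move=> hg hx hy; have g0 : g 0%N = 0 by case: hg.
have o1 : ordge 1 (ev1 g x) by apply: ordge_trunc1.
have o2 : ordge 1 (ev1 g y) by apply: ordge_trunc1.
have o3 : ordge 1 (ev2 x y) by apply: ordge_trunc2.
apply: (ordge_trunc1_cancel f1); [exact: ordge_trunc1|exact: ordge_trunc2|].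
apply: ordge_trans (log_mul hg o3) _; apply: ordge_sym.
apply: ordge_trans (log_add o1 o2) _.
apply: (@ordge_trans _ _ _ _ (c a * (ev1 f x + ev1 f y))).
  by rewrite mulrDr opprD addrACA; apply: ordgeD; apply: log_mul.
by rewrite -mulrBr; apply: ordgeMl; apply: ordge_sym; apply: log_add.
Qed.

Lemma bracket_mul a b g1 g2 g3 x : bracket a g1 -> bracket b g2 ->
  bracket (a * b) g3 -> ordge 1 x -> ordge n (ev1 g1 (ev1 g2 x) - ev1 g3 x).
Proof.
move=> h1 h2 h3 hx.
have o2 : ordge 1 (ev1 g2 x) by apply: ordge_trunc1 => //; case: h2.
have o3 : ordge 1 (ev1 g3 x) by apply: ordge_trunc1 => //; case: h3.
apply: (ordge_trunc1_cancel f1) => //; first by apply: ordge_trunc1 => //; case: h1.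
apply: ordge_trans (log_mul h1 o2) _; apply: ordge_sym.
apply: ordge_trans (log_mul h3 hx) _; apply: ordge_sym.
by rewrite mpolyCM -mulrA -mulrBr; apply: ordgeMl; apply: log_mul.
Qed.

Lemma bracket_one g x : bracket 1 g -> ordge 1 x -> ordge n (ev1 g x - x).
Proof.
move=> h hx; apply: (ordge_trunc1_cancel f1) => //.
  by apply: ordge_trunc1 => //; case: h.
by have := log_mul h hx; rewrite mpolyC1 mul1r.
Qed.

Lemma bracket_zero g x : f 0%N = 0 -> bracket 0 g -> ordge 1 x -> ordge n (ev1 g x).
Proof.
move=> f0 h hx; rewrite -[ev1 g x]subr0; apply: (ordge_trunc1_cancel f1) => //.
- by apply: ordge_trunc1 => //; case: h.
- exact: ordge_zero.
have := log_mul h hx; rewrite mpolyC0 mul0r.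
suff -> : ev1 f 0 = 0 by [].
rewrite /ps_trunc1 big1 // => -[[|i] hi] _ /=; first by rewrite f0 mpolyC0 mul0r.
by rewrite expr0n mulr0.
Qed.

End FormalIdentities.

(** * Honda's functional equation: integrality, reduction and derivative of [[pi]_F] *)

Section Honda.
Variables (R : realType) (Q : fieldType) (N : fieldExtType Q) (nu : N -> R).
Hypothesis hnu : nonarch_abs nu.
Variables (K : {subfield N}) (phi : {rmorphism N -> N}) (pi : N) (l e : nat).
Local Notation q := (l ^ e)%N.
Hypotheses (lP : prime l) (e0 : (0 < e)%N) (hl : nu l%:R <= nu pi).
Hypotheses (piK : pi \in K) (pi0 : 0 < nu pi) (pi1 : nu pi < 1) (phipi : phi pi = pi).
Hypothesis phiK : forall x, x \in K -> phi x \in K.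
Hypothesis frob : forall x, x \in K -> nu x <= 1 -> nu (phi x - x ^+ q) <= nu pi.
Hypothesis unram : forall x, x \in K -> nu x < 1 -> nu x <= nu pi.

Let q1 : (1 < q)%N.
Proof.
case: e e0 => // e' _; rewrite (leq_trans (prime_gt1 lP)) // -{1}[l]expn1.
by rewrite leq_pexp2l // prime_gt0.
Qed.

Let abs0' := abs0 hnu.

(** Membership in [K] accompanies every estimate because [phi] is controlled, and absolute values
    below 1 improve to [|pi|], only on [K]. *)
Definition bnd (c : R) (x : N) := x \in K /\ nu x <= c.

Lemma bnd_ge0 c x : bnd c x -> 0 <= c.
Proof. by case=> _; apply: le_trans; apply: abs_ge0. Qed.

Lemma bnd0 c : 0 <= c -> bnd c 0.
Proof. by move=> h; split; rewrite ?rpred0 // abs0'. Qed.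

Lemma bnd1 : bnd 1 1. Proof. by split; rewrite ?rpred1 ?(abs1 hnu). Qed.

Lemma bndD c x y : bnd c x -> bnd c y -> bnd c (x + y).
Proof.
by move=> [kx hx] [ky hy]; split; [exact: rpredD|exact: absD_bound].
Qed.

Lemma bndN c x : bnd c x -> bnd c (- x).
Proof. by move=> [kx hx]; split; rewrite ?rpredN // absN. Qed.

Lemma bndB c x y : bnd c x -> bnd c y -> bnd c (x - y).
Proof. by move=> hx hy; apply: bndD => //; apply: bndN. Qed.

Lemma bndM c d x y : bnd c x -> bnd d y -> bnd (c * d) (x * y).
Proof.
move=> [kx hx] [ky hy]; split; first exact: rpredM.
by rewrite absM // ler_pM // abs_ge0.
Qed.

Lemma bnd_le c d x : c <= d -> bnd c x -> bnd d x.
Proof. by move=> h [kx hx]; split=> //; apply: le_trans h. Qed.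

Lemma bnd_sum c I (r : seq I) (p : pred I) (G : I -> N) : 0 <= c ->
  (forall i, p i -> bnd c (G i)) -> bnd c (\sum_(i <- r | p i) G i).
Proof.
move=> c0 h; apply: (big_ind (bnd c)) => //; first exact: bnd0.
by move=> x y; apply: bndD.
Qed.

Lemma bndX x n : bnd 1 x -> bnd 1 (x ^+ n).
Proof.
by move=> h; elim: n => [|n IH]; rewrite ?exprS; [exact: bnd1|rewrite -[1]mulr1; exact: bndM].
Qed.

Lemma bnd_phi x : bnd 1 x -> bnd 1 (phi x).
Proof.
move=> [kx hx]; split; first exact: phiK.
rewrite -[phi x](subrK (x ^+ q)); apply: absD_bound => //.
  by apply: le_trans (frob kx hx) _; apply: ltW.
by apply: absX_le1.
Qed.

Lemma nu_pinat n : (0 < n)%N -> nu (l ^ n)%:R <= nu pi.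
Proof.
case: n => // n _; rewrite expnS natrM absM // -[nu pi]mulr1.
by apply: ler_pM; rewrite ?abs_ge0 // abs_nat.
Qed.

(** The iterates are bundled as ring morphisms so that they can act on polynomials through
    [map_poly]. *)
Fixpoint phin (n : nat) : {rmorphism N -> N} :=
  if n is n'.+1 then (phi \o phin n' : {rmorphism N -> N})
  else (idfun : {rmorphism N -> N}).

Lemma phinE n x : phin n x = iter n phi x.
Proof. by elim: n => //= n ->. Qed.

Lemma phin_pi n : phin n pi = pi.
Proof. by elim: n => //= n ->. Qed.

Lemma bnd_phin n x : bnd 1 x -> bnd 1 (phin n x).
Proof. by move=> h; elim: n => //= n IH; apply: bnd_phi. Qed.

Lemma phinK n x : x \in K -> phin n x \in K.
Proof. by move=> h; elim: n => //= n IH; apply: phiK. Qed.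

Definition pbnd (c : R) (P : {poly N}) := forall i, bnd c P`_i.

Lemma pbnd0 c : 0 <= c -> pbnd c 0.
Proof. by move=> h i; rewrite coef0; apply: bnd0. Qed.

Lemma pbndD c P S : pbnd c P -> pbnd c S -> pbnd c (P + S).
Proof. by move=> hP hS i; rewrite coefD; apply: bndD. Qed.

Lemma pbndN c P : pbnd c P -> pbnd c (- P).
Proof. by move=> hP i; rewrite coefN; apply: bndN. Qed.

Lemma pbnd_trans c P S T : pbnd c (P - S) -> pbnd c (S - T) -> pbnd c (P - T).
Proof. by move=> h1 h2; have := pbndD h1 h2; rewrite addrA subrK. Qed.

Lemma pbnd_le c d P : c <= d -> pbnd c P -> pbnd d P.
Proof. by move=> h hP i; apply: bnd_le h _. Qed.

Lemma pbndM c d P S : 0 <= c -> 0 <= d -> pbnd c P -> pbnd d S -> pbnd (c * d) (P * S).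
Proof.
move=> c0 d0 hP hS i; rewrite coefM; apply: bnd_sum; first exact: mulr_ge0.
by move=> j _; apply: bndM.
Qed.

Lemma pbndMl c P S : 0 <= c -> pbnd 1 P -> pbnd c S -> pbnd c (P * S).
Proof. by move=> c0 hP hS; rewrite -[c]mul1r; apply: pbndM. Qed.

Lemma pbnd_sum c I (r : seq I) (p : pred I) (G : I -> {poly N}) : 0 <= c ->
  (forall i, p i -> pbnd c (G i)) -> pbnd c (\sum_(i <- r | p i) G i).
Proof.
move=> c0 h; apply: (big_ind (pbnd c)) => //; first exact: pbnd0.
by move=> x y; apply: pbndD.
Qed.

Lemma pbndC c x : bnd c x -> pbnd c x%:P.
Proof. by move=> h i; rewrite coefC; case: eqP => // _; apply: bnd0 (bnd_ge0 h). Qed.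

Lemma pbndXn n : pbnd 1 'X^n.
Proof. by move=> i; rewrite coefXn; case: eqP => _; [exact: bnd1|exact: bnd0]. Qed.

Lemma pbndX P n : pbnd 1 P -> pbnd 1 (P ^+ n).
Proof.
move=> h; elim: n => [|n IH]; last by rewrite exprS; apply: pbndMl.
by rewrite expr0; apply: pbndC; exact: bnd1.
Qed.

Lemma pbnd_subX c P S n : 0 <= c -> pbnd 1 P -> pbnd 1 S -> pbnd c (P - S) ->
  pbnd c (P ^+ n - S ^+ n).
Proof.
move=> c0 hP hS h; rewrite subrXX mulrC; apply: pbndMl => //.
by apply: pbnd_sum => // i _; apply: pbndMl => //; apply: pbndX.
Qed.

Let pige0 : 0 <= nu pi. Proof. exact: ltW. Qed.
Let piX k : 0 <= nu pi ^+ k. Proof. exact: exprn_ge0. Qed.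
Let piX1 k : nu pi ^+ k <= 1. Proof. by rewrite exprn_ile1 // ltW. Qed.

(** The cofactor of [P - S] in [P ^+ q - S ^+ q] is congruent modulo [pi] to [q S ^+ q.-1], and [pi]
    divides [q]; raising to the power [q] therefore gains a factor [pi]. *)
Lemma pbnd_subXq k P S : (0 < k)%N -> pbnd 1 P -> pbnd 1 S ->
  pbnd (nu pi ^+ k) (P - S) -> pbnd (nu pi ^+ k.+1) (P ^+ q - S ^+ q).
Proof.
move=> k0 hP hS h; rewrite subrXX exprSr; apply: pbndM => //.
have h1 : pbnd (nu pi) (P - S).
  by apply: pbnd_le h; case: k k0 => // k _; rewrite exprS ler_piMr.
rewrite -[X in pbnd _ X](subrK (\sum_(i < q) S ^+ (q.-1 - i) * S ^+ i)).
apply: pbndD.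
  rewrite -sumrB; apply: pbnd_sum => // i _; rewrite -mulrBl mulrC.
  by apply: pbndMl; [|exact: pbndX|exact: pbnd_subX].
rewrite (eq_bigr (fun _ => S ^+ q.-1)); last first.
  by move=> i _; rewrite -exprD subnK //; have := ltn_ord i; have := q1; lia.
rewrite sumr_const card_ord -mulr_natr; apply: pbndMl => //; first exact: pbndX.
by rewrite -polyC_natr; apply: pbndC; split; [exact: rpred_nat|exact: nu_pinat].
Qed.

Lemma pbnd_subXqX r P S : pbnd 1 P -> pbnd 1 S -> pbnd (nu pi) (P - S) ->
  pbnd (nu pi ^+ r.+1) (P ^+ (q ^ r) - S ^+ (q ^ r)).
Proof.
move=> hP hS h; elim: r => [|r IH]; first by rewrite expn0 !expr1.
by rewrite expnSr !exprM; apply: pbnd_subXq => //; apply: pbndX.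
Qed.

Lemma pbnd_dream P S n : pbnd 1 P -> pbnd 1 S ->
  pbnd (nu pi) ((P + S) ^+ (l ^ n) - (P ^+ (l ^ n) + S ^+ (l ^ n))).
Proof.
move=> hP hS; elim: n => [|n IH]; first by rewrite expn0 !expr1 subrr; apply: pbnd0.
rewrite expnSr !exprM; set A := P ^+ _; set B := S ^+ _; set T := (P + S) ^+ _.
have hA : pbnd 1 A by apply: pbndX.
have hB : pbnd 1 B by apply: pbndX.
apply: (@pbnd_trans _ _ ((A + B) ^+ l)).
  by apply: pbnd_subX => //; [apply: pbndX; apply: pbndD|apply: pbndD].
have l1 := prime_gt1 lP; case: (l) l1 lP hl => // l' _ lP' hl'.
rewrite exprDn big_ord_recl big_ord_recr /= subn0 expr0 mulr1 bin0 mulr1n.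
rewrite /bump /= add1n subnn expr0 mul1r binn mulr1n.
set D := \sum_(i < _) _; have -> : A ^+ l'.+1 + (D + B ^+ l'.+1) - (A ^+ l'.+1 + B ^+ l'.+1) = D.
  by ring.
apply: pbnd_sum => // i _; have /dvdnP[k ->] : (l'.+1 %| 'C(l'.+1, 1 + i))%N.
  by apply: prime_dvd_bin => //; rewrite add1n /= ltnS ltn_ord.
rewrite -mulr_natr; apply: pbndMl => //.
  by apply: pbndMl => //; apply: pbndX.
rewrite natrM; apply: pbndMl => //.
  by rewrite -polyC_natr; apply: pbndC; split; [exact: rpred_nat|exact: abs_nat].
by rewrite -polyC_natr; apply: pbndC; split; [exact: rpred_nat|].
Qed.

(** Induction on the Horner form [P * 'X + c], the additivity of the [l ^ n]-th power modulo [pi]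
    separating the two terms. *)
Lemma pbnd_frob (psi : {rmorphism N -> N}) n P : (forall x, x \in K -> psi x \in K) ->
  (forall x, bnd 1 x -> bnd (nu pi) (psi x - x ^+ (l ^ n))) ->
  pbnd 1 P -> pbnd (nu pi) ((map_poly psi P) \Po 'X^(l ^ n) - P ^+ (l ^ n)).
Proof.
move=> psiK hpsi; elim/poly_ind: P => [|P c IH] hP.
  rewrite rmorph0 comp_poly0 expr0n; have -> : (l ^ n == 0)%N = false.
    by apply/negbTE; rewrite -lt0n expn_gt0 prime_gt0.
  by rewrite subrr; apply: pbnd0.
have hP' : pbnd 1 P.
  by move=> i; have := hP i.+1; rewrite coefD coefMX coefC /= addr0.
have hc : bnd 1 c by have := hP 0%N; rewrite coefD coefMX coefC /= add0r.
apply: pbnd_trans (_ : pbnd _ (_ - ((P * 'X) ^+ (l ^ n) + c%:P ^+ (l ^ n)))) _; last first.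
  rewrite -opprB; apply: pbndN; apply: pbnd_dream; last exact: pbndC.
  by rewrite mulrC; apply: pbndMl => //; rewrite -['X]expr1; exact: pbndXn.
rewrite rmorphD rmorphM /= map_polyX map_polyC /= comp_polyD comp_polyM comp_polyX comp_polyC.
rewrite exprMn opprD addrACA; apply: pbndD.
  by rewrite -mulrBl mulrC; apply: pbndMl => //; [exact: pbndXn|exact: IH].
by rewrite -rmorphXn -rmorphB; apply: pbndC; exact: hpsi.
Qed.

Lemma bnd_expq r x y : bnd 1 x -> bnd 1 y -> bnd (nu pi) (x - y) ->
  bnd (nu pi) (x ^+ r - y ^+ r).
Proof.
move=> hx hy h.
have /(_ 0%N) : pbnd (nu pi) (x%:P ^+ r - y%:P ^+ r).
  by apply: pbnd_subX => //; rewrite -?rmorphB; exact: pbndC.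
by rewrite -!rmorphXn -rmorphB coefC.
Qed.

Lemma frob_iter n x : bnd 1 x -> bnd (nu pi) (phin n x - x ^+ (l ^ (e * n))).
Proof.
move=> hx; elim: n => [|n IH]; first by rewrite muln0 expr1 subrr; apply: bnd0.
rewrite mulnS expnD mulnC exprM.
have h1 : bnd 1 (phin n x) by apply: bnd_phin.
have h2 : bnd (nu pi) (phin n x ^+ q - (x ^+ (l ^ (e * n))) ^+ q).
  by apply: bnd_expq => //; apply: bndX.
have h3 : bnd (nu pi) (phi (phin n x) - phin n x ^+ q).
  split; last by apply: frob; case: h1.
  by case: h1 => k1 _; rewrite rpredB ?rpredX ?phiK.
by have := bndD h3 h2; rewrite addrA subrK.
Qed.


Variables (a f : nat -> N).
Hypotheses (a0 : a 0%N = pi) (aO : forall i, (0 < i)%N -> bnd 1 (a i)).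
Hypotheses (fK : forall i, f i \in K) (f0 : f 0%N = 0) (f1 : f 1%N = 1).
Hypothesis hu : forall n, bnd (nu pi) (type_act phi q a f n).

Let aO' i : bnd 1 (a i).
Proof. by case: i => [|i]; [rewrite a0; split=> //; exact: ltW|exact: aO]. Qed.

(** With the term [i = 0] isolated, the functional equation is a recursion for [pi * F n] in terms
    of the coefficients of index [n / q ^ i], smaller than [n] when [n > 0]. *)
Lemma type_act_recl (F : nat -> N) n : type_act phi q a F n =
  pi * F n + \sum_(1 <= i < n.+1 | (q ^ i %| n)%N) a i * phin i (F (n %/ q ^ i)%N).
Proof.
rewrite /type_act big_mkcond big_ord_recl /= expn0 dvd1n divn1 a0; congr (_ + _).
rewrite [RHS]big_mkcond big_add1 /= big_mkord; apply: eq_bigr => i _.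
by rewrite /bump /= add1n; case: ifP => // _; rewrite phinE.
Qed.

Let qX0 i : (0 < q ^ i)%N.
Proof. by rewrite expn_gt0 ltnW. Qed.

Lemma divq_lt n i : (0 < n)%N -> (0 < i)%N -> (n %/ q ^ i < n)%N.
Proof.
move=> n0 i0; apply: ltn_Pdiv => //.
by case: i i0 => // i _; apply: leq_trans q1 _; rewrite -{1}[q]expn1 leq_pexp2l // ltnW.
Qed.

Let pin0 : pi != 0. Proof. by rewrite -(abs_gt0 hnu). Qed.

(** In the recursion, passing from [n] to [n / q ^ i] uses up [i] factors [q] of the index and hence
    only [r - i] of the factors [pi]; the [i >= 1] left over provide the division by [pi]. *)
Lemma log_coef_bound n r : (0 < n)%N -> ~~ (q ^ r.+1 %| n)%N -> bnd 1 (pi ^+ r * f n).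
Proof.
elim/ltn_ind: n r => n IH r n0 hr.
split; first by rewrite rpredM ?rpredX.
have : bnd (nu pi) (pi * (pi ^+ r * f n)); last first.
  by case=> _; rewrite absM // -[X in _ <= X]mulr1 ler_pM2l.
have -> : pi * (pi ^+ r * f n) = pi ^+ r * type_act phi q a f n -
    \sum_(1 <= i < n.+1 | (q ^ i %| n)%N) pi ^+ r * (a i * phin i (f (n %/ q ^ i)%N)).
  by rewrite type_act_recl -mulr_sumr; ring.
apply: bndB.
  rewrite -[nu pi]mul1r; apply: bndM => //.
  by split; [exact: rpredX|rewrite absX //].
rewrite big_nat_cond; apply: bnd_sum => // i /andP[/andP[i1 _] qi].
have ir : (i <= r)%N.
  rewrite leqNgt; apply/negP => ri; move/negP: hr; apply.
  exact: dvdn_trans (dvdn_exp2l _ ri) qi.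
have -> : pi ^+ r * (a i * phin i (f (n %/ q ^ i)%N)) =
   pi ^+ i * (a i * phin i (pi ^+ (r - i) * f (n %/ q ^ i)%N)).
  by rewrite rmorphM rmorphXn /= phin_pi -{1}(subnKC ir) exprD; ring.
rewrite -[nu pi]mulr1; apply: bndM.
  split; first exact: rpredX.
  by case: i i1 {qi ir} => // i _; rewrite absX // exprS ler_piMr.
rewrite -[1]mulr1; apply: bndM => //; apply: bnd_phin; apply: IH.
- exact: divq_lt.
- by rewrite divn_gt0 ?qX0 // dvdn_leq.
apply: contra hr => h; rewrite -(subnKC ir) -addnS expnD mulnC.
by rewrite -dvdn_divRL.
Qed.

Lemma q_part n : (0 < n)%N -> exists2 r, (q ^ r %| n)%N & ~~ (q ^ r.+1 %| n)%N.
Proof.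
move=> n0; have ex : exists r, ~~ (q ^ r %| n)%N.
  by exists n; apply/negP => /(dvdn_leq n0); rewrite leqNgt ltn_expl.
case: (ex_minnP ex) => -[|r] hr hmin; first by rewrite expn0 dvd1n in hr.
exists r => //; apply/negPn/negP => /hmin; by rewrite ltnn.
Qed.

(** The derivative of the logarithm is integral: if [q ^ r] is the exact power of [q] dividing [n],
    then [|q ^ r| <= |pi| ^ r] offsets the denominator [pi ^+ r] of [f n]. *)
Lemma deriv_log_bound n : bnd 1 (n%:R * f n).
Proof.
case: (posnP n) => [->|n0]; first by rewrite mul0r; apply: bnd0.
have [r /dvdnP[k nk] hr] := q_part n0.
have [_ h] := log_coef_bound n0 hr.
split; first by rewrite rpredM ?rpred_nat.
apply: le_trans h; rewrite !absM // ler_wpM2r ?abs_ge0 //.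
rewrite nk natrM absM // -[nu (pi ^+ r)]mul1r ler_pM ?abs_ge0 ?abs_nat //.
by rewrite natrX !absX // lerXn2r ?nnegrE ?abs_ge0 // nu_pinat.
Qed.

(** A crude exponent, from [n < q ^ n]. Being [n.-1] and not [n], it leaves one factor [pi] when a
    series divisible by [pi] is substituted in [f]. *)
Lemma log_coef_pi n : (0 < n)%N -> bnd 1 (pi ^+ n.-1 * f n).
Proof.
move=> n0; apply: log_coef_bound => //; rewrite prednK //.
by apply/negP => /(dvdn_leq n0); rewrite leqNgt ltn_expl.
Qed.

Local Notation gM g M := (\sum_(i < M) (g i)%:P * 'X^i).
Local Notation fM M := (gM f M).

Lemma logtrunc_comp M P : (fM M) \Po P = ps_trunc1 (@polyC N) f M P.
Proof.
rewrite rmorph_sum; apply: eq_bigr => i _.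
by rewrite rmorphM /= comp_polyC rmorphXn /= comp_polyX.
Qed.

Local Notation Phi i P := (map_poly (phin i) P \Po 'X^(q ^ i)).

Lemma type_act_coef (H : {poly N}) n :
  type_act phi q a (fun i => H`_i) n = (\sum_(i < n.+1) (a i)%:P * Phi i H)`_n.
Proof.
rewrite /type_act big_mkcond coef_sum; apply: eq_bigr => i _.
rewrite coefCM coef_comp_poly_Xn ?qX0 //.
by case: ifP => _; [rewrite coef_map /= phinE|rewrite mulr0].
Qed.

Lemma coefX_order (P : {poly N}) j n : P`_0 = 0 -> (n < j)%N -> (P ^+ j)`_n = 0.
Proof.
move=> P0; elim: j n => // j IH n hn; rewrite exprS coefM big1 // => -[[|i] hi] _ /=.
  by rewrite P0 mul0r.
by rewrite IH ?mulr0 //; lia.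
Qed.

(* Honda's lemma: [f o P] again satisfies [u * f = 0 mod pi], because
   [P^(phi^i)(X^(q^i)) = P^(q^i) mod pi], a congruence which raising to the power
   [q^r m] improves to one modulo [pi^(r+1)], while [pi^r f_(q^r m)] is integral
   when [q] does not divide [m]. *)
Lemma type_act_comp P n : pbnd 1 P -> P`_0 = 0 ->
  bnd (nu pi) (type_act phi q a (fun i => (fM n.+1 \Po P)`_i) n).
Proof.
move=> hP P0; set M := n.+1; rewrite type_act_coef -/M.
set V := \sum_(i < M) (a i)%:P * Phi i (fM M).
have hV j : (j < M)%N -> bnd (nu pi) V`_j.
  move=> hj; suff -> : V`_j = type_act phi q a f j by exact: hu.
  (* The sum in [type_act] stops at [i = j]. The further terms present in [V] vanish because [q ^ i]
     then exceeds [j], or because [f 0 = 0] when [j = 0]. *)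
  rewrite /V /type_act coef_sum (big_ord_widen_cond _ (fun i => (q ^ i %| j)%N)
    (fun i => a i * iter i phi (f (j %/ q ^ i)%N)) hj) [RHS]big_mkcond.
  apply: eq_bigr => i _; rewrite coefCM coef_comp_poly_Xn ?qX0 //.
  case: ifP => [/dvdn_leq qj|_]; last by rewrite mulr0.
  rewrite coef_map /= coef_pstrunc (leq_ltn_trans (leq_div _ _) hj) phinE.
  case: ifP => // /negbT; rewrite -leqNgt => ji.
  have [->|j0] := posnP j; first by rewrite div0n f0 -phinE rmorph0 mulr0.
  by have := qj j0; rewrite leqNgt (leq_trans ji) // ltnW // ltn_expl.
have hVP : bnd (nu pi) (V \Po P)`_n.
  rewrite comp_polyE coef_sum; apply: bnd_sum => // j _; rewrite coefZ.
  have [hj|hj] := ltnP j M; last by rewrite coefX_order // mulr0; apply: bnd0.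
  by rewrite mulrC -[nu pi]mul1r; apply: bndM; [exact: pbndX|exact: hV].
rewrite -[X in bnd _ X](subrK (V \Po P)`_n); apply: bndD => //.
have VP : V \Po P = \sum_(i < M) (((a i)%:P * Phi i (fM M)) \Po P) by rewrite rmorph_sum.
rewrite VP !coef_sum -sumrB; apply: bnd_sum => // i _.
rewrite -coefB /= rmorphM /= comp_polyC -mulrBr coefCM -[nu pi]mul1r; apply: bndM => //.
have hA : pbnd (nu pi) (Phi i P - P ^+ (q ^ i)).
  rewrite -!expnM; apply: pbnd_frob => //; first exact: phinK.
  exact: frob_iter.
have hPhi : pbnd 1 (Phi i P).
  rewrite -[Phi i P](subrK (P ^+ (q ^ i))); apply: pbndD; last exact: pbndX.
  by apply: pbnd_le hA; exact: ltW.
have -> : Phi i (fM M \Po P) - (Phi i (fM M) \Po P) =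
    \sum_(m < M) (phin i (f m))%:P * (Phi i P ^+ m - (P ^+ (q ^ i)) ^+ m).
  rewrite !rmorph_sum -sumrB; apply: eq_bigr => m _ /=.
  rewrite !rmorphM /= !comp_polyC !rmorphXn /= !map_polyC /= !comp_polyC.
  rewrite !map_polyX !comp_polyX !rmorphXn /= !comp_polyX -mulrBr.
  by [].
apply: pbnd_sum => // m _.
have [->|m0] := posnP m; first by rewrite !expr0 subrr mulr0; apply: pbnd0.
have [r /dvdnP[k mk] hr] := q_part m0.
have [fk hf] := log_coef_bound m0 hr.
have hX : pbnd (nu pi ^+ r.+1) (Phi i P ^+ m - (P ^+ (q ^ i)) ^+ m).
  rewrite mk mulnC !exprM; apply: pbnd_subX => //; try by do ?apply: pbndX.
  by apply: pbnd_subXqX => //; apply: pbndX.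
move=> t; rewrite coefCM; split; first by rewrite rpredM ?phinK //; case: (hX t).
rewrite absM //; case: (hX t) => _ hXt.
apply: le_trans (ler_wpM2l (abs_ge0 hnu _) hXt) _.
have [_] := bnd_phin i (conj fk hf); rewrite rmorphM rmorphXn /= phin_pi absM // absX //.
by rewrite exprSr mulrA [_ * nu (phin _ _)]mulrC => h; rewrite -[X in _ <= X]mul1r ler_wpM2r.
Qed.

(** To first order [f (P + c X^n) = f P + c X^n]: in degree at least 2 the cofactor of [c X^n] has
    no constant term, so it contributes only beyond degree [n]. *)
Lemma log_perturb M (P : {poly N}) c n j : (1 < M)%N -> (0 < n)%N -> (j <= n)%N -> P`_0 = 0 ->
  (fM M \Po (P + c%:P * 'X^n))`_j = (fM M \Po P)`_j + c * (j == n)%:R.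
Proof.
move=> M1 n0 jn P0; set P' := P + _.
have P'0 : P'`_0 = 0 by rewrite coefD coefCM coefXn (ltn_eqF n0) P0 mulr0 addr0.
apply/eqP; rewrite addrC -subr_eq; apply/eqP.
rewrite !logtrunc_comp /ps_trunc1 -coefB -sumrB coef_sum.
have hT i : ((f i)%:P * P' ^+ i - (f i)%:P * P ^+ i)`_j = c * (j == n)%:R * (f i * (i == 1%N)%:R).
  rewrite -mulrBr coefCM subrXX /P' [P + _ - P]addrC addKr -[c%:P * _ * _]mulrA coefCM coefXnM.
  case: ltngtP jn => // [jn _|-> _]; first by rewrite /= mulr0n !(mulr0, mul0r).
  rewrite /= subnn mulr1n mulr1 mulrA [f i * c]mulrC -mulrA; congr (_ * (_ * _)).
  rewrite coef_sum; case: i => [|[|i]]; first by rewrite big_ord0.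
    by rewrite big_ord1 subn0 !expr0 mulr1 coefC.
  rewrite big1 // => k _; rewrite coefM big1 // => -[[|m] hm] // _ /=.
  rewrite sub0n; case: (posnP k) => [->|k0]; last by rewrite [_ * (P ^+ _)`_0]mulrC coefX_order ?mul0r.
  by rewrite coefX_order ?mul0r // subn0.
under eq_bigr => i _ do rewrite hT.
rewrite -mulr_sumr (bigD1 (Ordinal M1)) //= f1 mul1r mulr1n.
rewrite big1 ?addr0 ?mulr1 // => i; rewrite -val_eqE /= => /negbTE->; by rewrite mulr0.
Qed.

Section Bracket.
Variables (b : N) (g : nat -> N).
Hypotheses (bO : bnd 1 b) (phib : phi b = b) (hg : bracket f b g).

(** At [j = n] this is the recursion that determines [g n] from the preceding coefficients; at
    [j < n] the last term is absent. *)
Lemma bracket_step n j : (0 < n)%N -> (j <= n)%N ->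
  (fM n.+1 \Po gM g n)`_j + g n * (j == n)%:R = b * f j.
Proof.
move=> n0 jn; case: hg => g0 /(_ n.+1 j); rewrite ltnS => /(_ jn) <-.
rewrite -log_perturb //; last by rewrite coef_pstrunc n0.
have gS : ps_trunc1 (@polyC N) g n.+1 'X = gM g n + (g n)%:P * 'X^n.
  by rewrite /ps_trunc1 big_ord_recr.
by rewrite gS logtrunc_comp.
Qed.

Lemma pbnd_pstrunc c n : 0 <= c -> (forall k, (k < n)%N -> bnd c (g k)) -> pbnd c (gM g n).
Proof.
by move=> c0 h i; rewrite coef_pstrunc; case: ifP => [/h|_] //; apply: bnd0.
Qed.

(** Let [P] be the truncation of [g] below [n]. The series [f o P] and [b f] agree below degree [n]
    and differ by [g n] there, so applying [u] makes them differ by exactly [pi * g n] in degree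
    [n]. Both results are divisible by [pi], that of [b f] because [phi] fixes [b]. *)
Lemma bracket_integral n : bnd 1 (g n).
Proof.
elim/ltn_ind: n => n IH; have [->|n0] := posnP n; first by case: hg => -> _; apply: bnd0.
set P := gM g n; have hP : pbnd 1 P by apply: pbnd_pstrunc.
have P0 : P`_0 = 0 by rewrite coef_pstrunc n0; case: hg.
pose H := fM n.+1 \Po P.
have Hj j : (j < n)%N -> H`_j = b * f j.
  by move=> jn; have := bracket_step n0 (ltnW jn); rewrite (ltn_eqF jn) mulr0 addr0.
have Hn : g n = b * f n - H`_n.
  by have := bracket_step n0 (leqnn n); rewrite eqxx mulr1 -/P -/H => <-; ring.
have phinb i : phin i b = b by elim: i => //= i ->.
have hH : bnd (nu pi) (type_act phi q a (fun i => H`_i) n) by apply: type_act_comp.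
have key : pi * g n = b * type_act phi q a f n - type_act phi q a (fun i => H`_i) n.
  rewrite !type_act_recl Hn.
  set A := \sum_(_ <= _ < _ | _) _; set B := \sum_(_ <= _ < _ | _) _.
  suff -> : B = b * A by ring.
  rewrite mulr_sumr [LHS]big_nat_cond [RHS]big_nat_cond; apply: eq_bigr => i /andP[/andP[i1 _] _].
  by rewrite Hj ?divq_lt // rmorphM /= phinb; ring.
have kn : bnd (nu pi) (pi * g n).
  by rewrite key; apply: bndB => //; rewrite -[nu pi]mul1r; apply: bndM.
case: kn => k1 k2; split.
  by rewrite -[g n](mulKf pin0) rpredM ?rpredV.
by move: k2; rewrite absM // -[X in _ <= X]mulr1 ler_pM2l.
Qed.

End Bracket.

Section Height.
Variables (h : nat) (g : nat -> N).
Hypotheses (h0 : (0 < h)%N) (ah : nu (a h) = 1).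
Hypothesis alt : forall i, (0 < i < h)%N -> nu (a i) != 1.
Hypothesis hg : bracket f pi g.

Let asmall i : (0 < i < h)%N -> bnd (nu pi) (a i).
Proof.
move=> hi; have [ka ha] := aO' i; split=> //; apply: unram => //.
by rewrite lt_neqAle alt.
Qed.

(** Below [q ^ h] the recursion involves only the [a i] with [0 < i < h], all divisible by [pi], so
    no denominator arises. *)
Lemma log_coef_low n : (n < q ^ h)%N -> bnd 1 (f n).
Proof.
elim/ltn_ind: n => n IH hn; have [->|n0] := posnP n; first by rewrite f0; apply: bnd0.
split=> //; have : bnd (nu pi) (pi * f n); last first.
  by case=> _; rewrite absM // -[X in _ <= X]mulr1 ler_pM2l.
have -> : pi * f n = type_act phi q a f n -
    \sum_(1 <= i < n.+1 | (q ^ i %| n)%N) (a i * phin i (f (n %/ q ^ i)%N)).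
  by rewrite type_act_recl addrK.
apply: bndB => //; rewrite big_nat_cond; apply: bnd_sum => // i /andP[/andP[i1 _] /(dvdn_leq n0) qi].
have ih : (i < h)%N by rewrite -(ltn_exp2l _ _ q1); apply: leq_ltn_trans qi hn.
rewrite -[nu pi]mulr1; apply: bndM; first by apply: asmall; rewrite i1.
apply: bnd_phin; apply: IH; first exact: divq_lt.
by apply: leq_ltn_trans hn; exact: leq_div.
Qed.

(** Modulo [pi] the recursion at [n = q ^ h] retains the single term [i = h], equal to
    [a h * f 1 = a h], a unit. *)
Lemma log_coef_height : nu (pi * f (q ^ h)%N) = 1.
Proof.
have qh0 : (0 < q ^ h)%N := qX0 h.
have hq : (h < (q ^ h).+1)%N by rewrite ltnS ltnW // ltn_expl.
pose D := type_act phi q a f (q ^ h) -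
    \sum_(1 <= i < (q ^ h).+1 | ((q ^ i %| q ^ h)%N && (i != h))) (a i * phin i (f (q ^ h %/ q ^ i)%N)).
have -> : pi * f (q ^ h)%N = D - a h.
  rewrite /D type_act_recl; set S := \sum_(_ <= _ < _ | _) _.
  have -> : S = a h + \sum_(1 <= i < (q ^ h).+1 | ((q ^ i %| q ^ h)%N && (i != h)))
      (a i * phin i (f (q ^ h %/ q ^ i)%N)).
    rewrite /S big_mkcond (bigD1_seq h) ?iota_uniq ?mem_index_iota ?h0 //=.
    by rewrite dvdnn divnn qh0 f1 rmorph1 mulr1 [in RHS]big_mkcondl.
  by ring.
have Db : bnd (nu pi) D.
  apply: bndB => //; rewrite big_nat_cond; apply: bnd_sum => // i.
  move=> /andP[/andP[i1 _] /andP[/(dvdn_leq qh0) qi ih]].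
  have {}ih : (i < h)%N by rewrite ltn_neqAle ih /= -(leq_exp2l _ _ q1).
  rewrite -[nu pi]mulr1; apply: bndM; first by apply: asmall; rewrite i1.
  apply: bnd_phin; apply: log_coef_low; rewrite -expnB ?(ltnW ih) ?(ltnW q1) //.
  by rewrite ltn_exp2l //; lia.
by rewrite abs_dominant ?absN // ah; apply: le_lt_trans pi1; case: Db.
Qed.

Lemma pbndXX c P n : 0 <= c -> pbnd c P -> pbnd (c ^+ n) (P ^+ n).
Proof.
move=> c0 hP; elim: n => [|n IH]; first by rewrite !expr0; apply: pbndC bnd1.
by rewrite !exprS; apply: pbndM => //; apply: exprn_ge0.
Qed.

Lemma log_comp_pi M P : pbnd (nu pi) P -> pbnd (nu pi) (fM M \Po P).
Proof.
move=> hP; rewrite logtrunc_comp; apply: pbnd_sum => // -[i hi] _ /=.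
case: i hi => [|i] hi; first by rewrite f0 mul0r; apply: pbnd0.
move=> t; rewrite coefCM; have [k1 k2] := pbndXX i.+1 pige0 hP t.
split; first by rewrite rpredM.
rewrite absM //; apply: le_trans (ler_wpM2l (abs_ge0 hnu _) k2) _.
have [_] := log_coef_pi (ltn0Sn i); rewrite absM // absX // exprSr mulrA [_ * nu (f _)]mulrC.
by move=> k; rewrite -[X in _ <= X]mul1r ler_wpM2r.
Qed.

(** As long as the preceding coefficients of [g] are divisible by [pi], so is [f] composed with
    their truncation. Hence [[pi]_F] and [pi f] have the same first nonzero coefficient modulo
    [pi]. *)
Lemma mulpi_step n : (0 < n)%N -> (forall k, (k < n)%N -> bnd (nu pi) (g k)) ->
  bnd (nu pi) (pi * f n - g n).
Proof.
move=> n0 hk; have hP := pbnd_pstrunc pige0 hk.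
have := bracket_step hg n0 (leqnn n); rewrite eqxx mulr1 => <-.
by rewrite addrK; apply: log_comp_pi.
Qed.

Lemma mulpi_low n : (n < q ^ h)%N -> bnd (nu pi) (g n).
Proof.
elim/ltn_ind: n => n IH hn; have [->|n0] := posnP n; first by case: hg => -> _; apply: bnd0.
have h1 : bnd (nu pi) (pi * f n).
  by rewrite -[nu pi]mulr1; apply: bndM; [split|exact: log_coef_low].
have := bndB h1 (mulpi_step n0 _); rewrite opprB addrC subrK; apply=> k kn.
by apply: IH => //; apply: ltn_trans hn.
Qed.

Lemma mulpi_height : nu (g (q ^ h)%N) = 1.
Proof.
have [_ h1] := mulpi_step (qX0 h) (fun k => @mulpi_low k).
rewrite -log_coef_height; apply: abs_close => //.
by rewrite absC // log_coef_height; apply: le_lt_trans pi1.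
Qed.

(** Differentiating [f o g = pi f] gives [f'(g) g' = pi f']. Here [f'] is integral with constant
    term 1, so [f'(g)] can be divided out degree by degree. *)
Lemma mulpi_deriv k : bnd (nu pi) (k.+1%:R * g k.+1).
Proof.
have gO i : bnd 1 (g i) by apply: (bracket_integral _ phipi hg); split=> //; exact: ltW.
pose M := k.+2; pose G := gM g M.
have hG : pbnd 1 G by apply: pbnd_pstrunc.
have hfd : pbnd 1 (fM M)^`().
  move=> i; rewrite coef_deriv coef_pstrunc; case: ifP => _; last by rewrite mul0rn; apply: bnd0.
  by rewrite -mulr_natl; apply: deriv_log_bound.
pose S := (fM M)^`() \Po G.
have hS : pbnd 1 S.
  rewrite /S comp_polyE; apply: pbnd_sum => // i _.
  by rewrite -mul_polyC; apply: pbndMl => //; [exact: pbndC|exact: pbndX].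
have S0 : S`_0 = 1.
  rewrite -horner_coef0 /S horner_comp [G.[0]]horner_coef0 coef_pstrunc /=.
  by case: hg => -> _; rewrite horner_coef0 coef_deriv coef_pstrunc /= f1.
have hSG i : (i <= k)%N -> bnd (nu pi) (S * G^`())`_i.
  move=> ik; rewrite -deriv_comp coef_deriv.
  have -> : (fM M \Po G)`_i.+1 = pi * f i.+1.
    case: hg => _ /(_ M i.+1) <-; last by rewrite /M; lia.
    by rewrite logtrunc_comp.
  rewrite -mulr_natl mulrCA -[nu pi]mulr1; apply: bndM; [by split|exact: deriv_log_bound].
suff H i : (i <= k)%N -> bnd (nu pi) G^`()`_i.
  by have := H k (leqnn k); rewrite coef_deriv coef_pstrunc /M ltnSn mulr_natl.
elim/ltn_ind: i => i IH ik.
have := hSG i ik; rewrite coefM big_ord_recl /= S0 mul1r subn0 => hi.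
set D := \sum_(_ < _) _ in hi; have hD : bnd (nu pi) D.
  apply: bnd_sum => // j _; rewrite -[nu pi]mul1r; apply: bndM => //.
  by apply: IH; rewrite /bump /=; have := ltn_ord j; lia.
by have := bndB hi hD; rewrite addrK.
Qed.

End Height.

End Honda.

(** * Evaluation of integral series on the open disc of a complete ring *)

Section Evaluation.
Variables (R : realType) (N C : fieldType) (iota : {rmorphism N -> C}) (abs : C -> R).
Hypothesis habs : nonarch_abs abs.
Local Notation nu x := (abs (iota x)).

Section IntegralMpoly.
Variable d : nat.
Implicit Types P S : {mpoly N[d]}.

Definition mint P := forall m, nu P@_m <= 1.

Lemma mint0 : mint 0. Proof. by move=> m; rewrite mcoeff0 rmorph0 abs0. Qed.

Lemma mintC x : nu x <= 1 -> mint x%:MP.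
Proof.
move=> hx m; rewrite mcoeffC; case: eqP => _; first by rewrite mulr1.
by rewrite mulr0 rmorph0 abs0.
Qed.

Lemma mintD P S : mint P -> mint S -> mint (P + S).
Proof. by move=> hP hS m; rewrite mcoeffD rmorphD absD_bound. Qed.

Lemma mintN P : mint P -> mint (- P).
Proof. by move=> hP m; rewrite mcoeffN rmorphN absN. Qed.

Lemma mintM P S : mint P -> mint S -> mint (P * S).
Proof.
move=> hP hS m; rewrite mcoeffM rmorph_sum; apply: abs_sum => // i _.
by rewrite rmorphM /=; apply: absM_le1.
Qed.

Lemma mintXn P n : mint P -> mint (P ^+ n).
Proof.
move=> hP; elim: n => [|n IH]; last by rewrite exprS; apply: mintM.
by rewrite expr0 -mpolyC1; apply: mintC; rewrite rmorph1 abs1.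
Qed.

Lemma mintX (i : 'I_d) : mint 'X_i.
Proof.
move=> m; rewrite mcoeffX; case: eqP => _; first by rewrite rmorph1 abs1.
by rewrite rmorph0 abs0.
Qed.

Lemma mint_sum I (r : seq I) (p : pred I) (G : I -> {mpoly N[d]}) :
  (forall i, p i -> mint (G i)) -> mint (\sum_(i <- r | p i) G i).
Proof.
move=> h; apply: (big_ind mint) => //; first exact: mint0.
by move=> x y; apply: mintD.
Qed.

Lemma mint_trunc1 g n P : (forall i, nu (g i) <= 1) -> mint P ->
  mint (ps_trunc1 (@mpolyC d N) g n P).
Proof.
by move=> hg hP; apply: mint_sum => i _; apply: mintM; [exact: mintC|exact: mintXn].
Qed.

Lemma mint_trunc2 F n P S : (forall i j, nu (F i j) <= 1) -> mint P -> mint S ->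
  mint (ps_trunc2 (@mpolyC d N) F n P S).
Proof.
move=> hF hP hS; apply: mint_sum => i _; apply: mint_sum => j _.
by do ?apply: mintM; [exact: mintC|exact: mintXn|exact: mintXn].
Qed.

(** The passage from formal to analytic statements: a congruence modulo degree [n] between integral
    polynomials becomes an error [r ^+ n] between their values. *)
Lemma abs_mmap (v : 'I_d -> C) (r : R) n P : 0 <= r <= 1 ->
  (forall i, abs (v i) <= r) -> mint P -> ordge n P -> abs (mmap iota v P) <= r ^+ n.
Proof.
move=> /andP[r0 r1] hv hP oP; rewrite /mmap; apply: abs_sum => //; first exact: exprn_ge0.
move=> m _; have [hm|hm] := ltnP (mdeg m) n.
  by rewrite oP // rmorph0 mul0r abs0 // exprn_ge0.
apply: absM_le1 => //; apply: (@le_trans _ _ (r ^+ mdeg m)); last first.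
  by rewrite ler_wiXn2l.
rewrite mdegE /mmap1; elim/big_rec2: _ => [|i a b _ IH]; first by rewrite abs1.
rewrite exprD absM // ler_pM ?abs_ge0 // absX //.
by rewrite lerXn2r ?nnegrE ?abs_ge0.
Qed.

End IntegralMpoly.

Local Notation t1 := (ps_trunc1 iota).
Local Notation t2 := (ps_trunc2 iota).
Local Notation ev1 := (ps_eval1 iota abs).
Local Notation ev2 := (ps_eval2 iota abs).

Lemma trunc1_step g n x : (forall i, nu (g i) <= 1) -> abs (t1 g n.+1 x - t1 g n x) <= abs x ^+ n.
Proof.
move=> hg; rewrite /ps_trunc1 big_ord_recr /= [_ + _ * _]addrC addrK.
by apply: absM_le1; rewrite ?absX.
Qed.

Lemma trunc2_step F n x y (r : R) : (forall i j, nu (F i j) <= 1) -> r <= 1 ->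
  abs x <= r -> abs y <= r -> abs (t2 F n.+1 x y - t2 F n x y) <= r ^+ n.
Proof.
move=> hF r1 hx hy.
have r0 : 0 <= r := le_trans (abs_ge0 habs x) hx.
have xr i : abs (x ^+ i) <= r ^+ i by rewrite absX // lerXn2r ?nnegrE ?abs_ge0.
have yr i : abs (y ^+ i) <= r ^+ i by rewrite absX // lerXn2r ?nnegrE ?abs_ge0.
have ri i : r ^+ i <= 1 by rewrite exprn_ile1.
(* From [n] to [n.+1] the square of indices gains one row and one column, whose monomials all
   contain [x ^+ n] or [y ^+ n]. *)
rewrite /ps_trunc2 big_ord_recr /= (eq_bigr (fun i : 'I_n =>
  \sum_(j < n) iota (F i j) * (x ^+ i * y ^+ j) + iota (F i n) * (x ^+ i * y ^+ n))); last first.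
  by move=> i _; rewrite big_ord_recr.
rewrite big_split /= -[X in abs (X - _)]addrA [X in abs X]addrC addKr; apply: absD_bound => //.
  apply: abs_sum => //; first exact: exprn_ge0.
  by move=> i _; apply: absM_le1 => //; apply: absM_le1 => //; apply: le_trans (xr i) _.
apply: abs_sum => //; first exact: exprn_ge0.
move=> j _; apply: absM_le1 => //; rewrite mulrC; apply: absM_le1 => //.
exact: le_trans (yr j) _.
Qed.

Lemma abs_subX x y n : abs x <= 1 -> abs y <= 1 -> abs (x ^+ n - y ^+ n) <= abs (x - y).
Proof.
move=> hx hy; rewrite subrXX mulrC; apply: absM_le1 => //.
by apply: abs_sum => // i _; apply: absM_le1 => //; apply: absX_le1.
Qed.

Lemma trunc1_lip g n x y : (forall i, nu (g i) <= 1) -> abs x <= 1 -> abs y <= 1 ->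
  abs (t1 g n x - t1 g n y) <= abs (x - y).
Proof.
move=> hg hx hy; rewrite -sumrB; apply: abs_sum; rewrite ?abs_ge0 // => i _.
by rewrite -mulrBr; apply: absM_le1 => //; apply: abs_subX.
Qed.

Lemma trunc2_lip F n x y x' y' c : (forall i j, nu (F i j) <= 1) ->
  abs x <= 1 -> abs y <= 1 -> abs x' <= 1 -> abs y' <= 1 ->
  abs (x - x') <= c -> abs (y - y') <= c ->
  abs (t2 F n x y - t2 F n x' y') <= c.
Proof.
move=> hF hx hy hx' hy' cx cy; have c0 : 0 <= c := le_trans (abs_ge0 habs _) cx.
rewrite -sumrB; apply: abs_sum => // i _; rewrite -sumrB; apply: abs_sum => // j _.
rewrite -mulrBr; apply: absM_le1 => //.
have -> : x ^+ i * y ^+ j - x' ^+ i * y' ^+ j =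
   x ^+ i * (y ^+ j - y' ^+ j) + y' ^+ j * (x ^+ i - x' ^+ i) by ring.
apply: absD_bound => //; apply: absM_le1; rewrite ?absX_le1 //.
  by apply: le_trans (abs_subX _ _ _) _.
by apply: le_trans (abs_subX _ _ _) _.
Qed.

Variable E : C -> Prop.
Hypotheses (EB : forall x y, E x -> E y -> E (x - y)) (EM : forall x y, E x -> E y -> E (x * y)).
Hypotheses (E1 : E 1) (Ecomplete : complete_in abs E).

Lemma E0 : E 0. Proof. by rewrite -(subrr 1); apply: EB. Qed.
Lemma EN x : E x -> E (- x). Proof. by rewrite -sub0r; apply: EB; exact: E0. Qed.
Lemma ED x y : E x -> E y -> E (x + y).
Proof. by move=> hx hy; rewrite -[y]opprK; apply: EB => //; apply: EN. Qed.
Lemma EX x n : E x -> E (x ^+ n).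
Proof. by move=> hx; elim: n => [|n IH] //; rewrite exprS; apply: EM. Qed.
Lemma Esum I (r : seq I) (p : pred I) (G : I -> C) :
  (forall i, p i -> E (G i)) -> E (\sum_(i <- r | p i) G i).
Proof. by move=> h; apply: (big_ind E) => //; [exact: E0|move=> x y; apply: ED]. Qed.

(** The complete ring [E] will be the field [L] inside [N] itself, or [N(r)] inside the algebraic
    closure. *)
Definition disc x := E x /\ abs x < 1.
Definition good (g : nat -> N) := forall i, E (iota (g i)) /\ nu (g i) <= 1.

Let absr x : abs x < 1 -> 0 <= abs x < 1.
Proof. by move=> h; rewrite abs_ge0. Qed.

Lemma ev1_sum g x : good g -> disc x ->
  [/\ E (ev1 g x), ps_sum1 iota abs g x (ev1 g x)
    & forall n, abs (ev1 g x - t1 g n x) <= abs x ^+ n].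
Proof.
move=> hg [Ex hx]; have hgi i : nu (g i) <= 1 by case: (hg i).
have [hc hb] := cauchy_steps habs (absr hx) (fun n => trunc1_step n x hgi).
have [s Es hs] : exists2 l, E l & seq_to abs (fun n => t1 g n x) l.
  apply: Ecomplete => // n; apply: Esum => i _; apply: EM; last exact: EX.
  by case: (hg i).
have e : ev1 g x = s.
  apply: (seq_to_uniq habs _ hs); apply: xgetPex; by exists s.
rewrite e; split=> // n; apply: (seq_to_bound habs hs); exists n => m; exact: hb.
Qed.

Lemma ev1_approx g x (r : R) n : good g -> disc x -> abs x <= r ->
  abs (ev1 g x - t1 g n x) <= r ^+ n.
Proof.
move=> hg hx hr; have [_ _ /(_ n) h] := ev1_sum hg hx; apply: le_trans h _.
by rewrite lerXn2r ?nnegrE ?abs_ge0 // (le_trans _ hr) // abs_ge0.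
Qed.

Lemma ev1_le g x : good g -> g 0%N = 0 -> disc x -> abs (ev1 g x) <= abs x.
Proof.
move=> hg g0 hx; have [_ _ /(_ 1%N)] := ev1_sum hg hx.
by rewrite /ps_trunc1 big_ord1 g0 rmorph0 mul0r subr0 expr1.
Qed.

Lemma ev1_disc g x : good g -> g 0%N = 0 -> disc x -> disc (ev1 g x).
Proof.
move=> hg g0 hx; split; first by case: (ev1_sum hg hx).
by apply: le_lt_trans (ev1_le hg g0 hx) _; case: hx.
Qed.

Variable F : nat -> nat -> N.
Hypothesis goodF : forall i, good (F i).
Hypotheses (F10 : forall i, F i 0%N = (i == 1%N)%:R) (FC : forall i j, F i j = F j i).

Let F00 : F 0%N 0%N = 0. Proof. by rewrite F10. Qed.
Let hFi i j : nu (F i j) <= 1. Proof. by case: (goodF i j). Qed.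

Lemma ev2_sum x y (r : R) : disc x -> disc y -> r < 1 -> abs x <= r -> abs y <= r ->
  [/\ E (ev2 F x y), ps_sum2 iota abs F x y (ev2 F x y)
    & forall n, abs (ev2 F x y - t2 F n x y) <= r ^+ n].
Proof.
move=> [Ex _] [Ey _] r1 hx hy.
have hr : 0 <= r < 1 by rewrite r1 (le_trans _ hx) // abs_ge0.
have [hc hb] := cauchy_steps habs hr (fun n => trunc2_step n hFi (ltW r1) hx hy).
have [s Es hs] : exists2 l, E l & seq_to abs (fun n => t2 F n x y) l.
  apply: Ecomplete => // n; apply: Esum => i _; apply: Esum => j _; apply: EM.
    by case: (goodF i j).
  by apply: EM; apply: EX.
have e : ev2 F x y = s.
  apply: (seq_to_uniq habs _ hs); apply: xgetPex; by exists s.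
rewrite e; split=> // n; apply: (seq_to_bound habs hs); exists n => m; exact: hb.
Qed.

Lemma ev2_le x y (r : R) : disc x -> disc y -> r < 1 -> abs x <= r -> abs y <= r ->
  abs (ev2 F x y) <= r.
Proof.
move=> hx hy r1 rx ry; have [_ _ /(_ 1%N)] := ev2_sum hx hy r1 rx ry.
by rewrite /ps_trunc2 !big_ord1 F00 rmorph0 mul0r subr0 expr1.
Qed.

Lemma max_disc x y : disc x -> disc y ->
  [/\ Num.max (abs x) (abs y) < 1, abs x <= Num.max (abs x) (abs y)
    & abs y <= Num.max (abs x) (abs y)].
Proof. by case=> _ hx [_ hy]; rewrite gt_max hx hy !le_max !lexx orbT. Qed.

Lemma ev2_disc x y : disc x -> disc y -> disc (ev2 F x y).
Proof.
move=> hx hy; have [r1 rx ry] := max_disc hx hy; split.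
  by case: (ev2_sum hx hy r1 rx ry).
by apply: le_lt_trans r1; apply: ev2_le => //; case: (max_disc hx hy).
Qed.

Lemma ev2_unique x y s : disc x -> disc y -> ps_sum2 iota abs F x y s -> ev2 F x y = s.
Proof.
move=> hx hy; have [r1 rx ry] := max_disc hx hy.
by case: (ev2_sum hx hy r1 rx ry) => _ h _; apply: (seq_to_uniq habs).
Qed.

Lemma ev2C x y : ev2 F x y = ev2 F y x.
Proof.
rewrite /ps_eval2; congr (xget 0 _); apply/seteqP.
have tC n u v : t2 F n u v = t2 F n v u.
  rewrite /ps_trunc2 exchange_big; apply: eq_bigr => i _; apply: eq_bigr => j _.
  by rewrite FC [_ ^+ i * _]mulrC.
by split=> s hs e e0; have [n0 h] := hs e e0; exists n0 => n hn; rewrite tC; apply: h.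
Qed.

Lemma trunc2_0 n x : t2 F n.+2 x 0 = x.
Proof.
rewrite /ps_trunc2 (eq_bigr (fun i : 'I_n.+2 => (i == 1%N :> nat)%:R * x ^+ i)); last first.
  move=> i _; rewrite big_ord_recl /= expr0 mulr1 F10 rmorph_nat big1 ?addr0 // => j _.
  by rewrite expr0n /= !mulr0.
rewrite big_ord_recl big_ord_recl /= mul0r add0r mul1r expr1 big1 ?addr0 // => i _.
by rewrite mul0r.
Qed.

Lemma disc0 : disc 0. Proof. by split; [exact: E0|rewrite abs0]. Qed.

Lemma ev2_0 x : disc x -> ev2 F x 0 = x.
Proof.
move=> hx; apply: ev2_unique => //; first exact: disc0.
move=> e e0; exists 2%N => -[|[|n]] // _; by rewrite trunc2_0 subrr abs0.
Qed.

Hypothesis Fassoc : forall n : nat,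
  let X := 'X_(@Ordinal 3 0 isT) : {mpoly N[3]} in
  let Y := 'X_(@Ordinal 3 1 isT) : {mpoly N[3]} in
  let Z := 'X_(@Ordinal 3 2 isT) : {mpoly N[3]} in
  let Fn := ps_trunc2 (@mpolyC 3 N) F n in
  eq_mod_deg n (Fn (Fn X Y) Z) (Fn X (Fn Y Z)).

Lemma ev2_approx2 x y x' y' (r : R) n : disc x -> disc y -> r < 1 ->
  abs x <= r -> abs y <= r -> abs x' <= 1 -> abs y' <= 1 ->
  abs (x - x') <= r ^+ n -> abs (y - y') <= r ^+ n ->
  abs (ev2 F x y - t2 F n x' y') <= r ^+ n.
Proof.
move=> hx hy r1 rx ry x1 y1 xx yy; have [_ _ /(_ n) h] := ev2_sum hx hy r1 rx ry.
apply: (abs_trans habs h); apply: trunc2_lip => //; apply: ltW.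
  by case: hx.
by case: hy.
Qed.

Lemma trunc2_le1 n x y : abs x <= 1 -> abs y <= 1 -> abs (t2 F n x y) <= 1.
Proof.
move=> hx hy; apply: abs_sum => // i _; apply: abs_sum => // j _.
by apply: absM_le1 => //; apply: absM_le1 => //; rewrite absX_le1.
Qed.

Lemma trunc1_le1 g n x : (forall i, nu (g i) <= 1) -> abs x <= 1 -> abs (t1 g n x) <= 1.
Proof.
by move=> hg hx; apply: abs_sum => // i _; apply: absM_le1 => //; rewrite absX_le1.
Qed.

(** Each side is within [r ^+ n] of its truncated version, and the truncated versions agree up to
    [r ^+ n] by the formal identity. *)
Lemma ev2A x y z : disc x -> disc y -> disc z ->
  ev2 F (ev2 F x y) z = ev2 F x (ev2 F y z).
Proof.
move=> hx hy hz.
pose r := Num.max (Num.max (abs x) (abs y)) (abs z).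
have rx : abs x <= r by rewrite /r !le_max lexx.
have ry : abs y <= r by rewrite /r !le_max lexx orbT.
have rz : abs z <= r by rewrite /r !le_max lexx orbT.
have r1 : r < 1 by rewrite /r !gt_max; case: hx hy hz => _ -> [_ ->] [_ ->].
have r0 : 0 <= r := le_trans (abs_ge0 habs x) rx.
have [x1 y1 z1] : [/\ abs x <= 1, abs y <= 1 & abs z <= 1].
  by split; apply: le_trans (ltW r1).
apply/eqP; rewrite -subr_eq0; apply/eqP; apply: (abs_le_all0 habs (r := r)).
  by rewrite r0.
have rn n : 0 <= r ^+ n by apply: exprn_ge0.
exists 0%N => n _.
have hxy := ev2_disc hx hy; have hyz := ev2_disc hy hz.
have rxy : abs (ev2 F x y) <= r by apply: ev2_le.
have ryz : abs (ev2 F y z) <= r by apply: ev2_le.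
have a1 : abs (ev2 F x y - t2 F n x y) <= r ^+ n by apply: ev2_approx2; rewrite ?subrr ?abs0.
have a2 : abs (ev2 F y z - t2 F n y z) <= r ^+ n by apply: ev2_approx2; rewrite ?subrr ?abs0.
have b1 : abs (ev2 F (ev2 F x y) z - t2 F n (t2 F n x y) z) <= r ^+ n.
  by apply: ev2_approx2; rewrite ?subrr ?abs0 ?trunc2_le1.
have b2 : abs (ev2 F x (ev2 F y z) - t2 F n x (t2 F n y z)) <= r ^+ n.
  by apply: ev2_approx2; rewrite ?subrr ?abs0 ?trunc2_le1.
apply: (abs_trans habs b1); rewrite absC //; apply: (abs_trans habs b2); rewrite absC //.
have /= /eq_mod_degP h := @Fassoc n.
pose v := fun i : 'I_3 => if i == 0%N :> nat then x else if i == 1%N :> nat then y else z.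
have hv i : abs (v i) <= r by rewrite /v; case: eqP => // _; case: eqP.
have r01 : 0 <= r <= 1 by rewrite r0 ltW.
have hint : mint (ps_trunc2 (@mpolyC 3 N) F n (ps_trunc2 (@mpolyC 3 N) F n
    'X_(@Ordinal 3 0 isT) 'X_(@Ordinal 3 1 isT)) 'X_(@Ordinal 3 2 isT) -
  ps_trunc2 (@mpolyC 3 N) F n 'X_(@Ordinal 3 0 isT)
    (ps_trunc2 (@mpolyC 3 N) F n 'X_(@Ordinal 3 1 isT) 'X_(@Ordinal 3 2 isT))).
  by apply: mintD; [|apply: mintN]; do !apply: mint_trunc2 => //; exact: mintX.
have := abs_mmap r01 hv hint h.
have hc b : mmap iota v (mpolyC 3 b) = iota b by exact: mmapC.
by rewrite rmorphB /= !(ps_trunc2_morph hc) /= !(mmapX, mmap1U).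
Qed.


(** Transfers to a sum a bound [c] obeyed by its truncations, [r ^+ n] being the truncation
    error. *)
Lemma abs_le_approx u c (r : R) : 0 <= c -> 0 <= r < 1 ->
  (exists n0, forall n, (n0 <= n)%N -> abs u <= Num.max (r ^+ n) c) -> abs u <= c.
Proof.
move=> c0 hr [n0 h]; rewrite leNgt; apply/negP => cu.
have [n1 h1] := expr_small_all hr (le_lt_trans c0 cu).
by have := h _ (leq_maxl n0 n1); rewrite leNgt gt_max cu h1 // leq_maxr.
Qed.

(** Since [F(X, 0) = X], every monomial of [F] involving [X], other than [X] itself, also involves
    [Y] and yields an extra factor [y]. *)
Lemma ev2_sub x x' y (r : R) : disc x -> disc x' -> disc y -> r < 1 ->
  abs x <= r -> abs x' <= r -> abs y <= r ->
  abs (ev2 F x y - ev2 F x' y - (x - x')) <= r * abs (x - x').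
Proof.
move=> hx hx' hy r1 rx rx' ry; have r0 : 0 <= r := le_trans (abs_ge0 habs x) rx.
apply: (@abs_le_approx _ _ r); [by rewrite mulr_ge0 ?abs_ge0|by rewrite r0|].
exists 2%N => -[|[|n]] // _; set m := n.+2.
have [_ _ /(_ m) h1] := ev2_sum hx hy r1 rx ry.
have [_ _ /(_ m) h2] := ev2_sum hx' hy r1 rx' ry.
have -> : ev2 F x y - ev2 F x' y - (x - x') = (ev2 F x y - t2 F m x y) -
   (ev2 F x' y - t2 F m x' y) + (t2 F m x y - t2 F m x' y - (x - x')) by ring.
apply: absD_bound => //.
  by apply: absB_bound => //; rewrite le_max ?h1 ?h2.
rewrite le_max; apply/orP; right.
have -> : t2 F m x y - t2 F m x' y - (x - x') =
   (t2 F m x y - t2 F m x 0) - (t2 F m x' y - t2 F m x' 0) by rewrite !trunc2_0; ring.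
rewrite -!sumrB; apply: (abs_sum habs); first by rewrite mulr_ge0 ?abs_ge0.
move=> i _; rewrite -!sumrB; apply: (abs_sum habs); first by rewrite mulr_ge0 ?abs_ge0.
move=> [j hj] _ /=; set c := iota _.
have -> : c * (x ^+ i * y ^+ j) - c * (x ^+ i * 0 ^+ j) -
    (c * (x' ^+ i * y ^+ j) - c * (x' ^+ i * 0 ^+ j)) =
  c * ((y ^+ j - 0 ^+ j) * (x ^+ i - x' ^+ i)) by move: (0 ^+ j) => z; ring.
apply: (absM_le1 habs); first exact: hFi.
rewrite absM // ler_pM ?abs_ge0 //; last first.
  by apply: abs_subX; apply: le_trans (ltW r1).
case: j {hj c} => [|j]; first by rewrite subrr abs0.
rewrite expr0n subr0 absX // exprS; apply: (@le_trans _ _ (abs y)) => //.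
by rewrite ler_piMr ?abs_ge0 // exprn_ile1 ?abs_ge0 // ltW //; case: hy.
Qed.

Lemma ev2_isometry x x' y : disc x -> disc x' -> disc y ->
  abs (ev2 F x y - ev2 F x' y) = abs (x - x').
Proof.
move=> hx hx' hy.
pose r := Num.max (Num.max (abs x) (abs x')) (abs y).
have rx : abs x <= r by rewrite /r !le_max lexx.
have rx' : abs x' <= r by rewrite /r !le_max lexx orbT.
have ry : abs y <= r by rewrite /r !le_max lexx orbT.
have r1 : r < 1 by rewrite /r !gt_max; case: hx hx' hy => _ -> [_ ->] [_ ->].
have [->|ne] := eqVneq x x'; first by rewrite !subrr.
apply: (abs_close habs); apply: le_lt_trans (ev2_sub hx hx' hy r1 rx rx' ry) _.
by rewrite -[X in _ < X]mul1r ltr_pM2r // abs_gt0 // subr_eq0.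
Qed.

Lemma ev1_approx2 g x x' (r : R) n : good g -> disc x -> r < 1 ->
  abs x <= r -> abs x' <= 1 -> abs (x - x') <= r ^+ n ->
  abs (ev1 g x - t1 g n x') <= r ^+ n.
Proof.
move=> hg hx r1 rx x1 xx; apply: (abs_trans habs (ev1_approx n hg hx rx)).
apply: le_trans xx; apply: trunc1_lip => //; last by apply: ltW; case: hx.
by move=> i; case: (hg i).
Qed.

Variable f : nat -> N.
Hypotheses (f0 : f 0%N = 0) (f1 : f 1%N = 1).
Hypothesis flog : forall n : nat,
  let X := 'X_(@Ordinal 2 0 isT) : {mpoly N[2]} in
  let Y := 'X_(@Ordinal 2 1 isT) : {mpoly N[2]} in
  let Fn := ps_trunc2 (@mpolyC 2 N) F n in
  let fn := ps_trunc1 (@mpolyC 2 N) f n in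
  eq_mod_deg n (fn (Fn X Y)) (fn X + fn Y).

Section TwoPoints.
Variables (x y : C) (r : R).
Hypotheses (hx : disc x) (hy : disc y) (r1 : r < 1) (rx : abs x <= r) (ry : abs y <= r).

Let v := fun i : 'I_2 => if i == 0%N :> nat then x else y.
Let X : {mpoly N[2]} := 'X_(@Ordinal 2 0 isT).
Let Y : {mpoly N[2]} := 'X_(@Ordinal 2 1 isT).
Let r0 : 0 <= r. Proof. exact: le_trans (abs_ge0 habs x) rx. Qed.
Let r01 : 0 <= r <= 1. Proof. by rewrite r0 ltW. Qed.
Let x1 : abs x <= 1. Proof. exact: le_trans rx (ltW r1). Qed.
Let y1 : abs y <= 1. Proof. exact: le_trans ry (ltW r1). Qed.
Let hv i : abs (v i) <= r. Proof. by rewrite /v; case: eqP. Qed.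
Let hc b : mmap iota v (mpolyC 2 b) = iota b. Proof. exact: mmapC. Qed.
Let rn n : 0 <= r ^+ n. Proof. exact: exprn_ge0. Qed.
Let hr : 0 <= r < 1. Proof. by rewrite r0. Qed.
Let Xo : ordge 1 X. Proof. exact: ordge_var. Qed.
Let Yo : ordge 1 Y. Proof. exact: ordge_var. Qed.
Let vX : mmap iota v X = x. Proof. by rewrite mmapX mmap1U. Qed.
Let vY : mmap iota v Y = y. Proof. by rewrite mmapX mmap1U. Qed.
Let gi g : good g -> forall i, nu (g i) <= 1. Proof. by move=> h i; case: (h i). Qed.

(** The common pattern of the identities below: the formal congruence supplies the order,
    convergence supplies the two approximations. *)
Let transfer u w (P S : nat -> {mpoly N[2]}) :
  (forall n, mint (P n)) -> (forall n, mint (S n)) ->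
  (forall n, ordge n (P n - S n)) ->
  (forall n, abs (u - mmap iota v (P n)) <= r ^+ n) ->
  (forall n, abs (w - mmap iota v (S n)) <= r ^+ n) -> u = w.
Proof.
move=> iP iS o hu hw; apply/eqP; rewrite -subr_eq0; apply/eqP.
apply: (abs_le_all0 habs hr); exists 0%N => n _.
apply: (abs_trans habs (hu n)); rewrite absC //; apply: (abs_trans habs (hw n)).
rewrite absC // -rmorphB; apply: abs_mmap => //.
by apply: mintD => //; apply: mintN.
Qed.

Lemma ev_bracket_add a b g1 g2 g3 : good g1 -> good g2 -> good g3 ->
  bracket f a g1 -> bracket f b g2 -> bracket f (a + b) g3 ->
  ev2 F (ev1 g1 x) (ev1 g2 x) = ev1 g3 x.
Proof.
move=> G1 G2 G3 h1 h2 h3.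
have g10 : g1 0%N = 0 by case: h1.
have g20 : g2 0%N = 0 by case: h2.
apply: (transfer (P := fun n => ps_trunc2 (@mpolyC 2 N) F n
    (ps_trunc1 (@mpolyC 2 N) g1 n X) (ps_trunc1 (@mpolyC 2 N) g2 n X))
  (S := fun n => ps_trunc1 (@mpolyC 2 N) g3 n X)).
- by move=> n; apply: mint_trunc2 => //; (apply: mint_trunc1; [exact: gi|exact: mintX]).
- by move=> n; (apply: mint_trunc1; [exact: gi|exact: mintX]).
- by move=> n; apply: bracket_add h1 h2 h3 _.
- move=> n; rewrite (ps_trunc2_morph hc) !(ps_trunc1_morph hc) /= vX.
  apply: ev2_approx2; rewrite ?trunc1_le1 //; try exact: gi; try exact: ev1_disc.
  + exact: le_trans (ev1_le G1 g10 hx) rx.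
  + exact: le_trans (ev1_le G2 g20 hx) rx.
  + exact: ev1_approx.
  + exact: ev1_approx.
- by move=> n; rewrite (ps_trunc1_morph hc) /= vX; apply: ev1_approx.
Qed.

Lemma ev_bracket_hom a g : good g -> bracket f a g ->
  ev1 g (ev2 F x y) = ev2 F (ev1 g x) (ev1 g y).
Proof.
move=> G h; have g0 : g 0%N = 0 by case: h.
have [_ _ axy] := ev2_sum hx hy r1 rx ry.
apply: (transfer (P := fun n => ps_trunc1 (@mpolyC 2 N) g n (ps_trunc2 (@mpolyC 2 N) F n X Y))
  (S := fun n => ps_trunc2 (@mpolyC 2 N) F n
    (ps_trunc1 (@mpolyC 2 N) g n X) (ps_trunc1 (@mpolyC 2 N) g n Y))).
- by move=> n; apply: mint_trunc1; [exact: gi|apply: mint_trunc2 => //; exact: mintX].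
- by move=> n; apply: mint_trunc2 => //; (apply: mint_trunc1; [exact: gi|exact: mintX]).
- by move=> n; apply: bracket_hom h _ _.
- move=> n; rewrite (ps_trunc1_morph hc) (ps_trunc2_morph hc) /= vX vY.
  apply: ev1_approx2 => //; [exact: ev2_disc|exact: ev2_le|exact: trunc2_le1].
- move=> n; rewrite (ps_trunc2_morph hc) !(ps_trunc1_morph hc) /= vX vY.
  apply: ev2_approx2; rewrite ?trunc1_le1 //; try exact: gi; try exact: ev1_disc.
  + exact: le_trans (ev1_le G g0 hx) rx.
  + exact: le_trans (ev1_le G g0 hy) ry.
  + exact: ev1_approx.
  + exact: ev1_approx.
Qed.

Lemma ev_bracket_mul a b g1 g2 g3 : good g1 -> good g2 -> good g3 ->
  bracket f a g1 -> bracket f b g2 -> bracket f (a * b) g3 ->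
  ev1 g1 (ev1 g2 x) = ev1 g3 x.
Proof.
move=> G1 G2 G3 h1 h2 h3; have g20 : g2 0%N = 0 by case: h2.
apply: (transfer (P := fun n => ps_trunc1 (@mpolyC 2 N) g1 n (ps_trunc1 (@mpolyC 2 N) g2 n X))
  (S := fun n => ps_trunc1 (@mpolyC 2 N) g3 n X)).
- by move=> n; apply: mint_trunc1; [exact: gi|apply: mint_trunc1; [exact: gi|exact: mintX]].
- by move=> n; (apply: mint_trunc1; [exact: gi|exact: mintX]).
- by move=> n; apply: bracket_mul h1 h2 h3 _.
- move=> n; rewrite !(ps_trunc1_morph hc) /= vX.
  apply: ev1_approx2; rewrite ?trunc1_le1 //; try exact: gi; first exact: ev1_disc.
  + exact: le_trans (ev1_le G2 g20 hx) rx.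
  + exact: ev1_approx.
- by move=> n; rewrite (ps_trunc1_morph hc) /= vX; apply: ev1_approx.
Qed.

Lemma ev_bracket_one g : good g -> bracket f 1 g -> ev1 g x = x.
Proof.
move=> G h; apply: (transfer (P := fun n => ps_trunc1 (@mpolyC 2 N) g n X) (S := fun n => X)).
- by move=> n; (apply: mint_trunc1; [exact: gi|exact: mintX]).
- by move=> n; apply: mintX.
- by move=> n; apply: bracket_one h _.
- by move=> n; rewrite (ps_trunc1_morph hc) /= vX; apply: ev1_approx.
- by move=> n; rewrite /= vX subrr abs0.
Qed.

Lemma ev_bracket_zero g : good g -> bracket f 0 g -> ev1 g x = 0.
Proof.
move=> G h; apply: (transfer (P := fun n => ps_trunc1 (@mpolyC 2 N) g n X) (S := fun n => 0)).
- by move=> n; (apply: mint_trunc1; [exact: gi|exact: mintX]).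
- by move=> n; apply: mint0.
- by move=> n; rewrite subr0; apply: bracket_zero h _.
- by move=> n; rewrite (ps_trunc1_morph hc) /= vX; apply: ev1_approx.
- by move=> n; rewrite rmorph0 subrr abs0.
Qed.

End TwoPoints.

Section MulPi.
Variables (pi : N) (g : nat -> N).
Local Notation w := (abs (iota pi)).
Hypotheses (w0 : 0 < w) (w1 : w < 1) (Epi : E (iota pi)^-1).
Hypotheses (gg : good g) (g0 : g 0%N = 0) (g1 : g 1%N = pi).

Lemma mulpi_approx x : disc x -> abs (ev1 g x - iota pi * x) <= abs x ^+ 2.
Proof.
move=> hx; have := ev1_approx 2 gg hx (lexx _).
by rewrite /ps_trunc1 !big_ord_recl big_ord0 /= g0 g1 rmorph0 mul0r add0r addr0 expr1.
Qed.

(** For [|x| < |pi|] the linear term [pi x] dominates the remainder, of size at most [|x| ^ 2]. *)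
Lemma abs_mulpi x : disc x -> abs x < w -> abs (ev1 g x) = w * abs x.
Proof.
move=> hx xw; rewrite -absM //; have [x0|x0] := eqVneq x 0.
  have := mulpi_approx hx; rewrite x0 mulr0 subr0 abs0 // expr0n /= => h.
  by apply/le_anti; rewrite h abs_ge0.
apply: (abs_close habs); apply: le_lt_trans (mulpi_approx hx) _.
by rewrite absM // expr2 ltr_pM2r // abs_gt0.
Qed.

Lemma disc_small x : E x -> abs x <= w ^+ 2 -> disc x.
Proof. by move=> Ex hx; split=> //; apply: le_lt_trans hx _; rewrite exprn_ilt1 // ltW. Qed.

(** For [i >= 2] each term of the cofactor of [x - y] in [x ^+ i - y ^+ i] contains [x] or [y],
    hence is at most [w ^+ 2]. Division by [pi] will leave a contraction of ratio [w]. *)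
Lemma mulpi_sub x y : E x -> E y -> abs x <= w ^+ 2 -> abs y <= w ^+ 2 ->
  abs (ev1 g x - ev1 g y - iota pi * (x - y)) <= w ^+ 2 * abs (x - y).
Proof.
move=> Ex Ey hx hy; have r1 : w ^+ 2 < 1 by rewrite exprn_ilt1 // ltW.
have r0 : 0 <= w ^+ 2 by rewrite exprn_ge0 // ltW.
apply: (@abs_le_approx _ _ (w ^+ 2)); [by apply: mulr_ge0 => //; exact: abs_ge0|by rewrite r0|].
exists 2%N => -[|[|n]] // _; set m := n.+2.
have h1 := ev1_approx m gg (disc_small Ex hx) hx.
have h2 := ev1_approx m gg (disc_small Ey hy) hy.
have -> : ev1 g x - ev1 g y - iota pi * (x - y) = (ev1 g x - t1 g m x) -
   (ev1 g y - t1 g m y) + (t1 g m x - t1 g m y - iota pi * (x - y)) by ring.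
apply: absD_bound => //.
  by apply: absB_bound => //; rewrite le_max ?h1 ?h2.
rewrite le_max; apply/orP; right.
rewrite /ps_trunc1 !big_ord_recl /= g0 g1 rmorph0 !mul0r !add0r !expr1.
set A := \sum_(_ < _) _; set B := \sum_(_ < _) _.
have -> : iota pi * x + A - (iota pi * y + B) - iota pi * (x - y) = A - B by ring.
rewrite -sumrB; apply: (abs_sum habs); first by apply: mulr_ge0 => //; exact: abs_ge0.
move=> i _; rewrite -mulrBr; apply: (absM_le1 habs); first by case: (gg (bump 0 (bump 0 i))).
rewrite subrXX absM // mulrC ler_pM ?abs_ge0 //; apply: abs_sum => // j _.
have x1 : abs x <= 1 by apply: le_trans hx (ltW r1).
have y1 : abs y <= 1 by apply: le_trans hy (ltW r1).
case: (posnP j) => [->|j0].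
  rewrite expr0 mulr1 subn0 /bump !leq0n /= !add1n [x ^+ _]exprS mulrC.
  by apply: (absM_le1 habs) => //; exact: (absX_le1 habs).
rewrite -(prednK j0) [y ^+ _]exprS mulrCA mulrC; apply: (absM_le1 habs) => //.
by apply: (absM_le1 habs); apply: (absX_le1 habs).
Qed.

(* Banach iteration for [x |-> x - (g(x) - t) / pi] on the ball of radius w^2. *)
Lemma mulpi_onto t : E t -> abs t <= w ^+ 3 ->
  exists x, [/\ E x, abs x <= w ^+ 2 & ev1 g x = t].
Proof.
move=> Et ht; pose p := iota pi; have p0 : p != 0 by rewrite -(abs_gt0 habs).
pose T x := x - (ev1 g x - t) / p.
have r0 : 0 <= w ^+ 2 by rewrite exprn_ge0 // ltW.
have wge0 : 0 <= w by apply: ltW.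
have T_lip x y : E x -> E y -> abs x <= w ^+ 2 -> abs y <= w ^+ 2 ->
    abs (T x - T y) <= w * abs (x - y).
  move=> Ex Ey hx hy; rewrite -(ler_pM2l w0) mulrA -expr2.
  have -> : w * abs (T x - T y) = abs (ev1 g x - ev1 g y - p * (x - y)).
    rewrite -absM // -(absN habs); congr (abs _); rewrite /T; field.
    exact: p0.
  exact: mulpi_sub.
have ev0 : ev1 g 0 = 0.
  have /= := ev1_le gg g0 disc0; rewrite abs0 // => h.
  by apply/eqP; rewrite -(abs_eq0 habs); apply/eqP/le_anti; rewrite h abs_ge0.
(* The image [T 0 = t / pi] lies in the ball precisely because [|t| <= w ^+ 3], and [T x] is within
   [w |x|] of it. *)
have T_ball x : E x -> abs x <= w ^+ 2 -> E (T x) /\ abs (T x) <= w ^+ 2.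
  move=> Ex hx; split.
    apply: EB => //; apply: EM => //; apply: EB => //.
    by case: (ev1_sum gg (disc_small Ex hx)).
  rewrite -[T x](subrK (T 0)); apply: absD_bound => //.
    apply: le_trans (T_lip _ _ Ex E0 hx _) _; first by rewrite abs0.
    by rewrite subr0 -[X in _ <= X]mul1r ler_pM ?abs_ge0 // ltW.
  rewrite /T ev0 sub0r sub0r -mulNr opprK absM // absV //.
  by rewrite ler_pdivrMr // -exprSr.
pose u n := iter n T 0.
have hu n : E (u n) /\ abs (u n) <= w ^+ 2.
  elim: n => [|n [IH1 IH2]]; first by split; [exact: E0|rewrite abs0].
  exact: T_ball.
have steps n : abs (u n.+1 - u n) <= w ^+ n.
  elim: n => [|n IH].
    rewrite subr0; apply: le_trans (proj2 (hu 1%N)) _; rewrite exprn_ile1 //; exact: ltW.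
  case: (hu n.+1) (hu n) => e1 b1 [e2 b2].
  by apply: le_trans (T_lip _ _ e1 e2 b1 b2) _; rewrite exprS ler_pM2l.
have hw : 0 <= w < 1 by rewrite wge0.
have [cu bu] := cauchy_steps habs hw steps.
have [x Ex ux] := Ecomplete (fun n => proj1 (hu n)) cu.
have hx : abs x <= w ^+ 2.
  rewrite -[x]subr0; apply: (seq_to_bound habs ux); exists 0%N => n _.
  by rewrite subr0; case: (hu n).
have Tx : T x = x.
  apply: (seq_to_uniq habs _ ux) => e e0; have [n0 h] := ux e e0.
  exists n0.+1 => -[//|n] hn; case: (hu n) => e1 b1.
  apply: le_lt_trans (T_lip _ _ e1 Ex b1 hx) _; apply: le_lt_trans (h n hn).
  by rewrite ler_piMl ?abs_ge0 // ltW.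
exists x; split=> //; have : (ev1 g x - t) / p = 0.
  by apply/eqP; rewrite -[X in X == _]opprK oppr_eq0 -[- _](addKr x) -/(T x) Tx addNr.
by move/eqP; rewrite mulf_eq0 invr_eq0 (negbTE p0) orbF subr_eq0 => /eqP.
Qed.

End MulPi.

Section ModuleLaws.
Variables (A : N -> Prop) (br : N -> nat -> N).
Hypotheses (A1 : A 1) (AB : forall a b, A a -> A b -> A (a - b)).
Hypothesis AM : forall a b, A a -> A b -> A (a * b).
Hypotheses (brG : forall a, A a -> good (br a)) (brB : forall a, A a -> bracket f a (br a)).

Let A0 : A 0. Proof. by rewrite -(subrr 1); apply: AB. Qed.
Let AN a : A a -> A (- a). Proof. by rewrite -sub0r; apply: AB. Qed.
Let AD a b : A a -> A b -> A (a + b).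
Proof. by move=> ha hb; rewrite -[b]opprK; apply: AB => //; apply: AN. Qed.
Let br0 a : A a -> br a 0%N = 0. Proof. by move=> /brB[]. Qed.

Local Notation fadd := (ev2 F).
Local Notation fmul a := (ev1 (br a)).
Local Notation fopp := (ev1 (br (- 1))).

Lemma fmul_disc a x : A a -> disc x -> disc (fmul a x).
Proof. by move=> Aa hx; apply: ev1_disc; [exact: brG|exact: br0|]. Qed.

Lemma fmulDl a b x : A a -> A b -> disc x -> fadd (fmul a x) (fmul b x) = fmul (a + b) x.
Proof.
move=> Aa Ab hx; apply: (ev_bracket_add hx (proj2 hx) (lexx _) (lexx _)).
- exact: brG Aa.
- exact: brG Ab.
- exact: brG (AD Aa Ab).
- exact: brB.
- exact: brB.
exact: brB (AD Aa Ab).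
Qed.

Lemma fmulA a b x : A a -> A b -> disc x -> fmul a (fmul b x) = fmul (a * b) x.
Proof.
move=> Aa Ab hx; apply: (ev_bracket_mul hx (proj2 hx) (lexx _) (lexx _)).
- exact: brG Aa.
- exact: brG Ab.
- exact: brG (AM Aa Ab).
- exact: brB.
- exact: brB.
exact: brB (AM Aa Ab).
Qed.

Lemma fmulD a x y : A a -> disc x -> disc y ->
  fmul a (fadd x y) = fadd (fmul a x) (fmul a y).
Proof.
move=> Aa hx hy; have [r1 rx ry] := max_disc hx hy.
by apply: (ev_bracket_hom hx hy r1 rx ry); [exact: brG|exact: brB].
Qed.

Lemma fmul1 x : disc x -> fmul 1 x = x.
Proof.
move=> hx; apply: (ev_bracket_one hx (proj2 hx) (lexx _) (lexx _)).
- exact: brG.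
exact: brB.
Qed.

Lemma fmul0l x : disc x -> fmul 0 x = 0.
Proof.
move=> hx; apply: (ev_bracket_zero hx (proj2 hx) (lexx _) (lexx _)).
- exact: brG.
exact: brB.
Qed.

Let A1' : A (- 1). Proof. exact: AN. Qed.

Lemma fopp_disc x : disc x -> disc (fopp x). Proof. exact: fmul_disc. Qed.

Lemma faddN x : disc x -> fadd x (fopp x) = 0.
Proof.
by move=> hx; rewrite -{1}(fmul1 hx) fmulDl // subrr fmul0l.
Qed.

Lemma fmul0 a : A a -> fmul a 0 = 0.
Proof.
move=> Aa; have := ev1_le (brG Aa) (br0 Aa) disc0; rewrite abs0 // => h.
by apply/eqP; rewrite -(abs_eq0 habs); apply/eqP/le_anti; rewrite h abs_ge0.
Qed.

Lemma fmulN a x : A a -> disc x -> fmul a (fopp x) = fopp (fmul a x).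
Proof. by move=> Aa hx; rewrite !fmulA // mulrC. Qed.

(** Translation by [fopp y] is an isometry sending [y] to 0. This is why a ball has the same cosets
    for the two group laws. *)
Lemma abs_fsub x y : disc x -> disc y -> abs (fadd x (fopp y)) = abs (x - y).
Proof.
move=> hx hy; rewrite -(ev2_isometry hx hy (fopp_disc hy)) faddN // subr0 //.
Qed.

Variable pi : N.
Local Notation w := (abs (iota pi)).
Hypotheses (Api : A pi) (w0 : 0 < w) (w1 : w < 1) (Epi : E (iota pi)^-1).
Hypothesis br1 : br pi 1%N = pi.

Lemma zero_near r : disc r -> abs (fmul pi r) <= w ^+ 3 ->
  exists z, [/\ disc z, fmul pi z = 0 & abs (z - r) <= w ^+ 2].
Proof.
move=> hr ht; have ht' := fmul_disc Api hr.
have [y [Ey hy ey]] := mulpi_onto w0 w1 Epi (brG Api) (br0 Api) br1 (proj1 ht') ht.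
have dy := disc_small w0 w1 Ey hy.
exists (fadd r (fopp y)); split.
- by apply: ev2_disc => //; apply: fopp_disc.
- by rewrite fmulD ?fmulN ?ey ?faddN //; apply: fopp_disc.
have -> : fadd r (fopp y) - r = fadd (fopp y) r - fadd 0 r.
  by rewrite ev2C [fadd 0 r]ev2C ev2_0.
rewrite ev2_isometry //; [|exact: fopp_disc|exact: disc0].
by rewrite subr0; apply: le_trans hy; apply: ev1_le => //; [exact: brG|exact: br0].
Qed.

(** The difference [u] in the group law is again a zero, and is so small that [|[pi]_F u| = w
    |u|]. *)
Lemma zero_sep z z' : disc z -> disc z' -> fmul pi z = 0 -> fmul pi z' = 0 ->
  abs (z - z') < w -> z = z'.
Proof.
move=> hz hz' ez ez' hw; set u := fadd z (fopp z').
have du : disc u by apply: ev2_disc => //; apply: fopp_disc.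
have au : abs u = abs (z - z') by apply: abs_fsub.
have eu : fmul pi u = 0.
  rewrite fmulD ?fmulN ?ez ?ez' //; last exact: fopp_disc.
  by rewrite fmul0 // ev2_0 //; exact: disc0.
have := abs_mulpi (brG Api) (br0 Api) br1 du (_ : abs u < w); rewrite au eu abs0 // => /(_ hw).
move/esym/eqP; rewrite mulf_eq0 gt_eqF //= abs_eq0 // subr_eq0 => /eqP //.
Qed.

End ModuleLaws.
End Evaluation.

(** * Counting the roots of a polynomial in the open unit disc *)

Section GaussIndex.
Variables (R : realType) (C : fieldType) (abs : C -> R).
Hypothesis habs : nonarch_abs abs.
Implicit Types P A B : {poly C}.

(* The reduction of an integral polynomial has order exactly [k] at 0. *)
Definition gauss_index k A := [/\ forall i, abs A`_i <= 1, abs A`_k = 1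
  & forall j, (j < k)%N -> abs A`_j < 1].

Lemma gauss_index_inj k l A : gauss_index k A -> gauss_index l A -> k = l.
Proof.
move=> [_ hk lk] [_ hl ll]; case: (ltngtP k l) => // [/ll|/lk].
  by rewrite hk ltxx.
by rewrite hl ltxx.
Qed.

Lemma abs_lt1M x y : abs x < 1 -> abs y <= 1 -> abs (x * y) < 1.
Proof.
move=> hx hy; rewrite absM //; apply: le_lt_trans hx.
by rewrite ler_piMr ?abs_ge0.
Qed.

(** In the coefficient of index [k + l] the product of [A_k] and [B_l] is the only unit term; in
    lower ones every term has a factor below 1. *)
Lemma gauss_indexM k l A B : gauss_index k A -> gauss_index l B -> gauss_index (k + l) (A * B).
Proof.
move=> [iA uA lA] [iB uB lB]; split.
- by move=> i; rewrite coefM; apply: (abs_sum habs) => // j _; apply: (absM_le1 habs).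
- rewrite coefM; have hk : (k < (k + l).+1)%N by lia.
  rewrite (bigD1 (Ordinal hk)) //= addKn addrC.
  have e1 : abs (A`_k * B`_l) = 1 by rewrite absM // uA uB mulr1.
  rewrite -[RHS]e1; apply: (abs_dominant habs); rewrite e1.
  apply: (abs_sum_lt habs) => // -[i hi]; rewrite -val_eqE /= => ne.
  case: (ltngtP i k) ne => // ik _; first by apply: abs_lt1M => //; exact: lA.
  by rewrite mulrC; apply: abs_lt1M => //; apply: lB; lia.
move=> j hj; rewrite coefM; apply: (abs_sum_lt habs) => // -[i hi] _ /=.
have [ik|ik] := ltnP i k; first by apply: abs_lt1M => //; exact: lA.
by rewrite mulrC; apply: abs_lt1M => //; apply: lB; lia.
Qed.

Lemma gauss_index_inner r : abs r < 1 -> gauss_index 1 ('X - r%:P).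
Proof.
move=> hr; split.
- move=> i; rewrite coefB coefX coefC; apply: (absB_bound habs).
    by case: eqP => _; rewrite ?abs1 ?abs0.
  by case: eqP => _; rewrite ?abs0 // ltW.
- by rewrite coefB coefX coefC /= subr0 abs1.
by move=> [|j] // _; rewrite coefB coefX coefC /= sub0r absN.
Qed.

Lemma gauss_index_outer s : 1 <= abs s -> gauss_index 0 (1 - s^-1 *: 'X).
Proof.
move=> hs; have hs' : abs s^-1 <= 1 by rewrite absV // invf_le1 // (lt_le_trans ltr01).
split=> //; last by rewrite coefB coef1 coefZ coefX mulr0 subr0 abs1.
move=> i; rewrite coefB coef1 coefZ coefX; apply: (absB_bound habs).
  by case: eqP => _; rewrite ?abs1 ?abs0.
by apply: (absM_le1 habs) => //; case: eqP => _; rewrite ?abs1 ?abs0.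
Qed.

Lemma gauss_index_inner_prod rs : all (fun r => abs r < 1) rs ->
  gauss_index (size rs) (\prod_(r <- rs) ('X - r%:P)).
Proof.
elim: rs => [|r rs IH] /=.
  by move=> _; rewrite big_nil; split=> // [i|]; rewrite coef1 ?abs1 //;
    case: eqP => _; rewrite ?abs1 ?abs0.
move=> /andP[hr hrs]; rewrite big_cons -add1n.
by apply: gauss_indexM; [exact: gauss_index_inner|exact: IH].
Qed.

(** A factor with [|r| >= 1] is rescaled to [1 - r^-1 X], whose reduction does not vanish at 0; only
    the roots in the open disc remain visible to the index. *)
Lemma split_roots (s : seq C) : exists c rs B, [/\ c != 0, all (fun r => abs r < 1) rs,
  gauss_index 0 B & \prod_(r <- s) ('X - r%:P) = c *: (\prod_(r <- rs) ('X - r%:P) * B)].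
Proof.
elim: s => [|r s [c [rs [B [c0 hrs hB e]]]]].
  exists 1, [::], 1; split=> //; rewrite ?oner_eq0 ?big_nil ?mulr1 ?scale1r //.
  by split=> // [i|]; rewrite coef1 ?abs1 //; case: eqP => _; rewrite ?abs1 ?abs0.
rewrite big_cons e; have [hr|hr] := ltP (abs r) 1.
  exists c, (r :: rs), B; split; rewrite //= ?hr //.
  by rewrite big_cons -scalerAr mulrA.
have r0 : r != 0 by rewrite -(abs_gt0 habs) (lt_le_trans ltr01).
exists (- r * c), rs, ((1 - r^-1 *: 'X) * B); split=> //.
- by rewrite mulf_neq0 ?oppr_eq0.
- by rewrite -[0%N]addn0; apply: gauss_indexM => //; apply: gauss_index_outer.
have -> : 'X - r%:P = (- r) *: (1 - r^-1 *: 'X).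
  rewrite scalerBr scalerA mulNr mulfV // scaleN1r opprK addrC scaleNr.
  by rewrite -mul_polyC mulr1.
by rewrite -scalerAl -scalerAr scalerA mulrCA.
Qed.

(** [P] and the normalised product are both integral with a unit coefficient, so the scalar between
    them is a unit and the indices agree: the root count of Weierstrass preparation. *)
Lemma gauss_factor d P : (exists s : seq C, P = lead_coef P *: \prod_(r <- s) ('X - r%:P)) ->
  gauss_index d P -> exists rs B, [/\ size rs = d, all (fun r => abs r < 1) rs,
    gauss_index 0 B & P = \prod_(r <- rs) ('X - r%:P) * B].
Proof.
move=> [s Ps] hP; have [c [rs [B [c0 hrs hB e]]]] := split_roots s.
set l := lead_coef P in Ps; pose b := l * c.
have Pb : P = b *: (\prod_(r <- rs) ('X - r%:P) * B) by rewrite Ps e scalerA.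
have hQ := gauss_indexM (gauss_index_inner_prod hrs) hB; rewrite addn0 in hQ.
set A := _ * B in Pb hQ.
have ab : abs b = 1.
  case: hP hQ => iP uP _ [iQ uQ _]; apply/le_anti/andP; split.
    by have := iP (size rs); rewrite Pb coefZ absM // uQ mulr1.
  by rewrite -uP Pb coefZ absM // ler_piMr ?abs_ge0.
have hb k S : gauss_index k S -> gauss_index k (b *: S).
  move=> [i1 i2 i3]; split=> [i||j hj]; rewrite coefZ absM // ab mul1r //; exact: i3.
exists rs, (b *: B); split=> //; last by rewrite -scalerAr.
  by apply: gauss_index_inj hP; rewrite Pb; apply: hb.
exact: hb.
Qed.

Lemma horner_lip P x y : (forall i, abs P`_i <= 1) -> abs x <= 1 -> abs y <= 1 ->
  abs (P.[x] - P.[y]) <= abs (x - y).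
Proof.
move=> iP hx hy; rewrite !horner_coef -sumrB; apply: (abs_sum habs); rewrite ?abs_ge0 // => i _.
by rewrite -mulrBr; apply: (absM_le1 habs) => //; apply: abs_subX.
Qed.

Lemma gauss_index0_eval B x : gauss_index 0 B -> abs x < 1 -> abs B.[x] = 1.
Proof.
move=> [iB uB _] hx.
have h : abs (B.[x] - B`_0) <= abs x.
  rewrite -horner_coef0 -[X in _ <= abs X]subr0.
  by apply: horner_lip => //; [exact: ltW|rewrite abs0].
by rewrite -uB; apply: (abs_close habs); rewrite uB; exact: le_lt_trans h hx.
Qed.

End GaussIndex.

(** * The roots of the truncations of [[pi]_F] *)

Section TruncatedRoots.
Variables (R : realType) (N : fieldType) (C : closedFieldType).
Variables (iota : {rmorphism N -> C}) (abs : C -> R).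
Hypothesis habs : nonarch_abs abs.
Local Notation nu x := (abs (iota x)).
Variables (pi : N) (g : nat -> N) (d : nat).
Local Notation w := (abs (iota pi)).
Hypotheses (w0 : 0 < w) (w1 : w < 1) (d1 : (1 < d)%N).
Hypotheses (gO : forall i, nu (g i) <= 1) (g0 : g 0%N = 0) (g1 : g 1%N = pi).
Hypotheses (glow : forall j, (j < d)%N -> nu (g j) <= w) (gd : nu (g d) = 1).
Hypothesis gder : forall k, nu (k.+1%:R * g k.+1) <= w.
Local Notation t1 := (ps_trunc1 iota).

Definition trunc_poly m : {poly N} := \sum_(i < m) (g i)%:P * 'X^i.
Local Notation P m := (map_poly iota (trunc_poly m)).

Lemma coef_trunc_poly m i : (trunc_poly m)`_i = if (i < m)%N then g i else 0.
Proof. exact: coef_pstrunc. Qed.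

Lemma horner_trunc_poly m x : (P m).[x] = t1 g m x.
Proof.
rewrite rmorph_sum /= horner_sum; apply: eq_bigr => i _.
by rewrite rmorphM /= map_polyC map_polyXn hornerM hornerC hornerXn.
Qed.

Lemma gauss_index_trunc m : (d < m)%N -> gauss_index abs d (P m).
Proof.
move=> dm; split=> [i||j jd]; rewrite coef_map coef_trunc_poly /=.
- by case: ifP => _ //; rewrite rmorph0 abs0.
- by rewrite dm.
by rewrite (ltn_trans jd dm); apply: le_lt_trans (glow jd) _.
Qed.

Lemma deriv_trunc m x : (1 < m)%N -> abs x < 1 -> abs (P m)^`().[x] = w.
Proof.
move=> m1 hx; set S := (P m)^`().
have hS i : abs S`_i <= w.
  rewrite coef_deriv coef_map coef_trunc_poly /=; case: ifP => _.
    by rewrite -mulr_natl -(rmorph_nat iota) -rmorphM.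
  by rewrite rmorph0 mul0rn abs0 // ltW.
have S0 : S`_0 = iota pi by rewrite coef_deriv coef_map coef_trunc_poly m1 /= g1.
rewrite -S0; apply: (abs_close habs); rewrite S0 horner_coef.
case sS : (size S) => [|k].
  by move: S0; rewrite nth_default ?sS // => e0; move: w0; rewrite -e0 abs0 // ltxx.
rewrite big_ord_recl /= S0 expr0 mulr1 addrC addKr.
apply: (abs_sum_lt habs) => // i _; rewrite absM // exprS.
apply: le_lt_trans (_ : w * abs x < w); last by rewrite gtr_pMr.
rewrite ler_pM ?abs_ge0 // -[X in _ <= X]mulr1 absM // ler_pM ?abs_ge0 // absX //.
by rewrite exprn_ile1 ?abs_ge0 // ltW.
Qed.

(** A Newton polygon estimate: beyond this threshold the term of degree [d] strictly dominates,
    terms of lower degree being at most [w |x|]. A zero thus satisfies [|x| ^ (d-1) <= w]. *)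
Lemma trunc_large m x : (d < m)%N -> abs x < 1 -> w < abs x ^+ d.-1 ->
  abs (t1 g m x) = abs x ^+ d.
Proof.
move=> dm hx hw.
have x0 : 0 < abs x.
  rewrite abs_gt0 //; apply/eqP => x0; move: hw; rewrite x0 abs0 // expr0n.
  by case: (d) d1 => [|[|k]] //= _; rewrite ltNge (ltW w0).
rewrite -absX // -[X in _ = X]mul1r -gd -absM // /ps_trunc1 (bigD1 (Ordinal dm)) //= addrC.
apply: (abs_dominant habs); rewrite absM // gd mul1r absX //.
apply: (abs_sum_lt habs); first by rewrite exprn_gt0.
move=> [i im]; rewrite -val_eqE /= => ne; rewrite absM // absX //.
case: (ltngtP i d) ne => // id _.
  case: i im id => [|i] im id; first by rewrite g0 rmorph0 abs0 // mul0r exprn_gt0.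
  apply: le_lt_trans (_ : w * abs x < _).
    apply: ler_pM; [exact: (abs_ge0 habs)|by rewrite exprn_ge0 // abs_ge0|exact: glow|].
    by rewrite exprS ler_piMr ?abs_ge0 // exprn_ile1 ?abs_ge0 // ltW.
  by rewrite -[X in _ < _ ^+ X](prednK (ltnW d1)) exprSr ltr_pM2r.
apply: le_lt_trans (_ : abs x ^+ i < _).
  by rewrite ler_piMl ?exprn_ge0 ?abs_ge0.
by rewrite ltr_iXn2l.
Qed.

(* The roots in the open disc of a truncation: the derivative [P'(r)] is the
   product of the differences with the other roots, up to a unit. *)
Lemma disc_roots m : (d < m)%N -> exists rs, [/\ size rs = d, uniq rs,
  (forall r, r \in rs -> abs r < 1 /\ t1 g m r = 0),
  (forall r r', r \in rs -> r' \in rs -> r != r' -> w <= abs (r - r'))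
  & forall x, abs x < 1 -> abs (t1 g m x) = \prod_(r <- rs) abs (x - r)].
Proof.
move=> dm; have [rs0 hrs0] := closed_field_poly_normal (P m).
have [rs [B [srs /allP hrs hB Pf]]] :=
  gauss_factor habs (ex_intro _ rs0 hrs0) (gauss_index_trunc dm).
have key rs' x : abs x < 1 ->
    abs (\prod_(r' <- rs') ('X - r'%:P) * B).[x] = \prod_(r' <- rs') abs (x - r').
  move=> hx; rewrite hornerM absM // (gauss_index0_eval habs hB) // mulr1 horner_prod.
  elim: rs' => [|r' rs' IH]; first by rewrite !big_nil abs1.
  by rewrite !big_cons absM // IH !hornerE.
(* The product of the differences has absolute value [w] and all its factors are at most 1, so each
   is at least [w]. As [rem] deletes a single copy of [r], a repeated root would give a zero factor,
   which excludes multiplicities. *)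
have fact r : r \in rs -> forall r', r' \in rem r rs -> w <= abs (r - r').
  move=> rr r' rr'; have pr := perm_to_rem rr; have r1 := hrs _ rr.
  have := deriv_trunc (ltn_trans d1 dm) r1; rewrite Pf (perm_big _ pr) /= big_cons.
  rewrite -mulrA derivM derivB derivX derivC subr0 mul1r hornerD hornerM !hornerE subrr mul0r addr0.
  rewrite -hornerM key // => <-.
  rewrite (perm_big _ (perm_to_rem rr')) /= big_cons ler_piMr ?abs_ge0 //.
  rewrite big_seq; apply: prodr_ile1 => r'' /mem_rem /mem_rem /hrs hr''.
  by rewrite abs_ge0 //=; apply: (absB_bound habs); exact: ltW.
exists rs; split=> //.
- apply: count_mem_uniq => r; have [rr|rr] := boolP (r \in rs); last exact/count_memPn.
  rewrite (seq.permP (perm_to_rem rr)) /= eqxx; apply/eqP; rewrite eqSS; apply/eqP/count_memPn.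
  by apply/negP => /(fact r rr); rewrite subrr abs0 // leNgt w0.
- move=> r rr; split; first exact: hrs.
  by rewrite -horner_trunc_poly Pf hornerM horner_prod (big_rem r) //= !hornerE subrr !mul0r.
- move=> r r' rr rr' ne; apply: fact => //.
  by move: rr'; rewrite (perm_mem (perm_to_rem rr)) inE eq_sym (negbTE ne).
by move=> x hx; rewrite -horner_trunc_poly Pf key.
Qed.

End TruncatedRoots.

(** * Finite indices and the Herbrand quotient *)

Section Index.
Variable G : zmodType.
Implicit Types (H U : G -> Prop) (x y : G).

Definition subgrp H := H 0 /\ forall x y, H x -> H y -> H (x - y).

Lemma subgrpN H x : subgrp H -> H x -> H (- x).
Proof. by case=> h0 hB hx; rewrite -sub0r; apply: hB. Qed.

Lemma subgrpD H x y : subgrp H -> H x -> H y -> H (x + y).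
Proof.
by move=> sH hx hy; rewrite -[y]opprK; apply: (proj2 sH) => //; apply: subgrpN.
Qed.

(* [T] is in bijection with [H2 / H1]. *)
Definition quot_by H1 H2 (T : finType) := exists th : G -> T,
  (forall t, exists2 x, H2 x & th x = t) /\
  forall x y, H2 x -> H2 y -> (th x = th y <-> H1 (x - y)).

Lemma quot_by_le H1 H2 (T T' : finType) : quot_by H1 H2 T -> quot_by H1 H2 T' ->
  (#|T| <= #|T'|)%N.
Proof.
move=> [th [hs hf]] [th' [_ hf']].
have ex t : exists x, H2 x /\ th x = t by have [x hx e] := hs t; exists x.
have [s hs'] := choice ex.
apply: (leq_card (fun t => th' (s t))) => t1 t2 /hf' h.
rewrite -[t1](proj2 (hs' t1)) -[t2](proj2 (hs' t2)); apply/hf; try exact: (proj1 (hs' _)).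
by apply: h; exact: (proj1 (hs' _)).
Qed.

Lemma quot_by_card H1 H2 (T T' : finType) : quot_by H1 H2 T -> quot_by H1 H2 T' -> #|T| = #|T'|.
Proof. by move=> h h'; apply/eqP; rewrite eqn_leq !(@quot_by_le H1 H2). Qed.

Lemma quot_by_tower H1 H2 H3 (T1 T2 : finType) : subgrp H1 -> subgrp H2 -> subgrp H3 ->
  (forall x, H1 x -> H2 x) -> (forall x, H2 x -> H3 x) ->
  quot_by H2 H3 T2 -> quot_by H1 H2 T1 -> quot_by H1 H3 (T2 * T1)%type.
Proof.
move=> s1 s2 s3 h12 h23 [th2 [hs2 hf2]] [th1 [hs1 hf1]].
have ex t : exists x, H3 x /\ th2 x = t by have [x hx e] := hs2 t; exists x.
have [s hs] := choice ex.
have hr x : H3 x -> H2 (x - s (th2 x)).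
  by case: (hs (th2 x)) => k1 k2 hx; apply/hf2; rewrite ?k2.
exists (fun x => (th2 x, th1 (x - s (th2 x)))); split.
  move=> [t2 t1]; have [y hy <-] := hs1 t1; case: (hs t2) => k1 k2.
  have h3 : H3 (s t2 + y) by apply: subgrpD => //; apply: h23.
  exists (s t2 + y) => //; suff -> : th2 (s t2 + y) = t2 by rewrite addrC addKr.
  by rewrite -[RHS]k2; apply/hf2 => //; rewrite addrC addKr.
move=> x y hx hy; split=> [[e1 /hf1 e2]|hxy].
  have := e2 (hr x hx) (hr y hy); rewrite e1 opprD opprK addrACA addNr addr0 //.
have e1 : th2 x = th2 y by apply/hf2 => //; apply: h12.
rewrite e1; congr (_, _); apply/hf1; [by rewrite -e1; exact: hr|exact: hr|].
by rewrite opprD opprK addrACA addNr addr0.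
Qed.

(** The new index set consists of the classes that meet [H2]. *)
Lemma quot_by_sub H1 H2 H3 (T : finType) : subgrp H2 -> (forall x, H2 x -> H3 x) ->
  quot_by H1 H3 T -> exists T' : finType, quot_by H1 H2 T'.
Proof.
move=> s2 h23 [th [hs hf]].
pose p t := `[< exists2 x, H2 x & th x = t >].
have p0 : p (th 0) by apply/asboolP; exists 0 => //; case: s2.
exists {t | p t}; exists (fun x => insubd (exist _ (th 0) p0 : {t | p t}) (th x)).
have hv x : H2 x -> val (insubd (exist _ (th 0) p0 : {t | p t}) (th x)) = th x.
  by move=> hx; rewrite val_insubd; case: ifP => // /negP[]; apply/asboolP; exists x.
split=> [[t pt]|x y hx hy].
  have /asboolP[x hx e] := pt; exists x => //; apply: val_inj; rewrite hv //.
rewrite -(hf _ _ (h23 _ hx) (h23 _ hy)); split=> [/(congr1 val)|e]; first by rewrite !hv.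
by apply: val_inj; rewrite !hv.
Qed.

(* The Herbrand quotient of an endomorphism is unchanged on passing to a
   subgroup of finite index. *)
Lemma index_count (phi : G -> G) U (T1 T2 V : finType) (ks : seq G) :
  (forall x y, phi (x - y) = phi x - phi y) -> subgrp U ->
  (forall x, U x -> U (phi x)) -> (forall x, U x -> phi x = 0 -> x = 0) ->
  uniq ks -> (forall x, phi x = 0 <-> x \in ks) ->
  quot_by U (fun _ => True) T2 -> quot_by (fun x => exists2 y, U y & x = phi y) U T1 ->
  quot_by (fun x => exists y, x = phi y) (fun _ => True) V ->
  #|V| = (#|T1| * size ks)%N.
Proof.
move=> phiB sU Uphi Uinj uks hks q2 q1 qV.
pose phiU x := exists2 y, U y & x = phi y; pose im x := exists y, x = phi y.
(* [KU] is the preimage of [phi U], that is [U + ker phi]. Then [G / KU] is [phi G / phi U], indexed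
   by [T4], and [KU / U] is [ker phi]; so [|T2| |T1| = |V| |T4|] and [|T2| = |T4| |ker phi|]. *)
pose top := fun _ : G => True; pose KU x := phiU (phi x).
have phi0 : phi 0 = 0 by rewrite -[X in phi X](subrr 0) phiB subrr.
have [U0 UB] := sU.
have sphiU : subgrp phiU.
  split; first by exists 0.
  by move=> _ _ [x hx ->] [y hy ->]; exists (x - y); rewrite ?phiB //; apply: UB.
have sim : subgrp im.
  by split; [exists 0|move=> _ _ [x ->] [y ->]; exists (x - y)].
have stop : subgrp top by [].
have sKU : subgrp KU.
  split; first by rewrite /KU phi0; case: sphiU.
  by move=> x y hx hy; rewrite /KU phiB; case: sphiU => _; apply.
have q12 : quot_by phiU top (T2 * T1)%type.
  apply: (quot_by_tower _ sU) q2 q1 => //; by move=> _ [y hy ->]; apply: Uphi.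
have [T4 q4] := quot_by_sub sim (fun x _ => I) q12.
have qV4 : quot_by phiU top (V * T4)%type.
  by apply: (quot_by_tower _ sim) qV q4 => //; move=> _ [y hy ->]; exists y.
have qKU : quot_by KU top T4.
  case: q4 => th [hs hf]; exists (fun x => th (phi x)); split.
    by move=> t; have [_ [y ->] <-] := hs t; exists y.
  by move=> x y _ _; rewrite hf; [rewrite /KU phiB|exists x|exists y].
have qker : quot_by U KU (seq_sub ks).
  have k0 : 0 \in ks by apply/hks.
  have ex x : exists k : seq_sub ks, KU x -> U (x - val k).
    have [[u hu e]|nx] := pselect (KU x); last by exists (SeqSub k0).
    have xk : x - u \in ks by apply/hks; rewrite phiB e subrr.
    by exists (SeqSub xk) => _ /=; rewrite opprB addrC subrK.
  have [th hth] := choice ex.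
  have uk (k k' : seq_sub ks) x : U (x - val k) -> U (x - val k') -> k = k'.
    move=> h h'; apply: val_inj; apply/eqP; rewrite -subr_eq0; apply/eqP; apply: Uinj.
      by have := UB _ _ h' h; rewrite opprB addrC addrA subrK.
    have kk (j : seq_sub ks) : phi (val j) = 0 by apply/hks; exact: valP.
    by rewrite phiB !kk subrr.
  exists th; split.
    move=> k; have kKU : KU (val k).
      by rewrite /KU (_ : phi (val k) = 0); [exists 0|apply/hks; exact: valP].
    by exists (val k) => //; apply: (uk _ _ (val k)); [exact: hth|rewrite subrr].
  move=> x y hx hy; split=> [e|h].
    have := UB _ _ (hth x hx) (hth y hy); rewrite e opprB addrA subrK //.
  apply: (uk _ _ y); last exact: hth.
  by have := UB _ _ (hth x hx) h; rewrite opprB addrC addrA subrK.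
have qall : quot_by U top (T4 * seq_sub ks)%type.
  apply: (quot_by_tower sU sKU) qKU qker => //.
  by move=> x hx; exists x.
have c1 := quot_by_card q12 qV4; have c2 := quot_by_card q2 qall.
rewrite !card_prod card_seq_sub // in c1 c2.
have T40 : (0 < #|T4|)%N by case: q4 => th _; apply/card_gt0P; exists (th 0).
apply/eqP; rewrite -(eqn_pmul2l T40); apply/eqP.
by rewrite mulnC -c1 c2 -mulnA [(size ks * _)%N]mulnC.
Qed.

End Index.

(** * Bases of a quotient on which scalars act through lifts *)

Section MaximalFamily.
Variables (k : finFieldType) (G : zmodType) (H : G -> Prop) (s : k -> G -> G).
Hypothesis sH : subgrp H.
Hypotheses (sD : forall c x y, H (s c (x + y) - (s c x + s c y)))
  (sDl : forall c d x, H (s (c + d) x - (s c x + s d x)))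
  (sM : forall c d x, H (s (c * d) x - s c (s d x)))
  (s1 : forall x, H (s 1 x - x)) (sHs : forall c x, H x -> H (s c x)).

Local Notation "x ~ y" := (H (x - y)) (at level 70).

Let refl x : x ~ x. Proof. by rewrite subrr; case: sH. Qed.
Let sym x y : x ~ y -> y ~ x. Proof. by move/(subgrpN sH); rewrite opprB. Qed.
Let trans y x z : x ~ y -> y ~ z -> x ~ z.
Proof. by move=> h1 h2; have := subgrpD sH h1 h2; rewrite addrA subrK. Qed.
Let addc x x' y y' : x ~ x' -> y ~ y' -> x + y ~ x' + y'.
Proof. by move=> h1 h2; rewrite opprD addrACA; apply: subgrpD. Qed.
Let s0l x : s 0 x ~ 0.
Proof.
have := sDl 0 0 x; rewrite addr0 opprD addrA subrr add0r => /(subgrpN sH).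
by rewrite opprK subr0.
Qed.
Let s0 c : s c 0 ~ 0. Proof. by rewrite subr0; apply: sHs; case: sH. Qed.
Let sNl c x : s (- c) x ~ - s c x.
Proof.
have h : s (- c) x + s c x ~ 0 by apply: trans (sym (sDl _ _ _)) _; rewrite addNr.
by have := addc h (refl (- s c x)); rewrite addrK add0r.
Qed.
Let sc c x y : x ~ y -> s c x ~ s c y.
Proof.
move=> h; have := sD c (x - y) y; rewrite subrK => h1.
apply: (trans h1); rewrite -[X in _ ~ X]add0r; apply: addc => //.
by rewrite subr0; apply: sHs.
Qed.

(** Here [s c] will be multiplication by a chosen lift of the residue [c], so combinations live in
    [G] and obey the laws of a vector space only modulo [H]. *)
Definition comb r (x : 'I_r -> G) (c : 'rV[k]_r) := \sum_i s (c 0 i) (x i).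
Definition indep r (x : 'I_r -> G) := forall c, H (comb x c) -> c = 0.

Lemma comb_cong r (x : 'I_r -> G) (u v : 'I_r -> G) : (forall i, u i ~ v i) ->
  \sum_i u i ~ \sum_i v i.
Proof.
move=> h; rewrite -sumrB; apply: (big_ind H) => //; first by case: sH.
by move=> a b; apply: subgrpD.
Qed.

Lemma combD r (x : 'I_r -> G) c d : comb x (c + d) ~ comb x c + comb x d.
Proof. by rewrite -big_split; apply: comb_cong => // i; rewrite mxE. Qed.

Lemma combN r (x : 'I_r -> G) c : comb x (- c) ~ - comb x c.
Proof. by rewrite -sumrN; apply: comb_cong => // i; rewrite mxE. Qed.

Lemma s_sum c r (u : 'I_r -> G) : s c (\sum_i u i) ~ \sum_i s c (u i).
Proof.
elim: r u => [|r IH] u; first by rewrite !big_ord0; apply: s0.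
rewrite !big_ord_recl; apply: trans (sD _ _ _) _; apply: addc => //; exact: IH.
Qed.

Lemma combZ r (x : 'I_r -> G) a c : comb x (a *: c) ~ s a (comb x c).
Proof.
apply: trans (_ : _ ~ \sum_i s a (s (c 0 i) (x i))) _; last by apply: sym; apply: s_sum.
by apply: comb_cong => // i; rewrite mxE.
Qed.

(** Produces a basis of [G / H] without forming the quotient; the bound [B] expresses finite
    dimension. *)
Lemma maximal_family (B : nat) : (forall r (x : 'I_r -> G), indep x -> (r <= B)%N) ->
  exists r, exists2 x : 'I_r -> G, indep x & forall y, exists c, y ~ comb x c.
Proof.
move=> hB; pose P r := `[< exists x : 'I_r -> G, indep x >].
have P0 : exists r, P r.
  exists 0%N; apply/asboolP; exists (fun=> 0) => c _.
  by apply/rowP => -[].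
have hP r : P r -> (r <= B)%N by move=> /asboolP[x]; apply: hB.
case: (ex_maxnP P0 hP) => r /asboolP[x ix] rmax; exists r, x => // y.
apply: contrapT => ny; suff /rmax : P r.+1 by rewrite ltnn.
apply/asboolP; exists (fun i => oapp x y (unlift ord0 i)) => c.
rewrite /comb big_ord_recl unlift_none /=; under eq_bigr => i _ do rewrite liftK /=.
set c' := \row_j c 0 (lift ord0 j).
have -> : \sum_(i < r) s (c 0 (lift ord0 i)) (x i) = comb x c'.
  by apply: eq_bigr => i _; rewrite mxE.
move=> hc; have [c0|c0] := eqVneq (c 0 ord0) 0.
  have c'0 : c' = 0.
    apply: ix; have := addc (s0l y) (refl (comb x c')); rewrite -c0 add0r => /sym h.
    by rewrite -[comb x c']subr0; apply: trans h _; rewrite subr0.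
  apply/rowP => i; rewrite mxE; case: (unliftP ord0 i) => [j ->|->] //.
  by move/rowP/(_ j): c'0; rewrite !mxE.
case: ny; exists (- ((c 0 ord0)^-1 *: c')); set a := (c 0 ord0)^-1.
have h1 : s a (s (c 0 ord0) y + comb x c') ~ 0 by rewrite subr0; apply: sHs.
have h2 : y + comb x (a *: c') ~ 0.
  apply: trans h1; apply: sym; apply: trans (sD _ _ _) _; apply: addc.
    by apply: trans (sym (sM _ _ _)) _; rewrite mulVf.
  by apply: sym; apply: combZ.
have := addc h2 (refl (- comb x (a *: c'))); rewrite addrK add0r => h.
by apply: trans h _; apply: sym; apply: combN.
Qed.

Lemma quotient_coordinates r (x : 'I_r -> G) : indep x ->
  (forall y, exists c, y ~ comb x c) -> exists th : G -> 'rV[k]_r,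
  [/\ forall y z, th (y + z) = th y + th z, forall c y, th (s c y) = c *: th y,
      forall v, exists y, th y = v & forall y, th y = 0 <-> H y].
Proof.
move=> ix hx; have [th hth] := choice hx.
have uniq_th y c : y ~ comb x c -> th y = c.
  move=> h; apply/eqP; rewrite -subr_eq0; apply/eqP; apply: ix.
  rewrite -[comb _ _]subr0; apply: trans (combD _ _ _) _.
  apply: trans (addc (refl _) (combN _ _)) _; rewrite subr0.
  by apply: trans (sym (hth y)) h.
exists th; split.
- by move=> y z; apply: uniq_th; apply: trans (addc (hth y) (hth z)) _; apply: sym; apply: combD.
- by move=> c y; apply: uniq_th; apply: trans (sc c (hth y)) _; apply: sym; apply: combZ.
- by move=> v; exists (comb x v); apply: uniq_th.
have comb0 : comb x 0 ~ 0.
  by rewrite -(scale0r 0); apply: trans (combZ _ _ _) _; apply: s0l.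
move=> y; split=> [e|h].
  by rewrite -[y]subr0; apply: trans (hth y) _; rewrite e.
by apply: uniq_th; apply: trans (_ : y ~ 0) (sym comb0); rewrite subr0.
Qed.

End MaximalFamily.

(** Makes a group law on a subset into a [zmodType], so that the results on abstract groups apply to
    [O_L] with addition and to [F(p_L)] with the formal group law. *)
Lemma zmodType_of_law (X : choiceType) (D : X -> Prop) (z : X) (add : X -> X -> X) (opp : X -> X) :
  D z -> (forall x y, D x -> D y -> D (add x y)) -> (forall x, D x -> D (opp x)) ->
  (forall x y t, D x -> D y -> D t -> add x (add y t) = add (add x y) t) ->
  (forall x y, D x -> D y -> add x y = add y x) ->
  (forall x, D x -> add z x = x) -> (forall x, D x -> add (opp x) x = z) ->
  exists (Z : zmodType) (v : Z -> X), [/\ injective v, forall x, D (v x),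
    forall x, D x -> exists t, v t = x &
    [/\ v 0 = z, forall s t, v (s + t) = add (v s) (v t) & forall t, v (- t) = opp (v t)]].
Proof.
move=> Dz Dadd Dopp hA hC h0 hN.
pose T := {x : X | `[< D x >]}.
have DT (t : T) : D (val t) by apply/asboolP; exact: (valP t).
pose mk x (hx : D x) : T := exist _ x (introT (asboolP _) hx).
pose a (s t : T) : T := mk _ (Dadd _ _ (DT s) (DT t)).
pose o (t : T) : T := mk _ (Dopp _ (DT t)).
have aA : associative a by move=> s t u; apply: val_inj; apply: hA.
have aC : commutative a by move=> s t; apply: val_inj; apply: hC.
have a0 : left_id (mk _ Dz) a by move=> t; apply: val_inj; apply: h0.
have aN : left_inverse (mk _ Dz) o a by move=> t; apply: val_inj; apply: hN.
pose Z : zmodType := HB.pack T (GRing.isZmodule.Build T aA aC a0 aN).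
exists Z, (val : T -> X); split=> //; first exact: val_inj.
by move=> x hx; exists (mk _ hx).
Qed.

(** * Completeness of subspaces of [N] and of [N(r)] *)

Section FiniteSubspaces.
Variables (R : realType) (Q C : fieldType) (N : fieldExtType Q) (iota : {rmorphism N -> C}).
Variable abs : C -> R.
Hypothesis habs : nonarch_abs abs.
Hypothesis hQ : forall u : nat -> Q, cauchy_seq (fun x => abs (iota x%:A)) u ->
  exists l, seq_to (fun x => abs (iota x%:A)) u l.

Let sigma : {rmorphism Q -> C} := (iota \o in_alg N : {rmorphism Q -> C}).

Let span_c s : complete_in abs (in_span sigma s).
Proof. exact: span_complete. Qed.

Lemma complete_iff (E E' : C -> Prop) : (forall x, E x <-> E' x) ->
  complete_in abs E -> complete_in abs E'.
Proof.
move=> e hE u hu cu; have [l El ul] := hE u (fun n => proj2 (e _) (hu n)) cu.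
by exists l => //; apply/e.
Qed.

Lemma in_span_sum I (r : seq I) (p : pred I) (G : I -> C) s :
  (forall i, p i -> in_span sigma s (G i)) -> in_span sigma s (\sum_(i <- r | p i) G i).
Proof.
move=> h; apply: (big_ind (in_span sigma s)) => //; first exact: in_span0.
by move=> x y; apply: in_spanD.
Qed.

Lemma in_span_ind (E : C -> Prop) s : E 0 -> (forall x y, E x -> E y -> E (x + y)) ->
  (forall c x, x \in s -> E (sigma c * x)) -> forall x, in_span sigma s x -> E x.
Proof.
move=> E0 ED; elim: s => [|b s IH] hs x /=; first by move=> ->.
move=> [c [y [hy ->]]]; apply: ED; first by apply: hs; rewrite mem_head.
by apply: IH => // d z hz; apply: hs; rewrite inE hz orbT.
Qed.

Lemma subspace_complete (W : {vspace N}) :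
  complete_in abs (fun x => exists2 y, y \in W & x = iota y).
Proof.
apply: (complete_iff _ (@span_c [seq iota y | y <- vbasis W])) => x; split.
  apply: (in_span_ind (E := fun x => exists2 y, y \in W & x = iota y)).
  - by exists 0; rewrite ?mem0v ?rmorph0.
  - by move=> _ _ [y hy ->] [z hz ->]; exists (y + z); rewrite ?memvD ?rmorphD.
  move=> c _ /mapP[y /vbasis_mem hy ->]; exists (c *: y); first exact: memvZ.
  by rewrite /sigma /= -rmorphM -scalerAl mul1r.
move=> [y hy ->]; rewrite (coord_vbasis hy) rmorph_sum; apply: in_span_sum => i _.
have -> : iota (coord (vbasis W) i y *: (vbasis W)`_i) =
    sigma (coord (vbasis W) i y) * iota (vbasis W)`_i.
  by rewrite /sigma /= -rmorphM -scalerAl mul1r.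
by apply: in_spanZ; apply: in_span_mem; apply: map_f; rewrite mem_nth ?size_tuple.
Qed.

(** Division by [P] bounds degrees, so [N(r)] is spanned over [Q] by finitely many products of a
    basis vector of [N] and a power of [r]; [P] may be reducible. *)
Lemma adjoin_complete (P : {poly N}) r : P != 0 -> root (map_poly iota P) r ->
  complete_in abs (fun x => exists S : {poly N}, x = (map_poly iota S).[r]).
Proof.
move=> P0 Pr; pose n := size P.
apply: (complete_iff _ (@span_c [seq iota y * r ^+ i | y <- vbasis {: N}, i <- seq.iota 0 n])) => x.
split.
  apply: (in_span_ind (E := fun x => exists S : {poly N}, x = (map_poly iota S).[r])).
  - by exists 0; rewrite rmorph0 horner0.
  - by move=> _ _ [S ->] [T ->]; exists (S + T); rewrite rmorphD hornerD.
  move=> c _ /allpairsP[[y i] [_ _ ->]] /=; exists ((c *: y)%:P * 'X^i).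
  rewrite rmorphM /= map_polyC map_polyXn hornerM hornerC hornerXn mulrA; congr (_ * _).
  by rewrite /sigma /= -rmorphM -scalerAl mul1r.
move=> [S ->]; have -> : (map_poly iota S).[r] = (map_poly iota (S %% P)).[r].
  rewrite {1}(divp_eq S P) rmorphD rmorphM /= hornerD hornerM (rootP Pr) mulr0 add0r //.
rewrite (horner_coef_wide (n := n)); last first.
  by rewrite size_map_poly ltnW // ltn_modp.
apply: in_span_sum => i _; rewrite coef_map /=; set y := _`_i.
rewrite (coord_vbasis (memvf y)) rmorph_sum mulr_suml; apply: in_span_sum => j _.
set b := (vbasis _)`_j; set c := coord _ _ _.
have -> : iota (c *: b) * r ^+ i = sigma c * (iota b * r ^+ i).
  by rewrite mulrA; congr (_ * _); rewrite /sigma /= -rmorphM -scalerAl mul1r.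
apply: in_spanZ; apply: in_span_mem; apply: (allpairs_f (fun y i => iota y * r ^+ i)).
  by rewrite mem_nth ?size_tuple.
by rewrite mem_iota /= add0n.
Qed.

End FiniteSubspaces.

(** * The dimension of [O_L / pi O_L] over [k0] *)

Section ResidueRank.
Variables (R : realType) (Q : fieldType) (N : fieldExtType Q) (nu : N -> R).
Hypothesis hnu : nonarch_abs nu.
Variables (K0 L : {subfield N}) (pi : N) (k0 : finFieldType) (red : N -> k0).
Local Notation w := (nu pi).
Hypotheses (hK0L : (K0 <= L)%VS) (piK0 : pi \in K0) (w0 : 0 < w) (w1 : w < 1).
Hypothesis val0 : forall x, x \in K0 -> nu x < 1 -> nu x <= w.
Hypothesis hred : residue_map nu K0 red.
Hypothesis hcl : forall W : {vspace N}, complete_in nu (fun x => x \in W).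

Let O0 := int_ring nu K0.
Let OL := int_ring nu L.

Let OB (E : {subfield N}) x y : int_ring nu E x -> int_ring nu E y -> int_ring nu E (x - y).
Proof. by move=> [ex hx] [ey hy]; split; [exact: rpredB|exact: absB_bound]. Qed.
Let OM (E : {subfield N}) x y : int_ring nu E x -> int_ring nu E y -> int_ring nu E (x * y).
Proof. by move=> [ex hx] [ey hy]; split; [exact: rpredM|exact: absM_le1]. Qed.
Let O1 (E : {subfield N}) : int_ring nu E 1.
Proof. by split; [exact: rpred1|rewrite abs1]. Qed.
Let OD (E : {subfield N}) x y : int_ring nu E x -> int_ring nu E y -> int_ring nu E (x + y).
Proof. by move=> [ex hx] [ey hy]; split; [exact: rpredD|exact: absD_bound]. Qed.
Let ON (E : {subfield N}) x : int_ring nu E x -> int_ring nu E (- x).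
Proof. by move=> [ex hx]; split; rewrite ?rpredN ?absN. Qed.
Let OZ (E : {subfield N}) : int_ring nu E 0.
Proof. by split; rewrite ?rpred0 ?abs0. Qed.
Let O0L x : O0 x -> OL x. Proof. by case=> hx nx; split=> //; apply: (subvP hK0L). Qed.

Lemma redB x y : O0 x -> O0 y -> red (x - y) = red x - red y.
Proof.
case: hred => _ hD _ _ _ hx hy; apply/eqP; rewrite eq_sym subr_eq -hD ?subrK //.
exact: OB.
Qed.

Lemma red_eq x y : O0 x -> O0 y -> (red x = red y <-> nu (x - y) <= w).
Proof.
move=> hx hy; have hxy : O0 (x - y) by apply: OB.
case: hred => _ _ _ _ /(_ _ hxy) hr; split=> [e|hw].
  have : red (x - y) = 0 by rewrite redB // e subrr.
  by move/hr => [? ?]; apply: val0 => //; case: hxy.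
apply/eqP; rewrite -subr_eq0 -redB //; apply/eqP/hr; split; first by case: hxy.
exact: le_lt_trans hw w1.
Qed.

Lemma red_lift : exists lift : k0 -> N, forall c, O0 (lift c) /\ red (lift c) = c.
Proof.
case: hred => _ _ _ hs _.
have ex c : exists x, O0 x /\ red x = c by have [x hx e] := hs c; exists x.
by have [l hl] := choice ex; exists l.
Qed.

(** The relation [e f = [L : K0]] in a form that mentions neither [e] nor [f]: lifts of a basis of
    [O_L / pi O_L] form a basis of [L] over [K0]. *)
Lemma residue_coordinates : exists th : N -> 'rV[k0]_(\dim_K0 L),
  [/\ forall x y, OL x -> OL y -> th (x + y) = th x + th y,
      forall v, exists2 x, OL x & th x = v
    & forall x, OL x -> (th x = 0 <-> nu x <= w)].
Proof.
have [lift hlift] := red_lift.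
have lO c : O0 (lift c) by case: (hlift c).
have lr c : red (lift c) = c by case: (hlift c).
have [Z [v [vinj vO vsurj [v0 vD vN]]]] := @zmodType_of_law N OL 0 +%R -%R (@OZ L) (@OD L)
  (@ON L) (fun x y t _ _ _ => addrA x y t) (fun x y _ _ => addrC x y)
  (fun x _ => add0r x) (fun x _ => addNr x).
have vB s t : v (s - t) = v s - v t by rewrite vD vN.
have ex (cz : k0 * Z) : exists t, v t = lift cz.1 * v cz.2.
  by apply: vsurj; apply: OM; [exact: O0L|exact: vO].
have [s' hs'] := choice ex; pose s c z := s' (c, z).
have vs c z : v (s c z) = lift c * v z by rewrite /s hs'.
pose H z := nu (v z) <= w.
have sH : subgrp H.
  split; first by rewrite /H v0 abs0 // ltW.
  by move=> x y hx hy; rewrite /H vB; apply: absB_bound.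
have small x y z : O0 x -> O0 y -> red x = red y -> nu (x * v z - y * v z) <= w.
  move=> hx hy /(red_eq hx hy) h; rewrite -mulrBl mulrC; apply: absM_le1 => //.
  by case: (vO z).
have sD c x y : H (s c (x + y) - (s c x + s c y)).
  by rewrite /H vB vD !vs vD mulrDr subrr abs0 // ltW.
have [red1 hD hM _ _] := hred.
have sDl c d x : H (s (c + d) x - (s c x + s d x)).
  rewrite /H vB vD !vs -mulrDl; apply: small.
  - exact: lO.
  - by apply: OD; exact: lO.
  by rewrite hD ?lr //; exact: lO.
have sM c d x : H (s (c * d) x - s c (s d x)).
  rewrite /H vB !vs mulrA; apply: small.
  - exact: lO.
  - by apply: OM; exact: lO.
  by rewrite hM ?lr //; exact: lO.
have s1 x : H (s 1 x - x).
  by rewrite /H vB vs -[X in _ - X]mul1r; apply: small; rewrite ?lr ?red1 //; exact: O1.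
have sHs c x : H x -> H (s c x).
  by move=> hx; rewrite /H vs; apply: absM_le1 => //; case: (lO c).
have vcomb r (x : 'I_r -> Z) c : v (comb s x c) = \sum_i lift (c 0 i) * v (x i).
  rewrite /comb (big_morph v vD v0); by apply: eq_bigr => i _.
(* independence modulo pi lifts to independence over K0 by dividing a relation
   by a coefficient of maximal absolute value *)
have free r (x : 'I_r -> Z) : indep H s x ->
    forall c : 'I_r -> N, (forall i, c i \in K0) -> \sum_i c i * v (x i) = 0 -> forall i, c i = 0.
  move=> ix c cK hc i1; apply/eqP/negPn/negP => ci1.
  have [i0 hi0] : exists i0, forall i, nu (c i) <= nu (c i0).
    have [i0 _ hi0] := @Order.TotalTheory.arg_maxP _ _ _ i1 xpredT (fun i => nu (c i)) isT.
    by exists i0 => i; apply: hi0.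
  have c0 : c i0 != 0.
    by rewrite -(abs_gt0 hnu); apply: lt_le_trans (hi0 i1); rewrite abs_gt0.
  pose b i := c i / c i0.
  have bO i : O0 (b i).
    split; first by rewrite rpredM ?rpredV.
    by rewrite absM // absV // ler_pdivrMr ?abs_gt0 // mul1r.
  have hb : \sum_i b i * v (x i) = 0.
    transitivity ((c i0)^-1 * \sum_i c i * v (x i)); last by rewrite hc mulr0.
    by rewrite mulr_sumr; apply: eq_bigr => i _; rewrite /b mulrAC mulrC.
  have /ix /rowP /(_ i0) : H (comb s x (\row_i red (b i))).
    rewrite /H vcomb -[X in nu X]subr0 -[X in _ - X]hb -sumrB; apply: abs_sum => //; first exact: ltW.
    by move=> i _; rewrite mxE; apply: small; rewrite ?lr //; exact: lO.
  by rewrite !mxE /b mulfV // red1 => /eqP; rewrite oner_eq0.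
pose W r (x : 'I_r -> Z) := (\sum_i (K0 * <[v (x i)]>))%VS.
have memW r (x : 'I_r -> Z) y : y \in W r x ->
    exists2 c : 'I_r -> N, (forall i, c i \in K0) & y = \sum_i c i * v (x i).
  move=> /memv_sumP[u hu ->].
  have exc i : exists c, c \in K0 /\ u i = c * v (x i).
    by have /memv_cosetP[c cK e] := hu i isT; exists c.
  have [c hc] := choice exc; exists c => [i|]; first by case: (hc i).
  by apply: eq_bigr => i _; case: (hc i).
have Wmem r (x : 'I_r -> Z) (c : 'I_r -> N) : (forall i, c i \in K0) ->
    \sum_i c i * v (x i) \in W r x.
  move=> hc; apply: memv_sumr => i _; apply/memv_cosetP; exists (c i) => //.
have WL r (x : 'I_r -> Z) : (W r x <= L)%VS.
  apply/subv_sumP => i _; apply/subvP => y /memv_cosetP[c cK ->].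
  by apply: rpredM; [exact: (subvP hK0L)|case: (vO (x i))].
have dimW r (x : 'I_r -> Z) : indep H s x -> \dim (W r x) = (r * \dim K0)%N.
  move=> ix; have xn0 i : v (x i) != 0.
    apply/eqP => e0; have := free _ _ ix (fun j => (j == i)%:R) _ _ i.
    rewrite eqxx => h1; have /eqP : (1 : N) = 0.
      apply: h1 => [j|]; first by case: eqP => _; rewrite ?rpred1 ?rpred0.
      by rewrite big1 // => j _; case: eqP => [->|_]; rewrite ?e0 ?mulr0 ?mul0r.
    by rewrite oner_eq0.
  have /directvP /= -> : directv (W r x).
    apply/directv_sum_independent => us hus us0 i _.
    have exc j : exists c, c \in K0 /\ us j = c * v (x j).
      by have /memv_cosetP[c cK e] := hus j isT; exists c.
    have [c hc] := choice exc; have hs0 : \sum_j c j * v (x j) = 0.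
      by rewrite -[RHS]us0; apply: eq_bigr => j _; case: (hc j).
    case: (hc i) => _ ->; rewrite (free _ _ ix c) ?mul0r // => j.
    by case: (hc j).
  rewrite (eq_bigr (fun _ => \dim K0)); last by move=> i _; rewrite dim_cosetv.
  by rewrite sum_nat_const card_ord.
have K0pos : (0 < \dim K0)%N by rewrite adim_gt0.
(* A crude bound, by the dimension over the base field, suffices for a maximal family to exist; its
   exact size comes from [LW]. *)
have bound r (x : 'I_r -> Z) : indep H s x -> (r <= \dim L)%N.
  move=> /dimW e; apply: leq_trans (dimvS (WL _ x)); rewrite e; exact: leq_pmulr.
have [r [x ix xs]] := maximal_family sH sD sDl sM s1 sHs bound.
(* the K0-span of the family is closed and approximates O_L, hence contains it *)
have approx n y : OL y -> exists2 t, t \in W r x & nu (y - t) <= w ^+ n /\ y - t \in L.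
  move=> hy; elim: n => [|n [t tW [nt Lt]]].
    by exists 0; rewrite ?mem0v // subr0 expr0; case: hy.
  have pn0 : pi ^+ n != 0 by rewrite expf_neq0 // -(abs_gt0 hnu).
  have [z hz] : exists z, v z = (y - t) / pi ^+ n.
    apply: vsurj; split.
      by rewrite rpredM // rpredV rpredX // (subvP hK0L).
    by rewrite absM // absV // absX // ler_pdivrMr ?exprn_gt0 // mul1r.
  have [c hc] := xs z; pose u := \sum_i lift (c 0 i) * v (x i).
  have uW : u \in W r x by apply: Wmem => i; case: (lO (c 0 i)).
  have puW : pi ^+ n * u \in W r x.
    rewrite mulr_sumr (eq_bigr (fun i => (pi ^+ n * lift (c 0 i)) * v (x i))).
      by apply: Wmem => i; rewrite rpredM ?rpredX //; case: (lO (c 0 i)).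
    by move=> i _; rewrite mulrA.
  exists (t + pi ^+ n * u); first exact: memvD.
  have e : y - (t + pi ^+ n * u) = pi ^+ n * (v z - u).
    by rewrite hz mulrBr [pi ^+ n * (_ / _)]mulrC divfK // opprD addrA.
  split; last by rewrite opprD addrA rpredB // (subvP (WL _ x)).
  rewrite e exprSr absM // absX // ler_pM2l ?exprn_gt0 //.
  by move: hc; rewrite /H vB vcomb.
have OW y : OL y -> y \in W r x.
  move=> hy; have exn n : exists t, t \in W r x /\ nu (y - t) <= w ^+ n.
    by have [t tW [nt _]] := approx n y hy; exists t.
  have [t ht] := choice exn.
  have ty : seq_to nu t y.
    apply: (seq_to_approx (r := w)); first by rewrite w1 ltW.
    by move=> n; rewrite absC //; case: (ht n).
  have [l lW tl] := hcl (fun n => proj1 (ht n)) (seq_to_cauchy hnu ty).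
  by rewrite (seq_to_uniq hnu ty tl).
have LW : (L <= W r x)%VS.
  (* The quantity [1 + nu y] is positive even when [y = 0]; the exponent [m] is chosen so that
     [pi ^+ m * y] is integral. *)
  apply/subvP => y yL; have hy0 : 0 < 1 + nu y by rewrite ltr_pwDl ?abs_ge0.
  have hw : 0 <= w < 1 by rewrite w1 ltW.
  have hiv : 0 < (1 + nu y)^-1 by rewrite invr_gt0.
  have [m hm] := expr_small hw hiv.
  have pm0 : pi ^+ m != 0 by rewrite expf_neq0 // -(abs_gt0 hnu).
  have /OW/memW[c cK e] : OL (pi ^+ m * y).
    split; first by rewrite rpredM // rpredX // (subvP hK0L).
    rewrite absM // absX //; apply: le_trans (_ : w ^+ m * (1 + nu y) <= 1).
      by rewrite ler_wpM2l ?exprn_ge0 ?(ltW w0) // lerDr.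
    by rewrite -ler_pdivlMr // mul1r ltW.
  have -> : y = \sum_i ((pi ^+ m)^-1 * c i) * v (x i).
    rewrite -[LHS](mulKf pm0) e mulr_sumr; by apply: eq_bigr => i _; rewrite mulrA.
  by apply: Wmem => i; rewrite rpredM // rpredV rpredX.
have er : r = \dim_K0 L.
  have eW : W r x = L :> {vspace N} by apply/eqP; rewrite eqEsubv LW WL.
  by rewrite -eW dimW // mulnK.
have [th [thD _ ths th0]] := quotient_coordinates sH sD sDl sM sHs ix xs.
(* [u] inverts [v] on [O_L]; its values elsewhere are unconstrained. *)
have exu y : exists z, OL y -> v z = y.
  by have [/vsurj[z e]|ny] := pselect (OL y); [exists z|exists 0].
have [u hu] := choice exu.
have uD y z : OL y -> OL z -> u (y + z) = u y + u z.
  by move=> hy hz; apply: vinj; rewrite vD !hu //; apply: OD.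
rewrite -er; exists (fun y => th (u y)); split.
- by move=> y z hy hz; rewrite uD.
- move=> c; have [z <-] := ths c; exists (v z); first exact: vO.
  by congr th; apply: vinj; rewrite hu //; exact: vO.
by move=> y hy; rewrite th0 /H hu.
Qed.

End ResidueRank.

(** * The cokernel of [[pi]_F] on [F(p_L)] and its number of elements *)

Section QuotientModPi.
Variables (R : realType) (Q : fieldType) (N : fieldExtType Q) (nu : N -> R).
Hypothesis hnu : nonarch_abs nu.
Variables (K0 L : {subfield N}) (pi : N) (k0 : finFieldType) (red : N -> k0).
Local Notation w := (nu pi).
Hypotheses (hK0L : (K0 <= L)%VS) (piK0 : pi \in K0) (w0 : 0 < w) (w1 : w < 1).
Hypothesis val0 : forall x, x \in K0 -> nu x < 1 -> nu x <= w.
Hypothesis hred : residue_map nu K0 red.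
Hypothesis hcl : forall W : {vspace N}, complete_in nu (fun x => x \in W).
Variables (F : nat -> nat -> N) (f : nat -> N) (br : N -> nat -> N) (ks : seq N).
Hypothesis FL : forall i j, F i j \in L /\ nu (F i j) <= 1.
Hypotheses (F10 : forall i, F i 0%N = (i == 1%N)%:R) (FC : forall i j, F i j = F j i).
Hypothesis Fassoc : forall n : nat,
  let X := 'X_(@Ordinal 3 0 isT) : {mpoly N[3]} in
  let Y := 'X_(@Ordinal 3 1 isT) : {mpoly N[3]} in
  let Z := 'X_(@Ordinal 3 2 isT) : {mpoly N[3]} in
  let Fn := ps_trunc2 (@mpolyC 3 N) F n in
  eq_mod_deg n (Fn (Fn X Y) Z) (Fn X (Fn Y Z)).
Hypotheses (f0 : f 0%N = 0) (f1 : f 1%N = 1).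
Hypothesis flog : forall n : nat,
  let X := 'X_(@Ordinal 2 0 isT) : {mpoly N[2]} in
  let Y := 'X_(@Ordinal 2 1 isT) : {mpoly N[2]} in
  let Fn := ps_trunc2 (@mpolyC 2 N) F n in
  let fn := ps_trunc1 (@mpolyC 2 N) f n in
  eq_mod_deg n (fn (Fn X Y)) (fn X + fn Y).
Local Notation O0 := (int_ring nu K0).
Local Notation pL := (max_ideal nu L).
Hypothesis brL : forall b, O0 b -> forall i, br b i \in L /\ nu (br b i) <= 1.
Hypotheses (brB : forall b, O0 b -> bracket f b (br b)) (br1 : br pi 1%N = pi).

Let id : {rmorphism N -> N} := (idfun : {rmorphism N -> N}).
Let EL := fun x => x \in L.
Local Notation fa := (ps_eval2 idfun nu F).
Local Notation fm b := (ps_eval1 idfun nu (br b)).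
Local Notation fo := (fm (- 1)).

Let EB x y : EL x -> EL y -> EL (x - y). Proof. exact: rpredB. Qed.
Let EM x y : EL x -> EL y -> EL (x * y). Proof. exact: rpredM. Qed.
Let E1 : EL 1. Proof. exact: rpred1. Qed.
Let Ec : complete_in nu EL. Proof. exact: hcl. Qed.
Let Epi : EL (id pi)^-1. Proof. by rewrite /EL rpredV; apply: (subvP hK0L). Qed.
Let A1 : O0 1. Proof. by split; [exact: rpred1|rewrite abs1]. Qed.
Let AB a b : O0 a -> O0 b -> O0 (a - b).
Proof. by move=> [ea ha] [eb hb]; split; [exact: rpredB|exact: absB_bound]. Qed.
Let AD a b : O0 a -> O0 b -> O0 (a + b).
Proof. by move=> [ea ha] [eb hb]; split; [exact: rpredD|exact: absD_bound]. Qed.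
Let AM a b : O0 a -> O0 b -> O0 (a * b).
Proof. by move=> [ea ha] [eb hb]; split; [exact: rpredM|exact: absM_le1]. Qed.
Let AN a : O0 a -> O0 (- a).
Proof. by move=> [ea ha]; split; rewrite ?rpredN ?absN. Qed.
Let Api : O0 pi. Proof. by split=> //; apply: ltW. Qed.
Let AN1 : O0 (- 1). Proof. exact: AN. Qed.
Let goodF i : good id nu EL (F i). Proof. by move=> j; apply: FL. Qed.
Let brG b : O0 b -> good id nu EL (br b). Proof. by move=> hb i; apply: brL. Qed.
Let br0 b : O0 b -> br b 0%N = 0. Proof. by move=> /brB[]. Qed.

Lemma fa_pL x y : pL x -> pL y -> pL (fa x y).
Proof. exact: (ev2_disc hnu EB EM E1 Ec goodF F10). Qed.
Lemma fm_pL b x : O0 b -> pL x -> pL (fm b x).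
Proof. exact: (fmul_disc hnu EB EM E1 Ec brG brB). Qed.
Lemma faC x y : fa x y = fa y x. Proof. exact: (ev2C id nu FC). Qed.
Lemma faA x y z : pL x -> pL y -> pL z -> fa x (fa y z) = fa (fa x y) z.
Proof. by move=> hx hy hz; symmetry; apply: (ev2A hnu EB EM E1 Ec goodF F10 Fassoc). Qed.
Lemma fa0 x : pL x -> fa 0 x = x.
Proof. by move=> hx; rewrite faC; apply: (ev2_0 hnu EB EM E1 Ec goodF F10). Qed.
Lemma faN x : pL x -> fa (fo x) x = 0.
Proof.
by move=> hx; rewrite faC; apply: (faddN hnu EB EM E1 Ec goodF F10 f0 f1 flog A1 AB brG brB).
Qed.
Lemma nu_faN x y : pL x -> pL y -> nu (fa x (fo y)) = nu (x - y).
Proof. exact: (abs_fsub hnu EB EM E1 Ec goodF F10 f0 f1 flog A1 AB brG brB). Qed.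
Lemma fmD b x y : O0 b -> pL x -> pL y -> fm b (fa x y) = fa (fm b x) (fm b y).
Proof. exact: (fmulD hnu EB EM E1 Ec goodF F10 f1 flog brG brB). Qed.
Lemma fmDl a b x : O0 a -> O0 b -> pL x -> fa (fm a x) (fm b x) = fm (a + b) x.
Proof. exact: (fmulDl hnu EB EM E1 Ec goodF F10 f1 flog A1 AB brG brB). Qed.
Lemma fmM a b x : O0 a -> O0 b -> pL x -> fm a (fm b x) = fm (a * b) x.
Proof. exact: (fmulA hnu EB EM E1 Ec f1 AM brG brB). Qed.
Lemma fm1 x : pL x -> fm 1 x = x.
Proof. exact: (fmul1 hnu EB EM E1 Ec f1 A1 brG brB). Qed.
Lemma nu_fmpi x : pL x -> nu x < w -> nu (fm pi x) = w * nu x.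
Proof. exact: (abs_mulpi hnu EB EM E1 Ec (brG Api) (br0 Api) br1). Qed.
Lemma fmpi_onto t : t \in L -> nu t <= w ^+ 3 ->
  exists x, [/\ x \in L, nu x <= w ^+ 2 & fm pi x = t].
Proof.
exact: (@mulpi_onto R N N id nu hnu EL EB EM E1 Ec pi (br pi) w0 w1 Epi
  (brG Api) (br0 Api) br1).
Qed.
Lemma fm_sep x y : pL x -> pL y -> fm pi x = 0 -> fm pi y = 0 -> nu (x - y) < w -> x = y.
Proof.
exact: (@zero_sep R N N id nu hnu EL EB EM E1 Ec F goodF F10 f f0 f1 flog O0 br
  A1 AB AM brG brB pi Api w0 br1).
Qed.

Hypotheses (uks : uniq ks) (hks : forall x, (pL x /\ fm pi x = 0) <-> x \in ks).

Let ball k x := x \in L /\ nu x <= w ^+ k.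
Let wX k : 0 < w ^+ k. Proof. exact: exprn_gt0. Qed.

Let ball_subgrp k : subgrp (ball k).
Proof.
split; first by split; [exact: rpred0|rewrite abs0 // ltW].
by move=> x y [lx hx] [ly hy]; split; [exact: rpredB|exact: absB_bound].
Qed.

Let pL_subgrp : subgrp pL.
Proof.
split; first by split; [exact: rpred0|rewrite abs0].
by move=> x y [lx hx] [ly hy]; split; [exact: rpredB|exact: absB_lt].
Qed.

Let ballS k x : ball k.+1 x -> ball k x.
Proof.
move=> [lx hx]; split=> //; apply: le_trans hx _.
by rewrite exprS ler_piMl // ltW.
Qed.

(** Division by [pi ^+ k] identifies the quotient with [O_L / pi O_L]. *)
Lemma ball_quot k : quot_by (ball k.+1) (ball k) 'rV[k0]_(\dim_K0 L).
Proof.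
have [th [thD ths th0]] := residue_coordinates hnu hK0L piK0 w0 w1 val0 hred hcl.
have pk0 : pi ^+ k != 0 by rewrite expf_neq0 // -(abs_gt0 hnu).
have pkL : pi ^+ k \in L by apply: rpredX; apply: (subvP hK0L).
have sc x : ball k x -> int_ring nu L (x / pi ^+ k).
  move=> [lx hx]; split; first by rewrite rpredM ?rpredV.
  by rewrite absM // absV // absX // ler_pdivrMr // mul1r.
exists (fun x => th (x / pi ^+ k)); split.
  move=> t; have [x [lx hx] <-] := ths t; exists (pi ^+ k * x); last first.
    by rewrite mulrC mulKf.
  by split; [exact: rpredM|rewrite absM // absX // ler_piMr // ltW].
move=> x y hx hy; have hxy : ball k (x - y) by case: (ball_subgrp k) => _; apply.
have e : x / pi ^+ k = (x - y) / pi ^+ k + y / pi ^+ k by rewrite -mulrDl subrK.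
rewrite e thD; [|exact: sc|exact: sc].
have hi : (th ((x - y) / pi ^+ k) = 0) <-> ball k.+1 (x - y).
  rewrite th0; last exact: sc.
  rewrite absM // absV // absX // ler_pdivrMr // -exprS.
  by split=> [h|[_ h]] //; split=> //; case: hxy.
split=> [h|/hi ->]; last by rewrite add0r.
by apply/hi/(addIr (th (y / pi ^+ k))); rewrite add0r.
Qed.

Lemma quotient_mod_pi : exists r, exists2 th : N -> 'rV[k0]_r,
  is_quotient_mod_pi nu K0 L pi F br red th &
  (#|k0| ^ r = #|k0| ^ (\dim_K0 L) * size ks)%N.
Proof.
have pL0 : pL 0 by case: pL_subgrp.
have [Z [v [vinj vP vsurj [v0 vD vN]]]] := @zmodType_of_law N pL 0 fa fo pL0 fa_pL
  (fun x => fm_pL AN1) faA (fun x y _ _ => faC x y) fa0 faN.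
have vB x y : v (x - y) = fa (v x) (fo (v y)) by rewrite vD vN.
have nvB x y : nu (v (x - y)) = nu (v x - v y) by rewrite vB nu_faN.
have exu x : exists z, pL x -> v z = x.
  by have [/vsurj[z e]|ny] := pselect (pL x); [exists z|exists 0].
have [u hu] := choice exu.
have uv z : u (v z) = z by apply: vinj; rewrite hu.
pose act b z := u (fm b (v z)).
have vact b z : O0 b -> v (act b z) = fm b (v z) by move=> hb; rewrite hu //; apply: fm_pL.
have actD b x y : O0 b -> act b (x + y) = act b x + act b y.
  by move=> hb; apply: vinj; rewrite vD !vact // vD fmD.
have actM a b x : O0 a -> O0 b -> act a (act b x) = act (a * b) x.
  by move=> ha hb; apply: vinj; rewrite !vact ?fmM //; apply: AM.
have act1 x : act 1 x = x by apply: vinj; rewrite vact // fm1.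
have actDl a b x : O0 a -> O0 b -> act (a + b) x = act a x + act b x.
  by move=> ha hb; apply: vinj; rewrite vD !vact // ?fmDl //; apply: AD.
have actB b x y : O0 b -> act b (x - y) = act b x - act b y.
  by move=> hb; apply/eqP; rewrite eq_sym subr_eq -actD // subrK.
have act0 b : O0 b -> act b 0 = 0 by move=> hb; rewrite -[X in act b X](subrr 0) actB // subrr.
have actBl a b x : O0 a -> O0 b -> act (a - b) x = act a x - act b x.
  by move=> ha hb; apply/eqP; rewrite eq_sym subr_eq -actDl ?subrK //; exact: AB.
pose phi := act pi; pose U z := nu (v z) <= w ^+ 2.
pose top := fun _ : Z => True; pose im z := exists y, z = phi y.
have w2w : w ^+ 2 < w by rewrite expr2 gtr_pMr.
have nphi z : U z -> nu (v (phi z)) = w * nu (v z).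
  by move=> hz; rewrite vact // nu_fmpi //; apply: le_lt_trans hz w2w.
have sU : subgrp U.
  split; first by rewrite /U v0 abs0 // ltW.
  by move=> x y hx hy; rewrite /U nvB; apply: absB_bound.
have Uphi z : U z -> U (phi z).
  by move=> hz; rewrite /U nphi //; apply: le_trans hz; rewrite ler_piMl ?abs_ge0 // ltW.
have Uinj z : U z -> phi z = 0 -> z = 0.
  move=> hz e; have := nphi z hz; rewrite e v0 abs0 // => /esym/eqP.
  by rewrite mulf_eq0 gt_eqF //= abs_eq0 // -v0 => /eqP/vinj.
(* For addition, [ball 2] has finite index in [ball 0 = O_L], so [p_L] meets finitely many of its
   cosets; by [nvB] these are also the cosets for the group law. *)
have [T2 q2] : exists T2 : finType, quot_by U top T2.
  have q20 := quot_by_tower (ball_subgrp 2) (ball_subgrp 1) (ball_subgrp 0)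
    (@ballS 1) (@ballS 0) (ball_quot 0) (ball_quot 1).
  have sub0 x : pL x -> ball 0 x by case=> lx hx; split=> //; rewrite expr0 ltW.
  have [T [th [ths thf]]] := quot_by_sub pL_subgrp sub0 q20.
  exists T; exists (fun z => th (v z)); split.
    by move=> t; have [x hx <-] := ths t; exists (u x) => //; rewrite hu.
  move=> x y _ _; rewrite thf // /ball /U nvB; split=> [[]|h] //; split=> //.
  by apply: rpredB; [case: (vP x)|case: (vP y)].
have phiUP z : (exists2 y, U y & z = phi y) <-> nu (v z) <= w ^+ 3.
  split=> [[y hy ->]|hz]; first by rewrite nphi // exprS ler_pM2l.
  have [x [lx hx e]] := fmpi_onto (proj1 (vP z)) hz.
  have px : pL x by split=> //; apply: le_lt_trans hx (lt_trans w2w w1).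
  exists (u x); first by rewrite /U hu.
  by apply: vinj; rewrite vact // hu.
have q1 : quot_by (fun z => exists2 y, U y & z = phi y) U 'rV[k0]_(\dim_K0 L).
  have [th [ths thf]] := ball_quot 2.
  have UB z : U z -> ball 2 (v z) by move=> hz; split=> //; case: (vP z).
  exists (fun z => th (v z)); split.
    move=> t; have [x [lx hx] <-] := ths t.
    have px : pL x by split=> //; apply: le_lt_trans hx (lt_trans w2w w1).
    by exists (u x); rewrite ?hu // /U hu.
  move=> x y hx hy; rewrite thf; [|exact: UB|exact: UB].
  rewrite phiUP nvB; split=> [[]|h] //; split=> //.
  by apply: rpredB; [case: (vP x)|case: (vP y)].
have phiB x y : phi (x - y) = phi x - phi y by apply: actB.
have sim : subgrp im.
  split; first by exists 0; rewrite /phi act0.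
  by move=> _ _ [x ->] [y ->]; exists (x - y).
have im_phiU z : (exists2 y, U y & z = phi y) -> im z by case=> y _ ->; exists y.
have [lift hlift] := red_lift hred.
have lO c : O0 (lift c) by case: (hlift c).
have lr c : red (lift c) = c by case: (hlift c).
(* If [b1 - b2 = pi * c], then [[b1 - b2]_F = [pi]_F o [c]_F] has its values in the image of
   [[pi]_F]. Hence [k0] acts on the cokernel through arbitrary lifts. *)
have cong b1 b2 z : O0 b1 -> O0 b2 -> red b1 = red b2 -> im (act b1 z - act b2 z).
  move=> h1 h2 e; have [bK hb] := AB h1 h2.
  have nb := proj1 (red_eq hnu w1 val0 hred h1 h2) e.
  have p0 : pi != 0 by rewrite -(abs_gt0 hnu).
  have cO : O0 ((b1 - b2) / pi).
    split; first by rewrite rpredM ?rpredV.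
    by rewrite absM // absV // ler_pdivrMr // mul1r.
  exists (act ((b1 - b2) / pi) z); rewrite /phi actM // mulrC divfK //.
  by rewrite actBl.
have [red1 hD hM _ _] := hred.
pose s c z := act (lift c) z.
have im0 z : z = 0 -> im z by move=> ->; case: sim.
have sD c x y : im (s c (x + y) - (s c x + s c y)).
  by apply: im0; rewrite /s actD // subrr.
have sDl c d x : im (s (c + d) x - (s c x + s d x)).
  rewrite /s -actDl //; apply: cong => //; first exact: AD.
  by rewrite hD ?lr.
have sM c d x : im (s (c * d) x - s c (s d x)).
  rewrite /s actM //; apply: cong => //; first exact: AM.
  by rewrite hM ?lr.
have s1 x : im (s 1 x - x).
  by rewrite /s -{2}[x]act1; apply: cong => //; rewrite lr.
have sHs c x : im x -> im (s c x).
  by move=> [y ->]; exists (s c y); rewrite /s /phi !actM // mulrC.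
have [T qT] : exists T : finType, quot_by (fun z => exists2 y, U y & z = phi y) top T.
  exists (T2 * 'rV[k0]_(\dim_K0 L))%type; apply: (quot_by_tower _ sU _ _ _ q2 q1) => //.
    split; first by exists 0; [case: sU|rewrite /phi act0].
    by move=> _ _ [x hx ->] [y hy ->]; exists (x - y) => //; case: sU => _; apply.
  by move=> _ [y hy ->]; apply: Uphi.
(* An independent family of size [r] gives [#|k0| ^ r] classes that are distinct in the finite
   quotient by [phi U], and [r < #|k0| ^ r]. *)
have bound r (x : 'I_r -> Z) : indep im s x -> (r <= #|T|)%N.
  move=> ix; case: qT => th [_ thf].
  have inj : injective (fun c : 'rV[k0]_r => th (comb s x c)).
    move=> c d /thf h; apply/eqP; rewrite -subr_eq0; apply/eqP; apply: ix.
    have h1 := combD sim sDl x c (- d); have h2 := combN sim sDl x d.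
    have h3 := im_phiU _ (h I I).
    have := subgrpD sim (subgrpD sim h1 h2) h3; congr im.
    rewrite opprD opprK !addrA subrK.
    by rewrite [_ + comb s x d + _]addrAC subrK addrK.
  have := leq_card _ inj; rewrite card_mx mul1n; apply: leq_trans.
  by apply: ltnW; apply: ltn_expl; apply: card_finNzRing_gt1.
have [r [x ix xs]] := maximal_family sim sD sDl sM s1 sHs bound.
have [th [thD thZ ths th0]] := quotient_coordinates sim sD sDl sM sHs ix xs.
have thB y z : th (y - z) = th y - th z.
  by apply/eqP; rewrite eq_sym subr_eq -thD subrK.
have th_eq y z : th y = th z <-> im (y - z).
  rewrite -th0 thB; split=> [->|/eqP]; first by rewrite subrr.
  by rewrite subr_eq0 => /eqP.
have uks' : uniq [seq u y | y <- ks].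
  rewrite map_inj_in_uniq // => y z /hks[hy _] /hks[hz _] e.
  by rewrite -(hu y hy) -(hu z hz) e.
have hks' z : phi z = 0 <-> z \in [seq u y | y <- ks].
  split=> [e|/mapP[y /hks[hy e] ->]].
    apply/mapP; exists (v z); last by rewrite uv.
    by apply/hks; split=> //; rewrite -vact // -/phi e.
  by apply: vinj; rewrite vact // hu // e v0.
exists r, (fun y => th (u y)).
  split.
  - by move=> y z hy hz; rewrite -thD; congr th; apply: vinj; rewrite vD !hu //; apply: fa_pL.
  - move=> b y hb hy; rewrite -thZ; apply/th_eq.
    have -> : u (fm b y) = act b (u y) by rewrite /act hu.
    by apply: cong => //; rewrite lr.
  - by move=> c; have [z <-] := ths c; exists (v z); rewrite ?uv.
  move=> y hy; rewrite th0; split=> [[z e]|[z hz e]].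
    by exists (v z) => //; rewrite -vact // -/phi -e hu.
  by exists (u z); apply: vinj; rewrite vact // !hu.
have qV : quot_by im top 'rV[k0]_r.
  exists th; split=> [c|y z _ _]; last exact: th_eq.
  by have [y e] := ths c; exists y.
have := index_count phiB sU Uphi Uinj uks' hks' q2 q1 qV.
by rewrite !card_mx !mul1n size_map.
Qed.

End QuotientModPi.

Lemma nonarch_abs_comp (R : realType) (N C : fieldType) (iota : {rmorphism N -> C})
  (abs : C -> R) : nonarch_abs abs -> nonarch_abs (fun x => abs (iota x)).
Proof.
move=> [k1 k2 k3 k4]; split=> [x|x|x y|x y].
- exact: k1.
- split=> [/k2/eqP|->]; first by rewrite fmorph_eq0 => /eqP.
  by rewrite rmorph0; apply/k2.
- by rewrite rmorphM k3.
- by rewrite rmorphD.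
Qed.

(** * The zeros of [[pi]_F] in the algebraic closure *)

Section KernelRoots.
Variables (R : realType) (Q : fieldType) (N : fieldExtType Q) (C : closedFieldType).
Variables (iota : {rmorphism N -> C}) (abs : C -> R).
Hypothesis habs : nonarch_abs abs.
Hypothesis hQ : forall u : nat -> Q, cauchy_seq (fun x => abs (iota x%:A)) u ->
  exists l, seq_to (fun x => abs (iota x%:A)) u l.
Let nu : N -> R := fun x => abs (iota x).
Variables (L : {vspace N}) (F : nat -> nat -> N) (f : nat -> N).
Hypotheses (FO : forall i j, nu (F i j) <= 1)
  (F10 : forall i, F i 0%N = (i == 1%N)%:R) (FC : forall i j, F i j = F j i).
Hypotheses (f0 : f 0%N = 0) (f1 : f 1%N = 1).
Hypothesis flog : forall n : nat,
  let X := 'X_(@Ordinal 2 0 isT) : {mpoly N[2]} in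
  let Y := 'X_(@Ordinal 2 1 isT) : {mpoly N[2]} in
  let Fn := ps_trunc2 (@mpolyC 2 N) F n in
  let fn := ps_trunc1 (@mpolyC 2 N) f n in
  eq_mod_deg n (fn (Fn X Y)) (fn X + fn Y).

(** Serves to place [W^1] inside [W^s]. The point [x] comes with no complete ring containing it, so
    only truncations occur: [y], the truncation of [[b]_F] at [x], tends to 0, truncated [[a]_F]
    satisfies [|[a]_F(y)| <= |y|], and the composite differs from truncated [[a b]_F] by at most
    [|x| ^ n]. *)
Lemma mul_sum_zero a b g1 g2 g3 x : (forall i, nu (g1 i) <= 1) -> (forall i, nu (g2 i) <= 1) ->
  (forall i, nu (g3 i) <= 1) -> bracket f a g1 -> bracket f b g2 -> bracket f (a * b) g3 ->
  abs x < 1 -> ps_sum1 iota abs g2 x 0 -> ps_sum1 iota abs g3 x 0.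
Proof.
move=> i1 i2 i3 h1 h2 h3 hx s2 e e0.
have hr : 0 <= abs x < 1 by rewrite abs_ge0.
have [n0 hn0] := s2 e e0; have [n1 hn1] := expr_small_all hr e0.
exists (maxn n0 n1) => n; rewrite geq_max => /andP[/hn0 k0 /hn1 k1].
rewrite subr0 in k0; rewrite subr0; set y := ps_trunc1 iota g2 n x in k0.
have x1 := ltW hx; have y1 : abs y <= 1 by apply: (trunc1_le1 habs).
have A : abs (ps_trunc1 iota g1 n y - ps_trunc1 iota g3 n x) <= abs x ^+ n.
  pose v := fun _ : 'I_2 => x; pose X : {mpoly N[2]} := 'X_(@Ordinal 2 0 isT).
  have hc b' : mmap iota v (mpolyC 2 b') = iota b' by exact: mmapC.
  have r01 : 0 <= abs x <= 1 by rewrite abs_ge0 ?x1.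
  have o := bracket_mul f1 (n := n) h1 h2 h3 (@ordge_var N 2 (@Ordinal 2 0 isT)).
  have hv (i : 'I_2) : abs (v i) <= abs x by [].
  have hint : mint iota abs (ps_trunc1 (@mpolyC 2 N) g1 n (ps_trunc1 (@mpolyC 2 N) g2 n X) -
      ps_trunc1 (@mpolyC 2 N) g3 n X).
    apply: (mintD habs); last apply: (mintN habs).
      by apply: (mint_trunc1 habs) => //; apply: (mint_trunc1 habs) => //; apply: mintX => //.
    by apply: (mint_trunc1 habs) => //; apply: mintX => //.
  have := abs_mmap habs r01 hv hint o.
  by rewrite rmorphB /= !(ps_trunc1_morph hc) /= mmapX mmap1U.
have B : abs (ps_trunc1 iota g1 n y) <= abs y.
  have := trunc1_lip habs n i1 y1 (_ : abs 0 <= 1); rewrite abs0 // subr0 => /(_ ler01).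
  suff -> : ps_trunc1 iota g1 n 0 = 0 by rewrite subr0.
  rewrite /ps_trunc1 big1 // => -[[|i] hi] _ /=; last by rewrite expr0n mulr0.
  by case: h1 => -> _; rewrite rmorph0 mul0r.
rewrite -[ps_trunc1 iota g3 n x](subKr (ps_trunc1 iota g1 n y)).
by apply: (absB_lt habs); [exact: le_lt_trans B k0|exact: le_lt_trans A k1].
Qed.

Variables (A : N -> Prop) (br : N -> nat -> N) (pi : N) (d : nat).
Local Notation w := (abs (iota pi)).
Local Notation pL := (max_ideal nu L).
Local Notation g := (br pi).
Hypotheses (A1 : A 1) (AB : forall a b, A a -> A b -> A (a - b)).
Hypothesis AM : forall a b, A a -> A b -> A (a * b).
Hypotheses (brO : forall b, A b -> forall i, nu (br b i) <= 1)
  (brB : forall b, A b -> bracket f b (br b)) (br1 : br pi 1%N = pi).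
Hypotheses (Api : A pi) (w0 : 0 < w) (w1 : w < 1) (d1 : (1 < d)%N).
Hypotheses (glow : forall j, (j < d)%N -> nu (g j) <= w) (gd : nu (g d) = 1)
  (gder : forall k, nu (k.+1%:R * g k.+1) <= w).
Hypothesis hWL : forall x, abs x < 1 -> ps_sum1 iota abs g x 0 -> exists2 y, y \in L & x = iota y.
Hypothesis conv : forall y, pL y -> forall n,
  nu (ps_eval1 idfun nu g y - ps_trunc1 idfun g n y) <= nu y ^+ n.
Hypothesis sep : forall x y, pL x -> pL y -> ps_eval1 idfun nu g x = 0 ->
  ps_eval1 idfun nu g y = 0 -> nu (x - y) < w -> x = y.

Let g0 : g 0%N = 0. Proof. by case: (brB Api). Qed.
Let gO i : abs (iota (g i)) <= 1. Proof. exact: brO. Qed.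

Let trm n y : iota (ps_trunc1 idfun g n y) = ps_trunc1 iota g n (iota y).
Proof. exact: (@ps_trunc1_morph N N C idfun iota iota (fun a => erefl)). Qed.

(** Serves both exact roots of a truncation and zeros of [g], whose truncation at [d.+1] is only
    known to be at most [|x| ^ d.+1]; that is already less than the value [|x| ^ d] forced beyond
    the threshold. *)
Let root_bound x n : abs x < 1 -> (d < n)%N -> abs (ps_trunc1 iota g n x) <= abs x ^+ d.+1 ->
  abs x ^+ d.-1 <= w.
Proof.
move=> hx dn h; rewrite leNgt; apply/negP => hw; move: h.
rewrite (trunc_large habs w0 d1 gO g0 glow gd dn hx hw) leNgt => /negP; apply.
have x0 : 0 < abs x.
  rewrite abs_gt0 //; apply/eqP => x0; move: hw; rewrite x0 abs0 // expr0n.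
  by case: (d) d1 => [|[|j]] //= _; rewrite ltNge (ltW w0).
by rewrite exprSr gtr_pMr ?exprn_gt0.
Qed.

(** As [m >= (d - 1) (d + 3)], the bound [|x| ^ (d-1) <= w] makes the truncation error at most
    [w ^ (d+3)]. This is at most [w ^ 3], as a small preimage requires, and less than [w ^ d], as
    needed to find a root near every zero. *)
Let m := (d * d + 3 * d)%N.
Let dm : (d < m)%N. Proof. rewrite /m; nia. Qed.

Let pow_bound x : abs x < 1 -> abs x ^+ d.-1 <= w -> abs x ^+ m <= w ^+ (d + 3).
Proof.
move=> hx h; apply: (@le_trans _ _ (abs x ^+ (d.-1 * (d + 3)))).
  by apply: ler_wiXn2l; rewrite ?abs_ge0 ?(ltW hx) // /m; nia.
by rewrite exprM lerXn2r ?nnegrE ?exprn_ge0 ?abs_ge0 // ltW.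
Qed.

(** The zero is constructed in the complete field [N(r)]; being a zero of [[pi]_F] in the disc, it
    then lies in [L] by [hWL]. *)
Let zero_of_root r : abs r < 1 -> ps_trunc1 iota g m r = 0 ->
  exists y, [/\ pL y, ps_eval1 idfun nu g y = 0 & abs (iota y - r) <= w ^+ 2].
Proof.
move=> hr tr; pose E x := exists S : {poly N}, x = (map_poly iota S).[r].
have EB x y : E x -> E y -> E (x - y).
  by move=> [S ->] [T ->]; exists (S - T); rewrite rmorphB hornerD hornerN.
have EM x y : E x -> E y -> E (x * y).
  by move=> [S ->] [T ->]; exists (S * T); rewrite rmorphM hornerM.
have Ei x : E (iota x) by exists x%:P; rewrite map_polyC hornerC.
have E1 : E 1 by rewrite -(rmorph1 iota).
have P0 : trunc_poly g m != 0.
  apply/eqP => /(congr1 (fun P : {poly N} => P`_d)); rewrite coef_trunc_poly dm coef0 => e.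
  by move: gd; rewrite /nu e rmorph0 abs0 // => /esym/eqP; rewrite oner_eq0.
have Pr : root (map_poly iota (trunc_poly g m)) r by rewrite /root horner_trunc_poly tr.
have Ec := adjoin_complete habs hQ P0 Pr.
have Er : E r by exists 'X; rewrite map_polyX hornerX.
have goodF i : good iota abs E (F i) by move=> j; split; [exact: Ei|exact: FO].
have brG b : A b -> good iota abs E (br b) by move=> Ab j; split; [exact: Ei|exact: brO].
have Epi : E (iota pi)^-1 by rewrite -fmorphV.
have hb : abs r ^+ d.-1 <= w.
  by apply: (root_bound hr dm); rewrite tr abs0 // exprn_ge0 // abs_ge0.
have small : abs (ps_eval1 iota abs g r) <= w ^+ 3.
  have [_ _ /(_ m)] := ev1_sum habs EB EM E1 Ec (brG _ Api) (conj Er hr).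
  rewrite tr subr0 => h; apply: le_trans h _; apply: le_trans (pow_bound hr hb) _.
  by apply: ler_wiXn2l; rewrite ?(ltW w0) ?(ltW w1) //; lia.
have [z [dz ez hz]] := @zero_near R N C iota abs habs E EB EM E1 Ec F goodF F10 FC f f0 f1 flog
  A br A1 AB AM brG brB pi Api w0 w1 Epi br1 r (conj Er hr) small.
have [_ sz _] := ev1_sum habs EB EM E1 Ec (brG _ Api) dz; rewrite ez in sz.
have [y yL ey] := hWL (proj2 dz) sz.
exists y; split; [|  |by rewrite -ey].
  by split=> //; rewrite /nu -ey; case: dz.
have s0 : ps_sum1 idfun nu g y 0.
  move=> e e0; have [n0 h] := sz e e0; exists n0 => n /h.
  by rewrite ey -trm subr0 /nu subr0.
apply: (seq_to_uniq (nonarch_abs_comp iota habs) _ s0).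
by apply: xgetPex; exists 0.
Qed.

Lemma kernel_roots : exists ks : seq N, [/\ uniq ks, size ks = d &
  forall x, (pL x /\ ps_eval1 idfun nu g x = 0) <-> x \in ks].
Proof.
have [rs [srs urs hrs hsep hprod]] := disc_roots habs w0 w1 d1 gO br1 glow gd gder dm.
have exz r : exists y, r \in rs ->
    [/\ pL y, ps_eval1 idfun nu g y = 0 & abs (iota y - r) <= w ^+ 2].
  have [rr|nr] := boolP (r \in rs); last by exists 0.
  by have [hr tr] := hrs r rr; have [y hy] := zero_of_root hr tr; exists y.
have [z hz] := choice exz.
have w2 : w ^+ 2 < w by rewrite expr2 gtr_pMr.
exists [seq z r | r <- rs]; split; rewrite ?size_map //.
  rewrite map_inj_in_uniq // => r r' rr rr' e; apply/eqP/negPn/negP => ne.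
  have := hsep r r' rr rr' ne; rewrite leNgt => /negP; apply; apply: le_lt_trans w2.
  have [_ _ h1] := hz r rr; have [_ _ h2] := hz r' rr'; rewrite -e in h2.
  by rewrite absC // in h1; apply: (abs_trans habs h1).
move=> x; split=> [[[xL hx] ex]|/mapP[r rr ->]]; last by case: (hz r rr).
have tx n : abs (ps_trunc1 iota g n (iota x)) <= abs (iota x) ^+ n.
  by have := conv (conj xL hx) n; rewrite ex sub0r /nu rmorphN absN // trm.
have hb : abs (iota x) ^+ d.-1 <= w by apply: (root_bound hx (ltnSn d)).
(* If all [d] roots were at distance at least [w] from [x], the truncation would be at least [w ^ d]
   there, more than the truncation error allows for a zero of [g]. *)
have [r rr hr] : exists2 r, r \in rs & abs (iota x - r) < w.
  apply: contrapT => nr; have : w ^+ d <= abs (ps_trunc1 iota g m (iota x)).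
    rewrite hprod // -srs.
    have : forall r, r \in rs -> w <= abs (iota x - r).
      by move=> r rr; rewrite leNgt; apply/negP => h; apply: nr; exists r.
    elim: (rs) => [|r s IH] h; first by rewrite big_nil expr0.
    rewrite big_cons exprS; apply: ler_pM; rewrite ?exprn_ge0 ?(ltW w0) //.
      by apply: h; rewrite mem_head.
    by apply: IH => r' hr'; apply: h; rewrite inE hr' orbT.
  rewrite leNgt => /negP; apply; apply: le_lt_trans (tx m) _.
  by apply: le_lt_trans (pow_bound hx hb) _; rewrite ltr_iXn2l //; lia.
have [zL ez hzr] := hz r rr; apply/mapP; exists r => //.
apply: sep => //; rewrite /nu rmorphB -[_ - _](subrK r).
have -> : iota x - iota (z r) - r + r = (iota x - r) - (iota (z r) - r) by ring.
by apply: (absB_lt habs) => //; apply: le_lt_trans w2.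
Qed.

End KernelRoots.

(** * The dimension of the cokernel *)

Theorem lemma2p12
  (R : realType) (p : nat)
  (Qp : fieldType)
  (* N: a finite normal extension of Q_p, large enough to contain M *)
  (N : splittingFieldType Qp)
  (K0 K L M : {subfield N})
  (* Kalg: an algebraic closure of K, with its p-adic absolute value *)
  (Kalg : closedFieldType) (iota : {rmorphism N -> Kalg}) (abs : Kalg -> R)
  (hKalg : forall z : Kalg, exists P : {poly N},
     [/\ P \is a polyOver K, P != 0 & root (map_poly iota P) z])
  (habs : nonarch_abs abs)
  (hQp : is_Qp (fun x : Qp => abs (iota x%:A)) p) :
  let nu : N -> R := fun x => abs (iota x) in
  forall
  (pi : N) (hpi : uniformizer nu K0 pi)
  (k0 : finFieldType) (red : N -> k0) (hred : residue_map nu K0 red)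
  (hK0K : (K0 <= K)%VS) (hKur : unramified nu K0 K)
  (hKL : (K <= L)%VS)
  (hLM : (L <= M)%VS) (hMur : unramified nu L M)
  (m : nat) (hgal : galois L M) (hm : #|'Gal(M / L)%g| = (p ^ m)%N)
  (* phi: the Frobenius automorphism of K/K0 *)
  (phi : gal_of K) (hphi : phi \in 'Gal(K / K0)%g)
  (hfrob : forall x, int_ring nu K x -> max_ideal nu K (phi x - x ^+ #|k0|))
  (* F: a Honda formal group with logarithm f, of type u = \sum_i a_i T^i *)
  (F : nat -> nat -> N) (hF : formal_group nu K F)
  (f : nat -> N) (hf : logarithm K F f)
  (a : nat -> N) (ha : honda_type nu K pi a)
  (hu : honda_of_type nu K pi phi #|k0| a f)
  (h : nat) (hh : type_height nu a h)
  (* br b = [b]_F *)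
  (br : N -> nat -> N) (hbr : forall b, int_ring nu K0 b -> fg_mult f b (br b))
  (s : nat) (hs : (1 <= s)%N),
  let Wk := fg_torsion iota abs pi br in
  let W := \bigcup_k Wk k in
  W `&` (iota @` max_ideal nu L) = Wk s ->
  W `&` (iota @` max_ideal nu M) = Wk s ->
  exists (V : vectType k0) (theta : N -> V),
    is_quotient_mod_pi nu K0 L pi F br red theta /\
    \dim {:V} = (\dim_K0 L + h)%N.
Proof.
move=> nu pi hpi k0 red hred hK0K hKur hKL hLM hMur m hgal hm phi hphi hfrob F hF f hf.
move=> a ha hu h hh br hbr s hs Wk W hWL _.
have hnu : nonarch_abs nu := nonarch_abs_comp iota habs.
have [pP _ hnat _ hQ] := hQp.
have [piK0 mK0] := hpi.
have maxE x : max_ideal nu K0 x -> nu x <= nu pi.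
  by rewrite mK0 => -[y [_ hy] <-]; rewrite absM // ler_piMr // abs_ge0.
have w1 : nu pi < 1.
  have : max_ideal nu K0 pi.
    by rewrite mK0; exists 1; [split; [exact: rpred1|rewrite abs1]|rewrite mulr1].
  by case.
have val0 x : x \in K0 -> nu x < 1 -> nu x <= nu pi by move=> xK hx; apply: maxE.
(* [p] is a nonzero element of the maximal ideal, hence a multiple of [pi], and [|p| = 1/p] is
   positive. *)
have w0 : 0 < nu pi.
  have np : nu p%:R = p%:R^-1.
    have := hnat p (prime_gt0 pP); rewrite -[p in logn _ p]expn1 pfactorK // expr1 => <-.
    by rewrite scaler_nat.
  have p1 : (1 : R) < p%:R by rewrite ltr1n prime_gt1.
  apply: lt_le_trans (_ : nu p%:R <= _); first by rewrite np invr_gt0 (lt_trans ltr01).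
  by apply: val0; [exact: rpred_nat|rewrite np invf_lt1 // (lt_trans ltr01)].
have unram x : x \in K -> nu x < 1 -> nu x <= nu pi.
  move=> xK hx; have : max_ideal nu K x by [].
  rewrite hKur => -[y [z [hy [_ hz] ->]]]; rewrite absM //.
  by apply: le_trans (maxE y hy); rewrite ler_piMr // abs_ge0.
have hK0L := subv_trans hK0K hKL.
have piK : pi \in K := subvP hK0K _ piK0.
have O1 : int_ring nu K0 1 by split; [exact: rpred1|rewrite abs1].
have OB x y : int_ring nu K0 x -> int_ring nu K0 y -> int_ring nu K0 (x - y).
  by move=> [? ?] [? ?]; split; [exact: rpredB|exact: absB_bound].
have OM x y : int_ring nu K0 x -> int_ring nu K0 y -> int_ring nu K0 (x * y).
  by move=> [? ?] [? ?]; split; [exact: rpredM|exact: absM_le1].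
have Opi : int_ring nu K0 pi by split=> //; apply: ltW.
(* The residue characteristic [l] is read off the finite field [k0]; [|l| <= |pi|] will follow
   because [red] sends [l] to 0. *)
have [l lP lchar] := finPcharP k0.
have [e e0 qE] : exists2 e, (0 < e)%N & #|k0| = (l ^ e)%N.
  have qe := card_pprimeChar lchar; exists (logn l #|k0|) => //.
  rewrite lt0n; apply/eqP => z; move: (card_finNzRing_gt1 k0).
  by rewrite (qe : #|k0| = _) z.
have hl : nu l%:R <= nu pi.
  have [r1 rD _ _ rP] := hred.
  have redn n : red n%:R = n%:R.
    elim: n => [|n IH]; last first.
      rewrite -!natr1 rD ?IH ?r1 //; split; rewrite ?rpred_nat ?abs_nat //.
    by apply/rP; split; rewrite ?rpred0 ?abs0.
  apply: maxE; apply/rP; first by split; rewrite ?rpred_nat ?abs_nat.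
  by rewrite redn; case/andP: lchar => _ /eqP.
pose ph : {rmorphism N -> N} := (gal_repr phi : {rmorphism N -> N}).
have phiK x : x \in K -> ph x \in K by apply: memv_gal.
have phiK0 x : x \in K0 -> ph x = x by move=> xK; apply: fixed_gal hphi xK.
(* The Frobenius congruence gives only an absolute value below 1; since [K] is unramified over [K0],
   this is divisibility by [pi]. *)
have frob x : x \in K -> nu x <= 1 -> nu (ph x - x ^+ (l ^ e)) <= nu pi.
  move=> xK hx; have [? ?] := hfrob x (conj xK hx).
  by rewrite -qE; apply: unram.
have [a0 aO] := ha; have [fK f0 f1 flog] := hf; have [FK F10 FC Fassoc] := hF.
have hu' n : bnd nu K (nu pi) (type_act ph (l ^ e) a f n).
  have [y [yK hy] ey] := hu n; rewrite -qE; rewrite [type_act _ _ _ _ _]ey.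
  by split; [exact: rpredM|rewrite absM // ler_piMr // abs_ge0].
have brB b : int_ring nu K0 b -> bracket f b (br b) := hbr b.
have brO b (hb : int_ring nu K0 b) i : bnd nu K 1 (br b i).
  case: (hb) => bK nb.
  apply: (bracket_integral hnu lP e0 hl piK w0 w1 (phiK0 _ piK0) phiK frob a0 aO fK f0 f1 hu'
    _ (phiK0 _ bK) (brB _ hb)).
  by split=> //; apply: (subvP hK0K).
have br1 : br pi 1%N = pi.
  case: (brB _ Opi) => g0 /(_ 2%N 1%N isT); rewrite /ps_trunc1 !big_ord_recl !big_ord0 /= f0 f1 g0.
  by rewrite !(polyC0, polyC1, mul0r, add0r, addr0, mul1r, expr1) coefCM coefX !mulr1.
have [h0 ah alt] := hh.
pose d := ((l ^ e) ^ h)%N.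
have glow j : (j < d)%N -> nu (br pi j) <= nu pi.
  move=> hj; have [] // := mulpi_low hnu lP e0 hl piK w0 w1 (phiK0 _ piK0) phiK frob unram
    a0 aO fK f0 f1 hu' alt (brB _ Opi) hj.
have gd : nu (br pi d) = 1 := mulpi_height hnu lP e0 hl piK w0 w1 (phiK0 _ piK0) phiK frob unram
    a0 aO fK f0 f1 hu' h0 ah alt (brB _ Opi).
have gder k : nu (k.+1%:R * br pi k.+1) <= nu pi.
  by have [] := mulpi_deriv hnu lP e0 hl piK w0 w1 (phiK0 _ piK0) phiK frob
    a0 aO fK f0 f1 hu' h0 (brB _ Opi) k.
have q1 : (1 < l ^ e)%N by rewrite -qE card_finNzRing_gt1.
have d1 : (1 < d)%N by rewrite /d -(exp1n h) ltn_exp2r.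
have hcl (V : {vspace N}) : complete_in nu (fun x => x \in V).
  apply: (complete_iff _ (@subspace_complete R Qp N N (idfun : {rmorphism N -> N}) nu hnu hQ V)).
  by move=> x; split=> [[y yV ->]|xV] //; exists x.
have hKLs x : x \in K -> x \in L := subvP hKL x.
have FL i j : F i j \in L /\ nu (F i j) <= 1 by have [? ?] := FK i j; split; [exact: hKLs|].
have brL b : int_ring nu K0 b -> forall i, br b i \in L /\ nu (br b i) <= 1.
  by move=> hb i; have [? ?] := brO b hb i; split; [exact: hKLs|].
(* Writing [pi ^+ s] as [pi ^+ s.-1 * pi], possible as [s >= 1], shows that a zero of [[pi]_F] lies
   in [W^s], all of whose points come from [L]. *)
have W1L x : abs x < 1 -> ps_sum1 iota abs (br pi) x 0 -> exists2 y, y \in L & x = iota y.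
  move=> hx sx; have : Wk s x.
    split=> //.
    have Ops : int_ring nu K0 (pi ^+ s.-1).
      by split; [exact: rpredX|apply: absX_le1 => //; apply: ltW].
    rewrite -(prednK hs) exprSr; apply: (mul_sum_zero habs f1 _ _ _ (brB _ Ops) (brB _ Opi) _ hx sx).
    - by move=> i; case: (brO _ Ops i).
    - by move=> i; case: (brO _ Opi i).
    - by move=> i; case: (brO _ (OM _ _ Ops Opi) i).
    exact: brB _ (OM _ _ Ops Opi).
  by rewrite -hWL => -[_ [y [yL _] <-]]; exists y.
have convL y : max_ideal nu L y -> forall n,
    nu (ps_eval1 idfun nu (br pi) y - ps_trunc1 idfun (br pi) n y) <= nu y ^+ n.
  move=> hy; have [_ _ //] := @ev1_sum R N N (idfun : {rmorphism N -> N}) nu hnu (fun x => x \in L)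
    (fun x y hx hy => rpredB hx hy) (fun x y hx hy => rpredM hx hy) (rpred1 L) (hcl L)
    (br pi) y (brL _ Opi) hy.
have sepL := fm_sep hnu piK0 w0 w1 hcl FL F10 f0 f1 flog brL brB br1.
have [ks [uks sks hks]] := kernel_roots habs hQ (fun i j => proj2 (FK i j)) F10 FC f0 f1 flog
  O1 OB OM (fun b hb i => proj2 (brO b hb i)) brB br1 Opi w0 w1 d1 glow gd gder W1L convL sepL.
have [r [th hth er]] := quotient_mod_pi hnu hK0L piK0 w0 w1 val0 hred hcl FL F10 FC Fassoc f0 f1
  flog brL brB br1 uks hks.
exists 'rV[k0]_r, th; split=> //.
(* The cokernel has [q ^ n * q ^ h] elements with [q = #|k0| > 1], so comparing exponents gives the
   dimension. *)
rewrite dimvf /dim /= mul1n; apply: (expnI (card_finNzRing_gt1 k0)).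
by rewrite er sks /d -qE expnD.
Qed.
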